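(* Let $n\ge 2$, let $p>1$, and let $\Omega\subset\mathbb R^n$ be a bounded domain satisfying the uniform exterior ball condition (with some constants $\delta_1\in(0,1)$ and $r_1>0$). Let $L=a^{ij}D_{ij}+b^iD_i-c$ be an operator whose coefficients are measurable functions on $\mathbb R^n$ satisfying, for some constants $K>0$ and $0<\lambda\le\Lambda<\infty$, $$a^{ij}=a^{ji},\quad \sum_i (b^i)^2\le K,\quad 0\le c\le K,$$ $$\lambda|\xi|^2\le a^{ij}(x)\xi_i\xi_j\le\Lambda|\xi|^2\quad\text{for all } x\in\Omega,\ \xi\in\mathbb R^n.$$ Then there exists at most one $C^2(\Omega)$ (or $W^{2,n}_{loc}(\Omega)$) solution $u$ of the problem $$Lu=u_+^p\ \text{ in }\Omega,\qquad u(x)\to+\infty\ \text{ as } \operatorname{dist}(x,\partial\Omega)\to 0.$$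
   Context: Summation over repeated indices is understood; $D_i=\partial/\partial x_i$, $D_{ij}=\partial^2/\partial x_i\partial x_j$; $t_+=\max(t,0)$. Solutions: $u\in W^{2,n}_{loc}(\Omega)$ is a solution of $Lu=g$ if $Lu=g$ almost everywhere in $\Omega$; functions in $W^{2,n}_{loc}(\Omega)$ are identified with their continuous representatives. $W^{2,q}_{loc}(\Omega)$ is the set of twice weakly differentiable $u$ with $\sum_{|\beta|\le 2}\int_{\Omega'}|D^\beta u|^q<\infty$ for all bounded open $\Omega'$ with $\overline{\Omega'}\subset\Omega$. Uniform exterior ball condition: $\Omega$ satisfies it with constants $\delta_1\in(0,1)$ and $r_1>0$ if for every $x\in\partial\Omega$ and every $0<r<r_1$ there exists a ball $B_\rho(y)\subset B_r(x)\setminus\overline\Omega$ with $\rho=\delta_1 r$. *)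

(* Defs.v *)
From HB Require Import structures.
From mathcomp Require Import all_boot all_order all_algebra.
From mathcomp Require Import all_classical all_reals all_analysis.

Set Implicit Arguments.
Unset Strict Implicit.
Unset Printing Implicit Defensive.

Import Order.TTheory GRing.Theory Num.Theory.
Import numFieldNormedType.Exports.

Local Open Scope classical_set_scope.
Local Open Scope ring_scope.

(* R^n is 'rV[R]_n. The library norm and balls on 'rV[R]_n are those of the
   sup norm: they are used for topological notions only (open, closure,
   bounded, compact, continuous), and metric notions use the Euclidean norm. *)

Definition eucl_norm (R : realType) (n : nat) (x : 'rV[R]_n) : R :=
  Num.sqrt (\sum_(i < n) x 0 i ^+ 2).

Definition eucl_ball (R : realType) (n : nat) (x : 'rV[R]_n) (r : R) :
    set 'rV[R]_n :=
  [set y | eucl_norm (y - x) < r].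

Definition eucl_dist (R : realType) (n : nat) (x : 'rV[R]_n)
    (A : set 'rV[R]_n) : R :=
  inf [set eucl_norm (x - y) | y in A].

Definition boundary (T : topologicalType) (A : set T) : set T :=
  closure A `\` interior A.

Definition uniform_exterior_ball (R : realType) (n : nat)
    (Omega : set 'rV[R]_n) (delta1 r1 : R) : Prop :=
  forall x r, boundary Omega x -> 0 < r < r1 ->
    exists y, eucl_ball y (delta1 * r) `<=` eucl_ball x r `\` closure Omega.

(* Lebesgue measure on R^n: the Caratheodory measure of the outer measure given
   by countable covers by boxes. *)

Definition box (R : realType) (n : nat) (B : 'rV[R]_n * 'rV[R]_n) :
    set 'rV[R]_n :=
  [set x | forall i, B.1 0 i < x 0 i <= B.2 0 i].

(* A box with B.2 0 i <= B.1 0 i for some i is empty and has volume 0. *)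
Definition box_volume (R : realType) (n : nat) (B : 'rV[R]_n * 'rV[R]_n) : R :=
  \prod_(i < n) Num.max (B.2 0 i - B.1 0 i) 0.

(* Covers are indexed by a set K of naturals, so that finite and empty covers
   are allowed, also in dimension 0. *)
Definition lebesgue_outer (R : realType) (n : nat) (A : set 'rV[R]_n) :
    \bar R :=
  ereal_inf [set (\esum_(k in C.1) (box_volume (C.2 k))%:E)%E |
    C in [set C : set nat * (nat -> 'rV[R]_n * 'rV[R]_n) |
      A `<=` \bigcup_(k in C.1) box (C.2 k)]].

Section lebesgue_outer_measure.
Local Open Scope ereal_scope.
Context (R : realType) (n : nat).
Implicit Types (A : set 'rV[R]_n) (B : 'rV[R]_n * 'rV[R]_n).

Lemma box_volume_ge0 B : 0 <= (box_volume B)%:E.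
Proof.
by rewrite lee_fin; apply: prodr_ge0 => i _; rewrite le_max lexx orbT.
Qed.
#[local] Hint Resolve box_volume_ge0 : core.

Lemma lebesgue_outer_ge0 A : 0 <= lebesgue_outer A.
Proof.
by apply: le_ereal_inf_tmp => _ [C _ <-]; apply: esum_ge0.
Qed.

Lemma lebesgue_outer0 : lebesgue_outer (set0 : set 'rV[R]_n) = 0.
Proof.
apply/eqP; rewrite eq_le lebesgue_outer_ge0 andbT.
apply: ereal_inf_lbound; exists (set0, fun=> (0%R, 0%R)) => //=.
by rewrite esum_set0.
Qed.

Lemma le_lebesgue_outer :
  {homo (@lebesgue_outer R n) : A B / A `<=` B >-> A <= B}.
Proof.
move=> A B AB; apply/ereal_inf_le_tmp => x [C BC <-].
by exists C => //; apply: subset_trans AB BC.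
Qed.

Lemma lebesgue_outer_sigma_subadditive :
  sigma_subadditive (@lebesgue_outer R n).
Proof.
move=> A; have [[i ioo]|] := pselect (exists i, lebesgue_outer (A i) = +oo).
  rewrite (eseries_pinfty _ _ ioo) ?leey// => m _.
  by rewrite -ltNye (lt_le_trans _ (lebesgue_outer_ge0 _)).
rewrite -forallNE => Aoo.
suff add2e (e : {posnum R}) : lebesgue_outer (\bigcup_n A n) <=
    \sum_(i <oo) lebesgue_outer (A i) + e%:num%:E.
  by apply/lee_addgt0Pr => _/posnumP[].
rewrite (le_trans _ (epsilon_trick _ _ _))//; last first.
  by move=> m; exact: lebesgue_outer_ge0.
pose P m (C : set nat * (nat -> 'rV[R]_n * 'rV[R]_n)) :=
  A m `<=` \bigcup_(k in C.1) box (C.2 k) /\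
  \esum_(k in C.1) (box_volume (C.2 k))%:E <=
    lebesgue_outer (A m) + (e%:num / (2 ^ m.+1)%:R)%:E.
have [G PG] : {G & forall m, P m (G m)}.
  apply: (@choice _ _ P) => m; rewrite /P.
  have em1 : (0 < e%:num / (2 ^ m.+1)%:R)%R by [].
  have fA : lebesgue_outer (A m) \is a fin_num.
    rewrite fin_numElt (lt_le_trans _ (lebesgue_outer_ge0 _))//=.
    by rewrite ltey; apply/eqP/Aoo.
  have [x [C AC <-] ltx] := lb_ereal_inf_adherent em1 fA.
  by exists C; split=> //; apply: ltW.
have /card_esym/ppcard_eqP[f] := card_nat2.
pose D : set (nat * nat) := [set ij | (G ij.1).1 ij.2].
pose v (ij : nat * nat) := (box_volume ((G ij.1).2 ij.2))%:E.
have DE : D = [set: nat] `*`` (fun i => (G i).1).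
  by apply/seteqP; split=> [[i j] ?|[i j] []].
apply: (@le_trans _ _ (\esum_(ij in D) v ij)).
  apply: ereal_inf_lbound; exists (f @^-1` D, fun m => (G (f m).1).2 (f m).2).
    move=> t [i _ /(PG i).1[j Gj tj]].
    by exists (f^-1%FUN (i, j)); rewrite /= ?invK ?inE.
  rewrite /= (@reindex_esum _ _ _ (f @^-1` D) D f v)//.
  split=> //; [by move=> ? ? _ _; apply: (@inj _ _ _ f); rewrite inE|].
  by move=> y Dy; exists (f^-1%FUN y); rewrite /= ?invK ?inE.
rewrite DE.
rewrite -(@esum_esum _ _ _ _ _ (fun i j => (box_volume ((G i).2 j))%:E))//.
rewrite -nneseries_esumT; last by move=> i; exact: esum_ge0.
by apply: lee_nneseries => [i _ _|i _]; [exact: esum_ge0|exact: (PG i).2].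
Qed.

HB.instance Definition _ := isOuterMeasure.Build R 'rV[R]_n
  (@lebesgue_outer R n) lebesgue_outer0 lebesgue_outer_ge0 le_lebesgue_outer
  lebesgue_outer_sigma_subadditive.

End lebesgue_outer_measure.

Definition lebesgue_om (R : realType) (n : nat) :
    {outer_measure set 'rV[R]_n -> \bar R} := @lebesgue_outer R n.

(* 'rV[R]_n equipped with the sigma-algebra of Lebesgue measurable sets *)
Notation leb_rV R n := (caratheodory_type (lebesgue_om R n)).

Definition lebesgue_rV (R : realType) (n : nat) :
    {measure set (leb_rV R n) -> \bar R} :=
  (lebesgue_om R n : set (leb_rV R n) -> \bar R).
Arguments lebesgue_rV {R n}.

(* [partials [:: i1; ...; ik] f] is D_i1 (... (D_ik f)). *)
Definition partials (R : realType) (n : nat) (s : seq 'I_n)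
    (f : 'rV[R]_n -> R) : 'rV[R]_n -> R :=
  foldr (fun i g => 'D_(delta_mx 0 i) g) f s.

Definition Ck_on (R : realType) (n k : nat) (Omega : set 'rV[R]_n)
    (f : 'rV[R]_n -> R) : Prop :=
  forall x, Omega x -> forall s : seq 'I_n,
    ((size s <= k)%N -> {for x, continuous (partials s f)}) /\
    ((size s < k)%N ->
      forall i, derivable (partials s f) x (delta_mx 0 i)).

Definition test_function (R : realType) (n : nat) (Omega : set 'rV[R]_n)
    (phi : 'rV[R]_n -> R) : Prop :=
  (forall k, Ck_on k [set: 'rV[R]_n] phi) /\
  let supp := closure [set x | phi x != 0] in
  compact supp /\ supp `<=` Omega.

Definition Lq_loc (R : realType) (n : nat) (Omega : set 'rV[R]_n) (q : R)
    (v : 'rV[R]_n -> R) : Prop :=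
  measurable_fun (Omega : set (leb_rV R n)) (v : leb_rV R n -> R) /\
  forall Omega' : set 'rV[R]_n,
    bounded_set Omega' -> open Omega' -> closure Omega' `<=` Omega ->
    (\int[lebesgue_rV]_(x in Omega') (`|v x| `^ q)%:E < +oo)%E.

Definition weak_partials (R : realType) (n : nat) (Omega : set 'rV[R]_n)
    (s : seq 'I_n) (u v : 'rV[R]_n -> R) : Prop :=
  [/\ Lq_loc Omega 1 u, Lq_loc Omega 1 v &
    forall phi, test_function Omega phi ->
      \int[lebesgue_rV]_(x in Omega) (u x * partials s phi x) =
      (-1) ^+ size s * \int[lebesgue_rV]_(x in Omega) (v x * phi x)].

Definition W2q_loc (R : realType) (n : nat) (Omega : set 'rV[R]_n) (q : R)
    (u : 'rV[R]_n -> R) : Prop :=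
  Lq_loc Omega q u /\
  forall s : seq 'I_n, (1 <= size s <= 2)%N ->
    exists2 v, weak_partials Omega s u v & Lq_loc Omega q v.

(* L u = a^{ij} D_{ij} u + b^i D_i u - c u at x, where d s x stands for the
   derivative of u at x with respect to the indices in s. *)
Definition nondiv_op (R : realType) (n : nat)
    (a : 'I_n -> 'I_n -> 'rV[R]_n -> R) (b : 'I_n -> 'rV[R]_n -> R)
    (c : 'rV[R]_n -> R) (u : 'rV[R]_n -> R)
    (d : seq 'I_n -> 'rV[R]_n -> R) (x : 'rV[R]_n) : R :=
  \sum_(i < n) \sum_(j < n) a i j x * d [:: i; j] x +
  \sum_(i < n) b i x * d [:: i] x - c x * u x.

Definition W2n_solution (R : realType) (n : nat)
    (a : 'I_n -> 'I_n -> 'rV[R]_n -> R) (b : 'I_n -> 'rV[R]_n -> R)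
    (c : 'rV[R]_n -> R) (Omega : set 'rV[R]_n) (u g : 'rV[R]_n -> R) : Prop :=
  [/\ forall x, Omega x -> {for x, continuous u},
      W2q_loc Omega n%:R u &
      exists2 d : seq 'I_n -> 'rV[R]_n -> R,
        forall s, (1 <= size s <= 2)%N -> weak_partials Omega s u (d s) &
        {ae (@lebesgue_rV R n), forall x,
          Omega x -> nondiv_op a b c u d x = g x}].

Definition C2_solution (R : realType) (n : nat)
    (a : 'I_n -> 'I_n -> 'rV[R]_n -> R) (b : 'I_n -> 'rV[R]_n -> R)
    (c : 'rV[R]_n -> R) (Omega : set 'rV[R]_n) (u g : 'rV[R]_n -> R) : Prop :=
  Ck_on 2 Omega u /\
  {ae (@lebesgue_rV R n), forall x,
    Omega x -> nondiv_op a b c u (fun s => partials s u) x = g x}.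

Definition boundary_blowup (R : realType) (n : nat) (Omega : set 'rV[R]_n)
    (u : 'rV[R]_n -> R) : Prop :=
  forall M : R, exists2 delta : R, 0 < delta &
    forall x, Omega x -> eucl_dist x (boundary Omega) < delta -> M < u x.

Definition pos_power (R : realType) (T : Type) (p : R) (u : T -> R) (x : T) : R
  := Num.max (u x) 0 `^ p.

(* Main.v *)
(* Two solutions u and v are compared through radial barriers at the boundary
   rate r^(-2/(p-1)). If y is the centre of an exterior ball, a function
   A(|x-y|^(-2m) - Q^(-m)) is a subsolution below u, so that u >= c r^(-2/(p-1))
   at distance at most r from the boundary; A(r^2-|x-x0|^2)^(-m) is a
   supersolution in an interior ball, so that u <= C r^(-2/(p-1)) at its centre.
   Hence u/v is bounded. Suppose that k* = sup u/v > 1, and let u(x0) > k v(x0)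
   with k close to k*. As k^p > k, the function w = u - k v satisfies
   L w >= c1 r^(-2/(p-1)-2) where w > 0, on a ball around x0 whose radius r is
   comparable to the distance of x0 to the boundary. So
   w - theta r^(-2/(p-1)) |x-x0|^2/r^2 attains its maximum over the ball on the
   sphere, at a point where u > (k+theta') v with theta' independent of k, which
   is impossible for k > k* - theta'.

   The equation enters only through the fact that a combination of u and v is
   not touched from above by a strict supersolution. For W^{2,n}_loc solutions
   this is an Aleksandrov-Bakelman-Pucci argument without area formula: after
   mollification at scale s, the slopes of the contact points fill a fixed cube;
   on a cell of side s the Hessian at a contact point, raised to the power n and
   multiplied by s^n, is at most the mean oscillation of the weak derivatives
   around the cell, so that the slopes of the contact points of this cell lie in
   a box of that volume; and the sum of these oscillations over the grid tends
   to 0 with s, because the weak derivatives are in L^n. *)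

(* The equation holds almost everywhere and the coefficients are only measurable, so it can never be
   evaluated at a chosen maximum point, not even for C^2 solutions. All uses of it pass through
   [touch_subsolution], proved for every combination s u + t v: the lower barrier needs -v, the
   upper barriers need u and v, the comparison needs u - k v. After that the two classes of
   solutions are treated alike. For C^2 solutions it is enough to move to a nearby point where the
   equation holds, by continuity of the second derivatives; only the W^{2,n} case needs the covering
   argument.

   The supremum of u/v need not be attained, and blow-up gives no boundary value for the ratio. What
   replaces attainment is scale invariance: since [growth r] to the power p equals
   [growth r / r ^+ 2], the nonlinearity, the operator and the bounds on u and v all scale alike on
   a ball of radius comparable to the distance to the boundary. Hence the gain theta' depends
   neither on the point nor on k, and one near-extremal point suffices. The sign of c enters through
   c w >= 0 where w > 0. *)
Require Import Defs.
From mathcomp Require Import all_boot all_order all_algebra.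
From mathcomp Require Import all_classical all_reals all_analysis.
From mathcomp Require Import measurable_realfun.
From mathcomp Require Import lra ring zify.

Set Implicit Arguments.
Unset Strict Implicit.
Unset Printing Implicit Defensive.

Import Order.TTheory GRing.Theory Num.Theory.
Import numFieldNormedType.Exports.

Local Open Scope classical_set_scope.
Local Open Scope ring_scope.

(** * Lebesgue measure of boxes *)

Section lebesgue_measure_rV.
Context {R : realType} {n : nat}.
Implicit Types (x y : 'rV[R]_n) (B : 'rV[R]_n * 'rV[R]_n) (A : set 'rV[R]_n).

Definition row_set x (i : 'I_n) (t : R) : 'rV[R]_n :=
  \row_j (if j == i then t else x 0 j).

Lemma row_setE x i t j : row_set x i t 0 j = if j == i then t else x 0 j.
Proof. by rewrite mxE. Qed.

(** Cutting by a hyperplane preserves volume, which is what Caratheodory's criterion for a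
    half-space asks of each box of a cover. Truncation by [min] and [max] also covers a hyperplane
    that misses the box: one piece then has volume 0. *)
Lemma box_volume_split B i t :
  box_volume B = box_volume (B.1, row_set B.2 i (Num.min (B.2 0 i) t)) +
                 box_volume (row_set B.1 i (Num.max (B.1 0 i) t), B.2).
Proof.
rewrite /box_volume (bigD1 i)//= [in X in _ = X + _](bigD1 i)//=.
rewrite [in X in _ = _ + X](bigD1 i)//= !row_setE eqxx.
rewrite [X in _ = _ * X + _](_ : _ =
    \prod_(j < n | j != i) Num.max (B.2 0 j - B.1 0 j) 0); last first.
  by apply: eq_bigr => j /negbTE ji; rewrite row_setE ji.
rewrite [X in _ = _ + _ * X](_ : _ =
    \prod_(j < n | j != i) Num.max (B.2 0 j - B.1 0 j) 0); last first.
  by apply: eq_bigr => j /negbTE ji; rewrite row_setE ji.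
rewrite -mulrDl; congr (_ * _).
rewrite /Num.max /Num.min; repeat case: ifPn; lra.
Qed.

Lemma measurable_halfspace i t :
  measurable ([set x : 'rV[R]_n | x 0 i <= t] : set (leb_rV R n)).
Proof.
apply: le_caratheodory_measurable => X.
apply: le_ereal_inf_tmp => _ [[J C] /= XC <-].
under eq_esum do rewrite (box_volume_split (C _) i t) EFinD.
rewrite esumD; [|by move=> k _; exact: box_volume_ge0..].
apply: leeD; apply: ereal_inf_lbound.
  exists (J, fun k => ((C k).1, row_set (C k).2 i (Num.min ((C k).2 0 i) t))) => //=.
  move=> x [/XC [k Jk Ckx] /= xt]; exists k => //= j; rewrite row_setE.
  have /andP[? ?] := Ckx j; case: eqP => [->|_]; last by apply/andP.
  by have /andP[? ?] := Ckx i; rewrite le_min; apply/and3P.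
exists (J, fun k => (row_set (C k).1 i (Num.max ((C k).1 0 i) t), (C k).2)) => //=.
move=> x [/XC [k Jk Ckx] /= /negP xt]; exists k => //= j; rewrite row_setE.
have /andP[? ?] := Ckx j; case: eqP => [->|_]; last by apply/andP.
have /andP[? ?] := Ckx i; rewrite gt_max; apply/andP; split=> //.
by apply/andP; split=> //; rewrite ltNge.
Qed.

Lemma measurable_coord i :
  measurable_fun setT (fun x : leb_rV R n => (x : 'rV[R]_n) 0 i).
Proof.
apply: measurability; [exact: RGenOInfty.measurableE|].
move=> _ [_ [t ->] <-]; rewrite setTI.
rewrite [X in measurable X](_ : _ = ~` [set x : 'rV[R]_n | x 0 i <= t]).
  by apply: measurableC; exact: measurable_halfspace.
by apply/seteqP; split=> x /=; rewrite in_itv/= andbT ltNge => /negP.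
Qed.

Lemma measurable_box B : measurable (box B : set (leb_rV R n)).
Proof.
rewrite [X in measurable X](_ : _ = \bigcap_(i in [set: 'I_n])
   ((fun x : leb_rV R n => (x : 'rV[R]_n) 0 i) @^-1` `]B.1 0 i, B.2 0 i])).
  apply: fin_bigcap_measurable => // i _.
  by rewrite -[X in measurable X]setTI; exact: measurable_coord.
apply/seteqP; split=> [x Bx i _|x Bx i]; first by rewrite /= in_itv/=; exact: Bx.
by have := Bx i I; rewrite /= in_itv.
Qed.

(** An open set is the countable union of the boxes with rational corners that it contains; in the
    union over all rational boxes the others are replaced by the empty set. *)
Lemma measurable_open_rV A : open A -> measurable (A : set (leb_rV R n)).
Proof.
move=> oA.
pose F (ab : 'rV[rat]_n * 'rV[rat]_n) : set (leb_rV R n) :=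
  let B := box (map_mx ratr ab.1 : 'rV[R]_n, map_mx ratr ab.2 : 'rV[R]_n) in
  if pselect (B `<=` A) then B else set0.
rewrite [X in measurable X](_ : _ = \bigcup_ab F ab); last first.
  apply/seteqP; split=> [x Ax|x [ab _]]; last first.
    by rewrite /F; case: pselect => //= BA; exact: BA.
  have /nbhs_ballP[e /= e0 xeA] : nbhs x A by exact: open_nbhs_nbhs.
  have exa i : exists q : rat, ratr q \in `]x 0 i - e, x 0 i[.
    by apply: rat_in_itvoo; rewrite ltrBlDr ltrDl.
  have exb i : exists q : rat, ratr q \in `]x 0 i, x 0 i + e[.
    by apply: rat_in_itvoo; rewrite ltrDl.
  have [qa qaP] := choice exa; have [qb qbP] := choice exb.
  exists (\row_i qa i, \row_i qb i) => //; rewrite /F; case: pselect => /= [_ i|nBA].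
    rewrite !mxE; have := qaP i; have := qbP i; rewrite !in_itv/=; lra.
  exfalso; apply: nBA => y By; apply: xeA; split=> // i j; rewrite ord1.
  have := By j; have := qaP j; have := qbP j; rewrite /= !mxE !in_itv/= /ball/=.
  rewrite ltr_norml; lra.
apply: countable_bigcupT_measurable => // ab.
by rewrite /F/=; case: pselect => //= _; exact: measurable_box.
Qed.

(** The indices of grid points in the interval lie between the least and the greatest such index,
    whose distance is at most the length of the interval over the step; the 1 counts both ends. *)
Lemma card_grid_interval (N : nat) (a w l u : R) : 0 < w ->
  #|[set j : 'I_N.+1 | (l < a + w * j%:R / N.+1%:R < u)%R]%SET|%:R <=
    N.+1%:R * (Num.max (u - l) 0 / w) + 1.
Proof.
move=> w0; set P := [set _ | _]%SET.
have N0 : 0 < N.+1%:R :> R by rewrite ltr0n.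
have [P0|[j0 j0P]] := set_0Vmem P.
  rewrite P0 cards0 addr_ge0// mulr_ge0// divr_ge0 ?(ltW w0)//.
  by rewrite le_max lexx orbT.
case: (arg_minnP (fun j : 'I_N.+1 => val j) j0P) => i iP imin'.
case: (arg_maxnP (fun j : 'I_N.+1 => val j) j0P) => k kP kmax'.
have imin (j : 'I_N.+1) : j \in P -> (i <= j)%N by exact: imin'.
have kmax (j : 'I_N.+1) : j \in P -> (j <= k)%N by exact: kmax'.
have cP : (#|P| <= (k - i).+1)%N.
  rewrite -[X in (_ <= X)%N]card_ord.
  rewrite -(@card_in_imset _ _ (fun j : 'I_N.+1 => inord (j - i) : 'I_(k - i).+1)).
    exact: max_card.
  move=> j j' jP j'P /(congr1 val); rewrite /= !inordK ?ltnS ?leq_sub2r ?kmax//.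
  have := imin _ jP; have := imin _ j'P => /= ? ? ?; apply: val_inj => /=; lia.
have ik : (i <= k)%N by exact: imin.
have : (#|P|%:R : R) <= (k - i).+1%:R by rewrite ler_nat.
move/le_trans; apply; rewrite -natr1 natrB// lerD2r.
have : i \in P by []; have : k \in P by []; rewrite !inE => /andP[_ ku] /andP[li _].
have h : w * (k%:R - i%:R) / N.+1%:R <= Num.max (u - l) 0.
  rewrite le_max; apply/orP; left; rewrite mulrBr mulrBl.
  by move: (w * _ / _) (w * _ / _) ku li => X Y ? ?; lra.
by rewrite mulrA ler_pdivlMr// mulrC [leRHS]mulrC -ler_pdivrMr.
Qed.

(** Volumes are compared by counting points of a fine grid: each grid point lies in some box of the
    cover, and a box holds about as many grid points as its volume predicts. The counting error
    vanishes as the grid is refined. It serves for the measure of boxes and, at the end of the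
    contact argument, for the box of slopes. *)
Lemma finite_box_cover_volume (a b : 'rV[R]_n) (s : seq ('rV[R]_n * 'rV[R]_n)) :
  (forall i, a 0 i < b 0 i) ->
  (forall x, (forall i, a 0 i <= x 0 i <= b 0 i) ->
     exists2 B, B \in s & forall i, B.1 0 i < x 0 i < B.2 0 i) ->
  \prod_i (b 0 i - a 0 i) <= \sum_(B <- s) box_volume B.
Proof.
move=> ab cov; pose w i := b 0 i - a 0 i.
have w0 i : 0 < w i by rewrite subr_gt0.
pose m (B : 'rV[R]_n * 'rV[R]_n) i := Num.max (B.2 0 i - B.1 0 i) 0.
pose pt (N : nat) (k : {ffun 'I_n -> 'I_N.+1}) : 'rV[R]_n :=
  \row_i (a 0 i + w i * (k i)%:R / N.+1%:R).
have count N : \prod_i w i <= \sum_(B <- s) \prod_i (m B i + w i * N.+1%:R^-1).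
  have N0 : 0 < N.+1%:R :> R by rewrite ltr0n.
  pose P B i := [set j : 'I_N.+1 | (B.1 0 i < a 0 i + w i * j%:R / N.+1%:R < B.2 0 i)%R]%SET.
  (* Double counting of the pairs of a grid point and a box containing it; each grid point occurs at
     least once. *)
  have h1 : (N.+1 ^ n)%:R <= \sum_(B <- s) \prod_i (#|P B i|%:R : R).
    have -> : (N.+1 ^ n)%N = #|{ffun 'I_n -> 'I_N.+1}| by rewrite card_ffun !card_ord.
    rewrite -sum1_card natr_sum.
    have -> : \sum_(B <- s) \prod_i (#|P B i|%:R : R) =
        \sum_(B <- s) \sum_(k : {ffun 'I_n -> 'I_N.+1}) \prod_i (k i \in P B i)%:R.
      apply: eq_bigr => B _; rewrite -(bigA_distr_bigA (fun i (j : 'I_N.+1) => (j \in P B i)%:R : R)).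
      apply: eq_bigr => i _.
      by rewrite -sum1_card natr_sum big_mkcond/=; apply: eq_bigr => j _; case: ifP.
    rewrite exchange_big/=; apply: ler_sum => k _.
    have [|B Bs Bk] := cov (pt N k).
      move=> i; rewrite !mxE; have /ltW wi := w0 i.
      have kN : (k i)%:R / N.+1%:R <= 1 :> R.
        by rewrite ler_pdivrMr// mul1r ler_nat ltnW.
      have kN0 : 0 <= (k i)%:R / N.+1%:R :> R by rewrite divr_ge0// ltW.
      rewrite -mulrA; have := ler_wpM2l wi kN; have := mulr_ge0 wi kN0.
      by move: (w i * _) => q; rewrite mulr1 /w => ? ?; lra.
    rewrite (big_rem _ Bs)/= big1 ?lerDl; last first.
      by move=> i _; rewrite inE; have := Bk i; rewrite mxE => ->.
    by apply: sumr_ge0 => ? _; apply: prodr_ge0 => ? _; rewrite ler0n.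
  have h2 : (N.+1 ^ n)%:R <= \sum_(B <- s) \prod_i (N.+1%:R * (m B i / w i) + 1).
    apply: (le_trans h1); apply: ler_sum => B _; apply: ler_prod => i _.
    by rewrite ler0n/=; exact: card_grid_interval.
  have W0 : 0 < \prod_i w i / N.+1%:R ^+ n by rewrite divr_gt0 ?exprn_gt0//; exact: prodr_gt0.
  have := ler_wpM2r (ltW W0) h2; rewrite natrX mulrCA divff ?mulr1 ?expf_neq0 ?gt_eqF//.
  move/le_trans; apply; rewrite mulr_suml; apply: ler_sum => B _.
  rewrite [X in _ / X](_ : _ = \prod_(i < n) N.+1%:R); last by rewrite prodr_const card_ord.
  rewrite -prodfV -!big_split/=; apply: ler_prod => i _.
  have wi := w0 i; have mi : 0 <= m B i by rewrite /m le_max lexx orbT.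
  rewrite [X in _ && (_ <= X)](_ : _ = (N.+1%:R * (m B i / w i) + 1) * (w i / N.+1%:R)).
    rewrite lexx andbT mulr_ge0 ?divr_ge0 ?(ltW wi) ?(ltW N0)//.
    by rewrite addr_ge0// mulr_ge0 ?(ltW N0)// divr_ge0 ?(ltW wi).
  by field; rewrite !gt_eqF//=.
have -> : \sum_(B <- s) box_volume B = \sum_(B <- s) \prod_i (m B i + w i * 0).
  by apply: eq_bigr => B _; apply: eq_bigr => i _; rewrite mulr0 addr0.
have cv : (fun N => \sum_(B <- s) \prod_i (m B i + w i * harmonic N)) @ \oo -->
    \sum_(B <- s) \prod_i (m B i + w i * 0); last first.
  by apply: (cvgr_to_ge cv); apply: nearW => N; exact: count.
apply: cvg_big => [|B _]; first exact: add_continuous.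
apply: cvg_big => [|i _]; first exact: mul_continuous.
apply: cvgD; first exact: cvg_cst.
by apply: cvgMr; exact: cvg_harmonic.
Qed.

(** Pushing out the upper corners turns a cover by half-open boxes into an open one at small cost,
    as compactness requires. *)
Lemma box_volume_enlarge B (e : R) : 0 < e ->
  exists2 d : R, 0 < d &
    box_volume (B.1, B.2 + const_mx d) <= box_volume B + e.
Proof.
move=> e0.
have cv : (fun t => \prod_i Num.max (B.2 0 i - B.1 0 i + t) 0) @ (0 : R) -->
    \prod_i Num.max (B.2 0 i - B.1 0 i + 0) 0.
  apply: cvg_big => [|i _]; first exact: mul_continuous.
  apply: continuous_max; last exact: cvg_cst.
  by apply: cvgD; [exact: cvg_cst|exact: cvg_id].
have -> : box_volume B = \prod_i Num.max (B.2 0 i - B.1 0 i + 0) 0.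
  by apply: eq_bigr => i _; rewrite addr0.
have /cvgr_le h := cvg_at_right_filter cv.
have {}h := h _ (ltr_pwDr e0 (lexx _)).
near (0 : R)^'+ => d.
exists d => //; rewrite [leLHS](_ : _ = \prod_i Num.max (B.2 0 i - B.1 0 i + d) 0).
  by near: d.
by apply: eq_bigr => i _; rewrite !mxE addrAC.
Unshelve. all: by end_near.
Qed.

Lemma box_volume_lt (a b : 'rV[R]_n) : (forall i, a 0 i < b 0 i) ->
  box_volume (a, b) = \prod_i (b 0 i - a 0 i).
Proof. by move=> ab; apply: eq_bigr => i _; apply/max_idPl; rewrite subr_ge0 ltW. Qed.

Lemma lebesgue_box_le B : (lebesgue_rV (box B : set (leb_rV R n)) <= (box_volume B)%:E)%E.
Proof.
apply: ereal_inf_lbound; exists ([set 0%N], fun=> B) => /=; first by move=> x; exists 0%N.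
by rewrite esum_set1//; exact: box_volume_ge0.
Qed.

Lemma open_open_box (a b : 'rV[R]_n) :
  open [set x : 'rV[R]_n | forall i, a 0 i < x 0 i < b 0 i].
Proof.
rewrite openE => x /= xab.
apply: (@filter_forall _ _ (fun i (y : 'rV[R]_n) => a 0 i < y 0 i < b 0 i) (nbhs x)) => i.
have cx : (fun y : 'rV[R]_n => y 0 i) @ x --> x 0 i by exact: coord_continuous.
have /andP[ax xb] := xab i; near=> y; apply/andP; split; near: y.
  exact: (cvgr_gt _ cx).
exact: (cvgr_lt _ cx).
Unshelve. all: by end_near.
Qed.

Lemma compact_closed_box (a b : 'rV[R]_n) :
  compact [set x : 'rV[R]_n | forall i, a 0 i <= x 0 i <= b 0 i].
Proof.
rewrite [X in compact X](_ : _ =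
    [set x : 'rV[R]_n | forall i, x ord0 i \in `[a ord0 i, b ord0 i]]).
  apply: (@rV_compact _ _ (fun i => `[a ord0 i, b ord0 i]%classic)) => i.
  exact: segment_compact.
by apply/seteqP; split=> x /= xab i; have := xab i; rewrite in_itv.
Qed.

Lemma lebesgue_box_ge (a b : 'rV[R]_n) : (forall i, a 0 i < b 0 i) ->
  ((\prod_i (b 0 i - a 0 i))%:E <= lebesgue_rV (box (a, b) : set (leb_rV R n)))%E.
Proof.
move=> ab; pose w i := b 0 i - a 0 i.
have w0 i : 0 < w i by rewrite subr_gt0.
apply: le_ereal_inf_tmp => _ [[J C] /= abC <-].
(* The half-open box is not compact: its lower faces are moved inwards by the fraction t of each
   side, the closed box is covered by finitely many enlarged boxes, and t tends to 0. *)
suff shrink (t : R) : 0 < t < 1 ->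
    ((\prod_i (w i * (1 - t)))%:E <= \esum_(k in J) (box_volume (C k))%:E)%E.
  have cv : (fun t => \prod_i (w i * (1 - t))) @ (0 : R) --> \prod_i (w i * (1 - 0)).
    apply: cvg_big => [|i _]; first exact: mul_continuous.
    apply: cvgMr; apply: cvgB; [exact: cvg_cst|exact: cvg_id].
  case E : (\esum_(k in J) (box_volume (C k))%:E)%E => [r| |]; last 2 first.
  - by rewrite leey.
  - have : (0 <= \esum_(k in J) (box_volume (C k))%:E)%E.
      by apply: esum_ge0 => k _; exact: box_volume_ge0.
    by rewrite E.
  rewrite lee_fin (_ : \prod_i _ = \prod_i (w i * (1 - 0))); last first.
    by apply: eq_bigr => i _; rewrite subr0 mulr1.
  apply: (cvgr_to_le (cvg_at_right_filter cv)).
  near=> t; rewrite -lee_fin -E shrink//; apply/andP; split => //.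
move=> /andP[t0 t1]; apply/lee_addgt0Pr => e e0.
have /choice[d dP] : forall k, exists d : R, 0 < d /\
    box_volume ((C k).1, (C k).2 + const_mx d) <= box_volume (C k) + e / (2 ^ k.+1)%:R.
  move=> k; have ek : 0 < e / (2 ^ k.+1)%:R by rewrite divr_gt0// ltr0n expn_gt0.
  by have [d d0 dle] := box_volume_enlarge (C k) ek; exists d.
pose D k := ((C k).1, (C k).2 + const_mx (d k)).
pose a' : 'rV[R]_n := \row_i (a 0 i + w i * t).
pose A := [set x : 'rV[R]_n | forall i, a' 0 i <= x 0 i <= b 0 i].
have cA : compact A by exact: compact_closed_box.
rewrite compact_cover in cA.
pose O k := [set x : 'rV[R]_n | forall i, (D k).1 0 i < x 0 i < (D k).2 0 i].
have [|x Ax|F FJ AF] := cA _ J O.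
- by move=> k _; exact: open_open_box.
- have [|k Jk Ckx] := abC x.
    move=> i /=; have := Ax i; rewrite !mxE => /andP[h ->]; rewrite andbT.
    by apply: lt_le_trans h; rewrite ltrDl mulr_gt0.
  exists k => // i; have /andP[h1 h2] := Ckx i; rewrite /D/= h1/= !mxE.
  by rewrite (le_lt_trans h2)// ltrDl; exact: (dP k).1.
pose F' : seq nat := finmap.enum_fset F.
have uF' : uniq F' by exact: finmap.fset_uniq.
have fv : \prod_i (w i * (1 - t)) <= \sum_(B <- [seq D k | k <- F']) box_volume B.
  rewrite (_ : \prod_i _ = \prod_i (b 0 i - a' 0 i)); last first.
    by apply: eq_bigr => i _; rewrite !mxE /w; ring.
  apply: finite_box_cover_volume.
    move=> i; rewrite mxE -ltrBrDl -/(w i) gtr_pMr//.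
  move=> x xA; have [k kF Okx] := AF x xA.
  by exists (D k); [apply/mapP; exists k|exact: Okx].
rewrite -lee_fin in fv; apply: (le_trans fv); rewrite big_map -sumEFin.
apply: (@le_trans _ _ (\sum_(k <- F') ((box_volume (C k))%:E + (e / (2 ^ k.+1)%:R)%:E))%E).
  by apply: lee_sum => k _; rewrite -EFinD lee_fin; exact: (dP k).2.
rewrite big_split/=; apply: leeD.
  apply: esum_ge; exists [set` F']; last by rewrite fsbig_seq.
  by split; [exact: finite_seq|move=> k /= kF; have := FJ _ kF; rewrite inE].
have := @epsilon_trick R (fun=> 0%E) e xpredT (fun=> lexx _) (ltW e0).
rewrite [X in (_ <= X + _)%E -> _]eseries0// add0e; apply: le_trans.
rewrite nneseries_esumT; last first.
  by move=> k; rewrite add0e lee_fin divr_ge0// ltW.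
apply: esum_ge; exists [set` F']; first by split; [exact: finite_seq|].
by rewrite -fsbig_seq//; apply: lee_sum => k _; rewrite add0e.
Unshelve. all: by end_near.
Qed.

Lemma lebesgue_box (a b : 'rV[R]_n) : (forall i, a 0 i < b 0 i) ->
  lebesgue_rV (box (a, b) : set (leb_rV R n)) = (\prod_i (b 0 i - a 0 i))%:E.
Proof.
move=> ab; apply/eqP; rewrite eq_le lebesgue_box_ge// andbT -box_volume_lt//.
exact: lebesgue_box_le.
Qed.

Lemma lebesgue_outer_translate_le (h : 'rV[R]_n) A :
  (lebesgue_outer [set x | A (x + h)%R] <= lebesgue_outer A)%E.
Proof.
apply: le_ereal_inf_tmp => _ [[J C] /= AC <-].
apply: ereal_inf_lbound; exists (J, fun k => ((C k).1 - h, (C k).2 - h)) => /=.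
  move=> x /= /AC[k Jk Ckx]; exists k => // i /=.
  by have := Ckx i; rewrite !mxE; lra.
apply: eq_esum => k _; congr EFin; apply: eq_bigr => i _.
by rewrite !mxE opprD addrACA subrr addr0.
Qed.

Lemma lebesgue_outer_translate (h : 'rV[R]_n) A :
  lebesgue_outer [set x | A (x + h)] = lebesgue_outer A.
Proof.
apply/eqP; rewrite eq_le lebesgue_outer_translate_le/=.
have := lebesgue_outer_translate_le (- h) [set x | A (x + h)].
apply: le_trans; rewrite (_ : [set x | _] = A)//.
by apply/seteqP; split=> x /=; rewrite subrK.
Qed.

Lemma measurable_translate (h : 'rV[R]_n) :
  measurable_fun setT (fun x : leb_rV R n => (x : 'rV[R]_n) + h : leb_rV R n).
Proof.
move=> _ A mA; rewrite setTI.
suff : (lebesgue_om R n).-caratheodory ((fun x => x + h) @^-1` A) by [].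
move=> X; have := mA [set x | X (x - h)].
rewrite /lebesgue_om/= lebesgue_outer_translate => ->.
rewrite -(lebesgue_outer_translate h (_ `&` A)) -(lebesgue_outer_translate h (_ `&` ~` A)).
congr (_ + _); congr lebesgue_outer; by apply/seteqP; split=> x /=; rewrite addrK.
Qed.

(** Needed so that a kernel has the same mass around every centre, and mollification fixes
    constants. *)
Lemma ge0_integral_translate (h : 'rV[R]_n) (f : leb_rV R n -> \bar R) :
  measurable_fun [set: leb_rV R n] f -> (forall x, 0 <= f x)%E ->
  (\int[lebesgue_rV]_x f ((x : 'rV[R]_n) + h)%R = \int[lebesgue_rV]_x f x)%E.
Proof.
move=> mf f0.
pose m1 : {measure set (leb_rV R n) -> \bar R} :=
  measure_function_pushforward__canonical__measure_function_Measure
    lebesgue_rV (measurable_translate h).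
have m1E : (\int[m1]_x f x = \int[lebesgue_rV]_x f x)%E.
  apply: (@eq_measure_integral _ _ _ _ lebesgue_rV m1) => A mA _.
  exact: lebesgue_outer_translate.
rewrite -m1E.
exact/esym/(@ge0_integral_pushforward _ _ _ _ R _ (measurable_translate h) lebesgue_rV setT f).
Qed.

End lebesgue_measure_rV.

(** * Mean oscillation on grids *)

Section integral_aux.
Context d (T : measurableType d) (R : realType) (mu : {measure set T -> \bar R}).
Implicit Types (D : set T) (F G H : T -> R).

Lemma measurable_absX D F (q : nat) : measurable_fun D F ->
  measurable_fun D (fun x => `|F x| ^+ q).
Proof. by move=> mF; apply: measurable_funX; exact: measurableT_comp. Qed.

Lemma ge0_le_integral_comb D F G H (A B : R) : measurable D ->
  0 <= A -> 0 <= B ->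
  measurable_fun D F -> measurable_fun D G -> measurable_fun D H ->
  (forall x, D x -> 0 <= F x) -> (forall x, D x -> 0 <= G x) ->
  (forall x, D x -> 0 <= H x) ->
  (forall x, D x -> F x <= A * G x + B * H x) ->
  (\int[mu]_(x in D) (F x)%:E <=
    A%:E * \int[mu]_(x in D) (G x)%:E + B%:E * \int[mu]_(x in D) (H x)%:E)%E.
Proof.
move=> mD A0 B0 mF mG mH F0 G0 H0 FGH.
have mEG : measurable_fun D (fun x => (G x)%:E) by exact/measurable_EFinP.
have mEH : measurable_fun D (fun x => (H x)%:E) by exact/measurable_EFinP.
rewrite -ge0_integralZl_EFin// -ge0_integralZl_EFin//.
rewrite -ge0_integralD//; last 4 first.
- by move=> x Dx; rewrite lee_fin mulr_ge0// G0.
- by apply: measurable_funeM.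
- by move=> x Dx; rewrite lee_fin mulr_ge0// H0.
- by apply: measurable_funeM.
apply: ge0_le_integral => //.
- exact/measurable_EFinP.
- by apply: emeasurable_funD; apply: measurable_funeM.
Qed.

End integral_aux.

Lemma exprD_le_2 (R : realType) (a b : R) (q : nat) : 0 <= a -> 0 <= b ->
  (a + b) ^+ q <= 2 ^+ q * (a ^+ q + b ^+ q).
Proof.
move=> a0 b0; wlog ab : a b a0 b0 / a <= b.
  move=> H; have [/H->//|/ltW ba] := leP a b.
  by rewrite addrC [X in _ * X]addrC H.
apply: (@le_trans _ _ ((2 * b) ^+ q)).
  by apply: lerXn2r; rewrite ?nnegrE ?addr_ge0 ?mulr_ge0//; lra.
by rewrite exprMn ler_wpM2l// ?exprn_ge0// lerDr exprn_ge0.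
Qed.

Lemma exprD_le (R : realType) (a b c : R) (q : nat) : `|c| <= a + b ->
  0 <= a -> 0 <= b -> `|c| ^+ q <= 2 ^+ q * a ^+ q + 2 ^+ q * b ^+ q.
Proof.
move=> cab a0 b0; rewrite -mulrDr; apply: le_trans (exprD_le_2 q a0 b0).
by apply: lerXn2r; rewrite ?nnegrE// addr_ge0.
Qed.

#[local] Opaque lebesgue_rV.

Section mean_oscillation.
Context {R : realType} {n : nat}.
Variables (c : 'rV[R]_n) (rho : R).
Local Notation mu := (@lebesgue_rV R n).

Definition cube (r : R) : set (leb_rV R n) := box (c - const_mx r, c + const_mx r).

Definition mesh (N : nat) : R := 2 * rho / N.+1%:R.

(* The cell of index [f] of the grid with [N.+1] cells per side on
   [cube rho], enlarged by [k] mesh sizes on every side. *)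
Definition cell (N : nat) (k : R) (f : {ffun 'I_n -> 'I_N.+1}) : set (leb_rV R n) :=
  box (\row_i (c 0 i - rho + mesh N * ((f i)%:R - k)),
       \row_i (c 0 i - rho + mesh N * ((f i)%:R + 1 + k))).

(** The constants [m f] are arbitrary instead of mean values of [g], so that constants for
    combinations and limits can be built from those of the given functions. Cells are enlarged by
    one mesh because mollification at the scale of the mesh sees that much. *)
Definition osc_sum (q : nat) (g : 'rV[R]_n -> R) (N : nat)
    (m : {ffun 'I_n -> 'I_N.+1} -> R) : \bar R :=
  (\sum_f \int[mu]_(x in cell 1 f) (`|g x - m f| ^+ q)%:E)%E.

Definition vanishing_osc (q : nat) (g : 'rV[R]_n -> R) : Prop :=
  forall e : R, 0 < e -> exists N0, forall N, (N0 <= N)%N ->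
    exists m : {ffun 'I_n -> 'I_N.+1} -> R, (osc_sum q g m <= e%:E)%E.

Hypothesis rho0 : 0 < rho.

Lemma measurable_cube r : measurable (cube r).
Proof. exact: measurable_box. Qed.

Lemma measurable_cell N k (f : {ffun 'I_n -> 'I_N.+1}) : measurable (cell k f).
Proof. exact: measurable_box. Qed.

Lemma mesh_gt0 N : 0 < mesh N.
Proof. by rewrite divr_gt0// mulr_gt0. Qed.

Lemma meshE N : mesh N * N.+1%:R = 2 * rho.
Proof. by rewrite divfK// gt_eqF. Qed.

(** With at least two cells per side, hence [N.+2], the mesh is at most [rho], so enlarging a cell
    by one mesh stays in the doubled cube. *)
Lemma cell_sub_cube N (f : {ffun 'I_n -> 'I_N.+2}) : cell 1 f `<=` cube (2 * rho).
Proof.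
move=> x fx i; have := fx i; rewrite /= !mxE => /andP[h1 h2].
have s0 := mesh_gt0 N.+1; have sE := meshE N.+1.
have fN : (f i)%:R + 1 <= N.+2%:R :> R by rewrite natr1 ler_nat.
have : (0 : R) <= (f i)%:R by [].
have N2 : 2 <= N.+2%:R :> R by rewrite ler_nat.
move: ((f i)%:R : R) (N.+2%:R : R) (mesh N.+1) fN N2 s0 sE h1 h2 => F M s *.
have : s * (F + 1) <= s * M by rewrite ler_pM2l.
have : s * 2 <= s * M by rewrite ler_pM2l.
have : 0 <= s * F by rewrite mulr_ge0// ltW.
by move=> *; apply/andP; split; nra.
Qed.

Lemma card_cell_overlap N (x : 'rV[R]_n) :
  \sum_(f : {ffun 'I_n -> 'I_N.+1}) (\1_(cell 1 f) x : R) <= 5 ^+ n.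
Proof.
(* An enlarged cell is three meshes wide; its half-open condition on the index is relaxed to an open
   interval of four meshes, which contains at most 4 + 1 grid points. *)
pose P i := [set j : 'I_N.+1 | (x 0 i - c 0 i - mesh N * 3 < - rho + 2 * rho * j%:R / N.+1%:R
   < x 0 i - c 0 i + mesh N)%R]%SET.
apply: (@le_trans _ _ (\sum_(f : {ffun 'I_n -> 'I_N.+1}) \prod_i (f i \in P i)%:R)).
  apply: ler_sum => f _; rewrite indicE; case: (boolP (x \in _)) => [|_]; last first.
    by apply: prodr_ge0 => i _; rewrite ler0n.
  rewrite inE => fx; rewrite big1// => i _; rewrite inE.
  have := fx i; rewrite /= !mxE; have s0 := mesh_gt0 N.
  rewrite (_ : 2 * rho * (f i)%:R / N.+1%:R = mesh N * (f i)%:R); last first.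
    by rewrite /mesh mulrAC.
  move: (mesh N) ((f i)%:R : R) s0 => s F s0 /andP[h1 h2].
  by have -> : (x 0 i - c 0 i - s * 3 < - rho + s * F < x 0 i - c 0 i + s)%R
    by apply/andP; split; nra.
rewrite -(bigA_distr_bigA (fun i (j : 'I_N.+1) => (j \in P i)%:R : R)).
rewrite [leRHS](_ : _ = \prod_(i < n) 5); last by rewrite prodr_const card_ord.
apply: ler_prod => i _; rewrite sumr_ge0//=.
rewrite [leLHS](_ : _ = #|P i|%:R); last first.
  by rewrite -sum1_card natr_sum [RHS]big_mkcond/=; apply: eq_bigr => j _; case: ifP.
apply: (le_trans (card_grid_interval _ _ _ _ _)); first by rewrite mulr_gt0.
rewrite (_ : Num.max _ _ = mesh N * 4); last first.
  by have s0 := mesh_gt0 N; rewrite max_l; lra.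
rewrite (_ : N.+1%:R * _ = mesh N * N.+1%:R * 4 / (2 * rho)); last by ring.
by rewrite meshE mulrAC divff ?gt_eqF ?mulr_gt0//; lra.
Qed.

Lemma integral_cells_le N (g : 'rV[R]_n -> R) :
  measurable_fun (cube (2 * rho)) (g : leb_rV R n -> R) -> (forall x, 0 <= g x) ->
  (\sum_(f : {ffun 'I_n -> 'I_N.+2}) \int[mu]_(x in cell 1 f) (g x)%:E <=
    (5 ^+ n)%:E * \int[mu]_(x in cube (2 * rho)) (g x)%:E)%E.
Proof.
move=> mg g0; have mC := measurable_cube (2 * rho).
have mgE : measurable_fun (cube (2 * rho)) (fun x : leb_rV R n => (g x)%:E).
  exact/measurable_EFinP.
have mgf (f : {ffun 'I_n -> 'I_N.+2}) :
    measurable_fun (cube (2 * rho)) (fun x : leb_rV R n => (g x * \1_(cell 1 f) x)%:E).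
  apply/measurable_EFinP; apply: measurable_funM => //.
  by apply: measurable_indic; exact: measurable_cell.
rewrite [leLHS](_ : _ = \sum_(f : {ffun 'I_n -> 'I_N.+2})
    \int[mu]_(x in cube (2 * rho)) (g x * \1_(cell 1 f) x)%:E)%E; last first.
  apply: eq_bigr => f _; have CE := setIidr (@cell_sub_cube N f).
  rewrite -[in LHS]CE integral_mkcondr; apply: eq_integral => x _.
  by rewrite patchE indicE; case: ifP => _; rewrite ?mulr1 ?mulr0.
rewrite -ge0_integral_sum//; last by move=> f x _; rewrite lee_fin mulr_ge0.
rewrite -ge0_integralZl_EFin//; last by move=> x _; rewrite lee_fin.
apply: (@ge0_le_integral _ _ _ mu _ mC).
- by move=> x _; apply: sume_ge0 => f _; rewrite lee_fin mulr_ge0.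
- by apply: emeasurable_sum.
- by apply: measurable_funeM.
move=> x _; rewrite sumEFin lee_fin -mulr_sumr mulrC ler_wpM2r//.
exact: card_cell_overlap.
Qed.

Lemma vanishing_osc_comb q (g h : 'rV[R]_n -> R) (s t : R) :
  measurable_fun (cube (2 * rho)) (g : leb_rV R n -> R) ->
  measurable_fun (cube (2 * rho)) (h : leb_rV R n -> R) ->
  vanishing_osc q g -> vanishing_osc q h ->
  vanishing_osc q (fun x => s * g x + t * h x).
Proof.
move=> mg mh og oh e e0.
pose A := 2 ^+ q * `|s| ^+ q; pose B := 2 ^+ q * `|t| ^+ q.
have A0 : 0 <= A by rewrite mulr_ge0// exprn_ge0.
have B0 : 0 <= B by rewrite mulr_ge0// exprn_ge0.
have d0 : 0 < e / (A + B + 1) by rewrite divr_gt0//; lra.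
have [N1 gN1] := og _ d0; have [N2 hN2] := oh _ d0.
(* The threshold 1 makes the grid size a successor, as [cell_sub_cube] requires. *)
exists (maxn (maxn N1 N2) 1) => -[|N]; rewrite !geq_max; first by rewrite andbF.
move=> /andP[/andP[/gN1[m mP] /hN2[k kP]] _].
exists (fun f => s * m f + t * k f).
apply: (@le_trans _ _ (A%:E * osc_sum q g m + B%:E * osc_sum q h k)%E).
  have ms (f : {ffun 'I_n -> 'I_N.+2}) (u : 'rV[R]_n -> R) (a : R) :
      measurable_fun (cube (2 * rho)) (u : leb_rV R n -> R) ->
      measurable_fun (cell 1 f) (fun x : leb_rV R n => `|u x - a| ^+ q).
    move=> mu0; apply: measurable_absX; apply: measurable_funB => //.
    by apply: measurable_funS mu0; [exact: measurable_cube|exact: cell_sub_cube].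
  have key (f : {ffun 'I_n -> 'I_N.+2}) : (
      \int[mu]_(x in cell 1 f) (`|s * g x + t * h x - (s * m f + t * k f)| ^+ q)%:E <=
      A%:E * \int[mu]_(x in cell 1 f) (`|g x - m f| ^+ q)%:E +
      B%:E * \int[mu]_(x in cell 1 f) (`|h x - k f| ^+ q)%:E)%E.
    apply: (@ge0_le_integral_comb _ _ _ mu).
    - exact: measurable_cell.
    - by [].
    - by [].
    - by apply: ms; apply: measurable_funD; apply: measurable_funM.
    - exact: ms.
    - exact: ms.
    - by move=> x _; rewrite exprn_ge0.
    - by move=> x _; rewrite exprn_ge0.
    - by move=> x _; rewrite exprn_ge0.
    move=> x _.
    have -> : A * `|g x - m f| ^+ q = 2 ^+ q * (`|s| * `|g x - m f|) ^+ q.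
      by rewrite exprMn mulrA.
    have -> : B * `|h x - k f| ^+ q = 2 ^+ q * (`|t| * `|h x - k f|) ^+ q.
      by rewrite exprMn mulrA.
    apply: exprD_le; rewrite ?mulr_ge0//.
    by rewrite -!normrM opprD addrACA -!mulrBr ler_normD.
  rewrite /osc_sum !ge0_sume_distrr; [|by move=> f _; apply: integral_ge0 => *; rewrite lee_fin exprn_ge0..].
  by rewrite -big_split/=; apply: lee_sum => f _; exact: key.
apply: (@le_trans _ _ (A%:E * (e / (A + B + 1))%:E + B%:E * (e / (A + B + 1))%:E)%E).
  by apply: leeD; apply: lee_wpmul2l; rewrite ?lee_fin.
rewrite -!EFinM -EFinD lee_fin -mulrDl mulrCA ger_pMr// ler_pdivrMr; lra.
Qed.

(** The constants of the approximating function also serve for [g]: by bounded overlap, the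
    approximation error enters the sum over cells at most 5^n times. *)
Lemma vanishing_osc_lim q (g : 'rV[R]_n -> R) :
  measurable_fun (cube (2 * rho)) (g : leb_rV R n -> R) ->
  (forall e : R, 0 < e -> exists h : 'rV[R]_n -> R,
    [/\ measurable_fun (cube (2 * rho)) (h : leb_rV R n -> R), vanishing_osc q h &
      (\int[mu]_(x in cube (2 * rho)) (`|g x - h x| ^+ q)%:E <= e%:E)%E]) ->
  vanishing_osc q g.
Proof.
move=> mg glim e e0.
have B0 : 0 < 2 ^+ q * (5 ^+ n + 1) :> R by rewrite mulr_gt0// ltr_wpDl ?exprn_ge0.
have d0 : 0 < e / (2 ^+ q * (5 ^+ n + 1)) by rewrite divr_gt0.
have [h [mh oh gh]] := glim _ d0; have [N1 hN1] := oh _ d0.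
exists (maxn N1 1) => -[|N]; rewrite !geq_max; first by rewrite andbF.
move=> /andP[/hN1[m mP] _]; exists m.
have mgh : measurable_fun (cube (2 * rho)) (fun x : leb_rV R n => `|g x - h x| ^+ q).
  by apply: measurable_absX; apply: measurable_funB.
have p2 : 0 <= 2 ^+ q :> R by rewrite exprn_ge0.
apply: (@le_trans _ _ ((2 ^+ q)%:E * (\sum_(f : {ffun 'I_n -> 'I_N.+2})
   \int[mu]_(x in cell 1 f) (`|g x - h x| ^+ q)%:E) + (2 ^+ q)%:E * osc_sum q h m)%E).
  have ms (f : {ffun 'I_n -> 'I_N.+2}) (u : 'rV[R]_n -> R) (a : R) :
      measurable_fun (cube (2 * rho)) (u : leb_rV R n -> R) ->
      measurable_fun (cell 1 f) (fun x : leb_rV R n => `|u x - a| ^+ q).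
    move=> mu0; apply: measurable_absX; apply: measurable_funB => //.
    by apply: measurable_funS mu0; [exact: measurable_cube|exact: cell_sub_cube].
  have key (f : {ffun 'I_n -> 'I_N.+2}) : (
      \int[mu]_(x in cell 1 f) (`|g x - m f| ^+ q)%:E <=
      (2 ^+ q)%:E * \int[mu]_(x in cell 1 f) (`|g x - h x| ^+ q)%:E +
      (2 ^+ q)%:E * \int[mu]_(x in cell 1 f) (`|h x - m f| ^+ q)%:E)%E.
    apply: (@ge0_le_integral_comb _ _ _ mu).
    - exact: measurable_cell.
    - by [].
    - by [].
    - exact: ms.
    - by apply: measurable_funS mgh; [exact: measurable_cube|exact: cell_sub_cube].
    - exact: ms.
    - by move=> x _; rewrite exprn_ge0.
    - by move=> x _; rewrite exprn_ge0.
    - by move=> x _; rewrite exprn_ge0.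
    by move=> x _; apply: exprD_le => //; rewrite (_ : g x - m f = (g x - h x) + (h x - m f)) ?ler_normD//; ring.
  rewrite /osc_sum !ge0_sume_distrr; [|by move=> f _; apply: integral_ge0 => *; rewrite lee_fin exprn_ge0..].
  by rewrite -big_split/=; apply: lee_sum => f _; exact: key.
apply: (@le_trans _ _ ((2 ^+ q)%:E * ((5 ^+ n)%:E * (e / (2 ^+ q * (5 ^+ n + 1)))%:E)
    + (2 ^+ q)%:E * (e / (2 ^+ q * (5 ^+ n + 1)))%:E)%E).
  apply: leeD; apply: lee_wpmul2l; rewrite ?lee_fin//.
  have := @integral_cells_le N (fun x => `|g x - h x| ^+ q) mgh (fun=> exprn_ge0 _ (normr_ge0 _)).
  move/le_trans; apply.
  by apply: lee_wpmul2l => //; rewrite lee_fin exprn_ge0.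
rewrite -!EFinM -EFinD lee_fin le_eqVlt; apply/orP; left; apply/eqP.
have : 5 ^+ n + 1 != 0 :> R by rewrite gt_eqF// ltr_wpDl ?exprn_ge0.
have : 2 ^+ q != 0 :> R by rewrite gt_eqF// exprn_gt0.
by move: (2 ^+ q) (5 ^+ n) => a b *; field; apply/andP.
Qed.

Lemma mesh_small (M e : R) : 0 < e ->
  exists N0, forall N, (N0 <= N)%N -> mesh N * M <= e.
Proof.
move=> e0; exists (Num.bound (2 * rho * `|M| / e)) => N N0N.
rewrite /mesh mulrAC ler_pdivrMr// mulrC.
have : 2 * rho * `|M| / e < N.+1%:R.
  apply: (lt_le_trans (archi_boundP _)); last by rewrite ler_nat ltnW.
  by rewrite divr_ge0 ?mulr_ge0// ltW.
rewrite ltr_pdivrMr// => h.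
have : 2 * rho * M <= 2 * rho * `|M| by rewrite ler_wpM2l ?ler_norm// mulr_ge0// ltW.
move: h; set A := 2 * rho * `|M|; rewrite ![M * _]mulrC ![e * _]mulrC; lra.
Qed.

Definition slab (i : 'I_n) (t d : R) : set (leb_rV R n) :=
  box (row_set (c - const_mx (2 * rho)) i (t - d), row_set (c + const_mx (2 * rho)) i (t + d)).

Lemma lebesgue_slab_le i (t d : R) : 0 <= d ->
  (mu (slab i t d) <= (2 * d * (4 * rho + 1) ^+ n)%:E)%E.
Proof.
move=> d0; apply: (le_trans (lebesgue_box_le _)); rewrite lee_fin /box_volume (bigD1 i)//=.
rewrite !row_setE eqxx max_l; last by lra.
rewrite (_ : t + d - (t - d) = 2 * d); last by ring.
rewrite ler_wpM2l ?mulr_ge0//.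
have -> : (4 * rho + 1) ^+ n = \prod_(j < n) (4 * rho + 1).
  by rewrite prodr_const card_ord.
rewrite [leRHS](bigD1 i)//= -[leLHS]mul1r; apply: ler_pM => //.
- by apply: prodr_ge0 => j _; rewrite le_max lexx orbT.
- by rewrite lerDr mulr_ge0// ltW.
apply: ler_prod => j ji; rewrite le_max lexx orbT/= !row_setE (negbTE ji) !mxE.
have h1 : c 0 j + 2 * rho - (c 0 j - 2 * rho) <= 4 * rho + 1 by lra.
by rewrite ge_max h1/= addr_ge0// mulr_ge0// ltW.
Qed.

(** Only cells that meet both the box and its complement contribute. They lie in slabs around the
    faces, whose thickness is proportional to the mesh. *)
Lemma vanishing_osc_box q (a b : 'rV[R]_n) : (0 < q)%N ->
  vanishing_osc q (\1_(box (a, b))).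
Proof.
move=> q0 e e0.
(* Overlap 5^n, n coordinates, two faces for each, and slabs of half-thickness four meshes inside
   the doubled cube. *)
pose M : R := 5 ^+ n * (n%:R * (2 * 4 * (4 * rho + 1) ^+ n) * 2).
have [N1 N1P] := mesh_small M e0.
exists (maxn N1 1) => -[|N]; rewrite !geq_max; first by rewrite andbF.
move=> /andP[/N1P N1N _].
(* The constant is 1 on cells inside the box and 0 on all others, also on those that straddle a
   face. *)
exists (fun f => (`[< cell 1 f `<=` box (a, b) >])%:R).
have s0 := mesh_gt0 N.+1; set s := mesh N.+1 in s0 N1N *.
pose G (x : leb_rV R n) : R :=
  \sum_i (\1_(slab i (a 0 i) (4 * s)) x + \1_(slab i (b 0 i) (4 * s)) x).
have mslab i t D : measurable_fun D (\1_(slab i t (4 * s)) : leb_rV R n -> R).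
  by apply: measurable_indic; exact: measurable_box.
have mG D : measurable_fun D G.
  by apply: measurable_sum => i; apply: measurable_funD.
have G0 x : 0 <= G x by apply: sumr_ge0 => i _; rewrite addr_ge0.
have mC := measurable_cube (2 * rho).
apply: (@le_trans _ _ (\sum_(f : {ffun 'I_n -> 'I_N.+2}) \int[mu]_(x in cell 1 f) (G x)%:E)%E).
  apply: lee_sum => f _; apply: (@ge0_le_integral _ _ _ mu).
  - exact: measurable_cell.
  - by move=> x _; rewrite lee_fin exprn_ge0.
  - apply/measurable_EFinP; apply: measurable_absX; apply: measurable_funB => //.
    by apply: measurable_indic; exact: measurable_box.
  - exact/measurable_EFinP.
  move=> x fx; rewrite lee_fin; case: asboolP => [/(_ x fx)|].
    by move=> abx; rewrite indicE mem_set// subrr normr0 expr0n gtn_eqF.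
  move=> /nonsubset[y [fy aby]]; rewrite subr0 indicE.
  have [|_] := boolP (x \in _); last by rewrite normr0 expr0n gtn_eqF.
  rewrite inE => abx; rewrite normr1 expr1n.
  have [i iP] : exists i, ~ (a 0 i < y 0 i <= b 0 i) by apply/existsNP.
  have Cx := @cell_sub_cube N f _ fx.
  have xs t : t - 4 * s < x 0 i <= t + 4 * s -> slab i t (4 * s) x.
    move=> tx j /=; rewrite !row_setE; case: eqP => [->//|_]; exact: Cx.
  have : slab i (a 0 i) (4 * s) x \/ slab i (b 0 i) (4 * s) x.
    have := abx i; have := fx i; have := fy i; rewrite /= !mxE -/s.
    move=> /andP[? ?] /andP[? ?] /andP[? ?].
    have [yb|yb] := leP (y 0 i) (b 0 i).
      have ya : y 0 i <= a 0 i by rewrite leNgt; apply/negP => ya; apply: iP; rewrite ya.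
      by left; apply: xs; apply/andP; split; lra.
    by right; apply: xs; apply/andP; split; lra.
  move=> slabP; rewrite /G (bigD1 i)//=.
  have : 1 <= \1_(slab i (a 0 i) (4 * s)) x + \1_(slab i (b 0 i) (4 * s)) x :> R.
    case: slabP => slabP; rewrite !indicE (mem_set slabP).
      by rewrite lerDl.
    by rewrite lerDr.
  by move/le_trans; apply; rewrite lerDl; apply: sumr_ge0 => j _; rewrite addr_ge0.
apply: (le_trans (@integral_cells_le N G (mG _) G0)).
have slab_int i t : (\int[mu]_(x in cube (2 * rho)) (\1_(slab i t (4 * s)) x)%:E <=
    (2 * (4 * s) * (4 * rho + 1) ^+ n)%:E)%E.
  rewrite integral_indic//; last exact: measurable_box.
  apply: (@le_trans _ _ (mu (slab i t (4 * s)))).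
    by apply: le_measure; rewrite ?inE; [apply: measurableI => //; exact: measurable_box|exact: measurable_box|].
  by apply: lebesgue_slab_le; lra.
apply: (@le_trans _ _ ((5 ^+ n)%:E * (\sum_(i < n) (2 * (2 * (4 * s) * (4 * rho + 1) ^+ n))%:E))%E).
  apply: lee_wpmul2l; first by rewrite lee_fin exprn_ge0.
  have mE i t : measurable_fun (cube (2 * rho)) (fun x : leb_rV R n => (\1_(slab i t (4 * s)) x : R)%:E).
    exact/measurable_EFinP.
  have E0 i t (x : leb_rV R n) : (0 <= (\1_(slab i t (4 * s)) x : R)%:E)%E by rewrite lee_fin.
  pose F i (x : leb_rV R n) : \bar R :=
    ((\1_(slab i (a 0 i) (4 * s)) x)%:E + (\1_(slab i (b 0 i) (4 * s)) x)%:E)%E.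
  have -> : (\int[mu]_(x in cube (2 * rho)) (G x)%:E =
      \int[mu]_(x in cube (2 * rho)) (\sum_i F i x))%E.
    by apply: eq_integral => x _; rewrite -sumEFin; apply: eq_bigr => i _; rewrite EFinD.
  have mF i : measurable_fun (cube (2 * rho)) (F i) by exact: emeasurable_funD.
  have F0 i (x : leb_rV R n) : cube (2 * rho) x -> (0 <= F i x)%E by move=> _; exact: adde_ge0.
  rewrite (@ge0_integral_sum _ _ _ mu _ mC _ F mF F0).
  apply: lee_sum => i _; rewrite /F.
  rewrite (@ge0_integralD _ _ _ mu _ mC _ _ (fun x _ => E0 _ _ x) (mE _ _) (fun x _ => E0 _ _ x) (mE _ _)).
  have -> : 2 * (2 * (4 * s) * (4 * rho + 1) ^+ n) = 2 * (4 * s) * (4 * rho + 1) ^+ n +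
    2 * (4 * s) * (4 * rho + 1) ^+ n by ring.
  by rewrite EFinD; exact: leeD.
rewrite sumEFin -EFinM lee_fin sumr_const card_ord.
apply: le_trans N1N; rewrite /M -mulr_natl le_eqVlt; apply/orP; left; apply/eqP; ring.
Qed.

Lemma vanishing_osc_cst q (k : R) : (0 < q)%N -> vanishing_osc q (fun=> k).
Proof.
move=> q0 e e0; exists 0%N => N _; exists (fun=> k); rewrite /osc_sum big1 ?lee_fin ?ltW// => f _.
by apply: integral0_eq => x _; rewrite subrr normr0 expr0n gtn_eqF.
Qed.

Definition boxes (s : seq ('rV[R]_n * 'rV[R]_n)) : set (leb_rV R n) :=
  [set x | exists2 B, B \in s & box B x].

Lemma boxes_cons B s : boxes (B :: s) = box B `|` boxes s.
Proof.
apply/seteqP; split=> x.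
  by move=> [B']; rewrite inE => /orP[/eqP ->|B's] ?; [left|right; exists B'].
by move=> [Bx|[B' B's B'x]]; [exists B|exists B'] => //; rewrite inE ?eqxx// B's orbT.
Qed.

Lemma measurable_boxes s : measurable (boxes s).
Proof.
elim: s => [|B s IH].
  rewrite [X in measurable X](_ : _ = set0)//; apply/seteqP; split => [x []//|//].
by rewrite boxes_cons; apply: measurableU => //; exact: measurable_box.
Qed.

Lemma vanishing_osc_boxes q s : (0 < q)%N -> vanishing_osc q (\1_(boxes s)).
Proof.
(* Induction on the length, not on the list: inclusion-exclusion also calls for the union of the
   intersections of B with the boxes of s, which is another list of the same length as s. *)
move=> q0; move: {2}(size s) (leqnn (size s)) => m; elim: m s => [|m IH] [|B s]//=.
- move=> _; rewrite (_ : boxes [::] = set0); last by apply/seteqP; split=> [x []//|//].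
  by rewrite indic0; exact: vanishing_osc_cst.
- move=> _; rewrite (_ : boxes [::] = set0); last by apply/seteqP; split=> [x []//|//].
  by rewrite indic0; exact: vanishing_osc_cst.
rewrite ltnS => sm.
pose cap (B' : 'rV[R]_n * 'rV[R]_n) : 'rV[R]_n * 'rV[R]_n :=
  (\row_i Num.max (B.1 0 i) (B'.1 0 i), \row_i Num.min (B.2 0 i) (B'.2 0 i)).
have capE B' : box (cap B') = box B `&` box B'.
  apply/seteqP; split=> [x h|x [h1 h2] i].
    split=> i; have := h i; rewrite /= !mxE gt_max le_min; lra.
  by have := h1 i; have := h2 i; rewrite /= !mxE gt_max le_min; lra.
have capsE : boxes [seq cap B' | B' <- s] = box B `&` boxes s.
  apply/seteqP; split=> [x [_ /mapP[B' B's ->]]|x [Bx [B' B's B'x]]].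
    by rewrite capE => -[? ?]; split=> //; exists B'.
  by exists (cap B'); [apply/mapP; exists B'|rewrite capE].
have -> : \1_(boxes (B :: s)) = (fun x => 1 * (1 * \1_(box B) x + 1 * \1_(boxes s) x)
    + (- 1) * \1_(boxes [seq cap B' | B' <- s]) x) :> ('rV[R]_n -> R).
  apply/funext => x; rewrite capsE indicI /= !mul1r mulN1r !indicE.
  rewrite boxes_cons in_setU.
  by case: (x \in box B); case: (x \in boxes s) => /=; rewrite ?mulr1 ?mulr0 ?mul0r; ring.
have mb t : measurable_fun (cube (2 * rho)) (\1_(boxes t) : leb_rV R n -> R).
  by apply: measurable_indic; exact: measurable_boxes.
have mB : measurable_fun (cube (2 * rho)) (\1_(box B) : leb_rV R n -> R).
  by apply: measurable_indic; exact: measurable_box.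
have mBs : measurable_fun (cube (2 * rho))
    ((fun x => 1 * \1_(box B) x + 1 * \1_(boxes s) x) : leb_rV R n -> R).
  by apply: measurable_funD; apply: measurable_funM; [|exact: mB| |exact: mb].
apply: (@vanishing_osc_comb q _ _ 1 (-1) mBs (mb _)).
  by apply: (@vanishing_osc_comb q _ _ 1 1 mB (mb _)); [exact: vanishing_osc_box|exact: IH].
by apply: IH; rewrite size_map.
Qed.

Lemma lebesgue_cube_lty r : (mu (cube r) < +oo)%E.
Proof. by apply: le_lt_trans (lebesgue_box_le _) _; rewrite ltry. Qed.

(** By definition of the outer measure the part of A in the cube has a cover U by boxes with excess
    at most e/2, and finitely many of these boxes fill U up to e/2. The two indicators differ only
    where U exceeds one of the two sets. *)
Lemma vanishing_osc_indic q (A : set (leb_rV R n)) : (0 < q)%N -> measurable A ->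
  vanishing_osc q (\1_A).
Proof.
move=> q0 mA; apply: vanishing_osc_lim => [|e e0].
  exact: measurable_indic.
have mC := measurable_cube (2 * rho).
pose A' := A `&` cube (2 * rho).
have mA' : measurable A' by exact: measurableI.
have A'oo : (mu A' < +oo)%E.
  apply: le_lt_trans (lebesgue_cube_lty (2 * rho)).
  by apply: le_measure; rewrite ?inE//; exact: subIsetr.
have A'fin : mu A' \is a fin_num by rewrite ge0_fin_numE.
have e20 : 0 < e / 2 by rewrite divr_gt0.
have [_ [[J C] /= AC <-] Ce] := lb_ereal_inf_adherent e20 A'fin.
rewrite -[ereal_inf _]/(mu A') in Ce.
pose sq N := [seq C k | k <- iota 0 N & `[< J k >]].
pose U : set (leb_rV R n) := \bigcup_N boxes (sq N).
have UE : U = \bigcup_(k in J) box (C k).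
  apply/seteqP; split=> [x [N _ [B /mapP[k]]]|x [k Jk Ckx]].
    by rewrite mem_filter => /andP[/asboolP Jk _] -> ?; exists k.
  exists k.+1 => //; exists (C k) => //; apply/mapP; exists k => //.
  by rewrite mem_filter mem_iota/= ltnSn andbT; exact/asboolP.
have mU : measurable U by apply: bigcupT_measurable => N; exact: measurable_boxes.
have Ue : (mu U < mu A' + (e / 2)%:E)%E.
  apply: le_lt_trans Ce; rewrite UE; apply: ereal_inf_lbound.
  by exists (J, C).
have Ufin : mu U \is a fin_num.
  rewrite ge0_fin_numE//; apply: (lt_trans Ue).
  by rewrite lte_add_pinfty// ltry.
have A'U : A' `<=` U by rewrite UE.
have cvU : mu (boxes (sq N)) @[N --> \oo] --> mu U.
  apply: nondecreasing_cvg_mu => //.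
    by move=> N; exact: measurable_boxes.
  move=> N M NM; apply/subsetPset => x [B /mapP[k]]; rewrite mem_filter mem_iota/=.
  move=> /andP[Jk kN] -> Ckx; exists (C k) => //; apply/mapP; exists k => //.
  by rewrite mem_filter Jk mem_iota/= (leq_trans kN).
have [N UN] : exists N, (mu U < mu (boxes (sq N)) + (e / 2)%:E)%E.
  apply: contrapT => /forallNP nU.
  have : (mu U <= mu U - (e / 2)%:E)%E.
    apply: (cvge_to_le cvU); apply: nearW => N.
    by rewrite leeBrDr// leNgt; apply/negP; exact: nU.
  rewrite -(fineK Ufin) -EFinB lee_fin; lra.
exists (\1_(boxes (sq N))); split.
- by apply: measurable_indic; exact: measurable_boxes.
- exact: vanishing_osc_boxes.
have mbx : measurable (boxes (sq N)) by exact: measurable_boxes.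
have bU : boxes (sq N) `<=` U by move=> x ?; exists N.
have diff (V : set (leb_rV R n)) : measurable V -> V `<=` U ->
    (mu U < mu V + (e / 2)%:E)%E ->
    (\int[mu]_(x in cube (2 * rho)) (\1_(U `\` V) x)%:E <= (e / 2)%:E)%E.
  move=> mV VU UV; have mUV : measurable (U `\` V) by exact: measurableD.
  rewrite (@integral_indic _ _ _ mu _ mC _ mUV).
  apply: (@le_trans _ _ (mu (U `\` V))).
    by apply: le_measure; rewrite ?inE//; apply: measurableI.
  have Uoo : (mu U < +oo)%E by rewrite -ge0_fin_numE.
  have VUoo : mu V \is a fin_num.
    rewrite ge0_fin_numE//; by apply: le_lt_trans Uoo; apply: le_measure; rewrite ?inE.
  by rewrite (@measureD _ _ _ mu _ _ mU mV Uoo) (setIidr VU) leeBlDl// ltW.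
have D0 (V : set (leb_rV R n)) (x : leb_rV R n) : 0 <= \1_V x :> R by [].
have mD (V : set (leb_rV R n)) : measurable V ->
    measurable_fun (cube (2 * rho)) (\1_V : leb_rV R n -> R) by move=> ?; exact: measurable_indic.
have := @ge0_le_integral_comb _ _ _ mu (cube (2 * rho))
  (fun x => `|\1_A x - \1_(boxes (sq N)) x| ^+ q) (\1_(U `\` A')) (\1_(U `\` boxes (sq N))) 1 1
  mC ler01 ler01.
move/(_ _ _ _ _ _ _ _)/le_trans; apply.
- by apply: measurable_absX; apply: measurable_funB; exact: mD.
- by apply: mD; exact: measurableD.
- by apply: mD; exact: measurableD.
- by move=> x _; rewrite exprn_ge0.
- by move=> x _; exact: D0.
- by move=> x _; exact: D0.
- move=> x Cx; rewrite !mul1r !indicE !in_setD.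
  have -> : (x \in A) = (x \in A').
    by rewrite /A' in_setI (mem_set Cx) andbT.
  have [xA'|xA'] := boolP (x \in A'); have [xb|xb] := boolP (x \in boxes (sq N)) => /=.
  + by rewrite subrr normr0 expr0n gtn_eqF// addr_ge0.
  + rewrite subr0 normr1 expr1n (_ : x \in U) ?andbF ?add0r//.
    by rewrite inE; apply: A'U; rewrite -inE.
  + rewrite sub0r normrN normr1 expr1n (_ : x \in U) ?addr0//.
    by rewrite inE; apply: bU; rewrite -inE.
  + by rewrite subrr normr0 expr0n gtn_eqF// addr_ge0.
rewrite !mul1e (_ : e%:E = (e / 2)%:E + (e / 2)%:E)%E; last by rewrite -EFinD -splitr.
by apply: leeD; exact: diff.
Qed.

Import HBNNSimple.

Lemma vanishing_osc_simple q (f : {nnsfun (leb_rV R n) >-> R}) : (0 < q)%N ->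
  vanishing_osc q (f : leb_rV R n -> R).
Proof.
move=> q0; have mC := measurable_cube (2 * rho).
have mf (y : R) : measurable (f @^-1` [set y]) by [].
pose r : seq R := finmap.enum_fset (fset_set (range f)).
have -> : (f : leb_rV R n -> R) = (fun x => \sum_(y <- r) y * \1_(f @^-1` [set y]) x).
  by apply/funext => x; rewrite fimfunE fsbig_finite.
suff : measurable_fun (cube (2 * rho))
    ((fun x => \sum_(y <- r) y * \1_(f @^-1` [set y]) x) : leb_rV R n -> R) /\
  vanishing_osc q (fun x => \sum_(y <- r) y * \1_(f @^-1` [set y]) x) by case.
elim: r => [|y r [IHm IH]].
  have -> : (fun x : leb_rV R n => \sum_(y <- [::]) y * \1_(f @^-1` [set y]) x) = (fun=> 0).
    by apply/funext => x; rewrite big_nil.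
  by split; [exact: measurable_cst|exact: vanishing_osc_cst].
have -> : (fun x : leb_rV R n => \sum_(y <- y :: r) y * \1_(f @^-1` [set y]) x) =
    (fun x => y * \1_(f @^-1` [set y]) x + 1 * \sum_(y <- r) y * \1_(f @^-1` [set y]) x).
  by apply/funext => x; rewrite big_cons mul1r.
have my : measurable_fun (cube (2 * rho)) (\1_(f @^-1` [set y]) : leb_rV R n -> R).
  exact: measurable_indic.
split; first by apply: measurable_funD; apply: measurable_funM.
exact: (@vanishing_osc_comb q _ _ y 1 my IHm (vanishing_osc_indic q0 (mf y)) IH).
Qed.

(** Simple functions increase to [g], and they converge in L^q because the q-th power of the error
    is dominated by that of [g]. *)
Lemma vanishing_osc_Lq_ge0 q (g : 'rV[R]_n -> R) : (0 < q)%N ->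
  measurable_fun (cube (2 * rho)) (g : leb_rV R n -> R) ->
  (forall x, 0 <= g x) ->
  (\int[mu]_(x in cube (2 * rho)) (g x ^+ q)%:E < +oo)%E -> vanishing_osc q g.
Proof.
move=> q0 mg g0 goo; apply: vanishing_osc_lim => // e e0.
have mC := measurable_cube (2 * rho).
have mEg : measurable_fun (cube (2 * rho)) (EFin \o (g : leb_rV R n -> R)).
  exact/measurable_EFinP.
pose h := nnsfun_approx mC mEg.
have hg x : cube (2 * rho) x -> (fun N => h N x) @ \oo --> g x.
  move=> Cx; apply: (@fine_cvg _ _ _ _ (EFin \o (fun N => h N x))).
  by apply: (cvg_nnsfun_approx mC mEg) => // y _; rewrite lee_fin.
have hle N x : cube (2 * rho) x -> h N x <= g x.
  move=> Cx; rewrite -(cvg_lim (@Rhausdorff R) (hg _ Cx)).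
  apply: (@nondecreasing_cvgn_le _ (fun N => h N x)).
    by move=> i j ij; have /lefP := nd_nnsfun_approx mC mEg ij; exact.
  by apply/cvg_ex; exists (g x); exact: hg.
have mh N : measurable_fun (cube (2 * rho)) (h N : leb_rV R n -> R).
  by apply: measurable_funS (measurable_funPT (h N)).
pose F N (x : leb_rV R n) : \bar R := (`|g x - h N x| ^+ q)%:E.
have cvF : (\int[mu]_(x in cube (2 * rho)) F N x)%E @[N --> \oo] -->
    (\int[mu]_(x in cube (2 * rho)) (cst 0%E : leb_rV R n -> \bar R) x)%E.
  apply: (@dominated_cvg _ _ _ mu _ mC F _ (fun x => (g x ^+ q)%:E)).
  - move=> N; apply/measurable_EFinP; apply: measurable_absX; exact: measurable_funB.
  - move=> x Cx; apply: cvg_EFin; first exact: nearW.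
    rewrite [X in _ --> X](_ : _ = `|g x - g x| ^+ q); last first.
      by rewrite subrr normr0 expr0n gtn_eqF.
    apply: (@cvg_comp _ _ _ (fun N => `|g x - h N x|) (fun y : R => y ^+ q) _ (nbhs `|g x - g x|)).
      by apply: cvg_norm; apply: cvgB; [exact: cvg_cst|exact: hg].
    exact: exprn_continuous.
  - by [].
  - apply/integrableP; split; first by apply/measurable_EFinP; exact: measurable_funX.
    rewrite (@eq_integral _ _ _ mu _ (fun x => (g x ^+ q)%:E))// => x _.
    by rewrite gee0_abs// lee_fin exprn_ge0.
  move=> N x Cx; rewrite /F/= lee_fin ger0_norm ?exprn_ge0//.
  apply: lerXn2r; rewrite ?nnegrE//.
  have := hle N _ Cx; have : 0 <= h N x by []; have := g0 x => *.
  by rewrite ler_norml; apply/andP; split; lra.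
rewrite integral0 in cvF.
have [N FN] : exists N, (\int[mu]_(x in cube (2 * rho)) F N x < e%:E)%E.
  apply: contrapT => /forallNP nF.
  have : (e%:E <= (0 : \bar R))%E.
    apply: (cvge_to_ge cvF); apply: nearW => N.
    by rewrite leNgt; apply/negP; exact: nF.
  by rewrite lee_fin leNgt e0.
exists (h N); split; [exact: mh|exact: vanishing_osc_simple|exact: ltW].
Qed.

Lemma vanishing_osc_Lq q (g : 'rV[R]_n -> R) : (0 < q)%N ->
  measurable_fun (cube (2 * rho)) (g : leb_rV R n -> R) ->
  (\int[mu]_(x in cube (2 * rho)) (`|g x| ^+ q)%:E < +oo)%E -> vanishing_osc q g.
Proof.
move=> q0 mg goo; have mC := measurable_cube (2 * rho).
have part (f : R -> R) : measurable_fun setT f -> (forall y, 0 <= f y <= `|y|) ->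
    measurable_fun (cube (2 * rho)) (fun x : leb_rV R n => f (g x)) /\
    vanishing_osc q (fun x => f (g x)).
  move=> mf fP.
  have mfg : measurable_fun (cube (2 * rho)) (fun x : leb_rV R n => f (g x)).
    exact: measurableT_comp mf mg.
  split=> //; apply: vanishing_osc_Lq_ge0 => //; first by move=> x; case/andP: (fP (g x)).
  apply: le_lt_trans goo; apply: (@ge0_le_integral _ _ _ mu _ mC).
  - by move=> x _; rewrite lee_fin exprn_ge0//; case/andP: (fP (g x)).
  - by apply/measurable_EFinP; apply: measurable_funX.
  - by apply/measurable_EFinP; apply: measurable_absX.
  move=> x _; have /andP[h1 h2] := fP (g x).
  by rewrite lee_fin; apply: lerXn2r; rewrite ?nnegrE.
have [mp op] := part (fun y => Num.max y 0) (measurable_maxr (@measurable_id _ _ _) (measurable_cst _)) (fun y => ltac:(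
  rewrite le_max lexx orbT ge_max ler_norm normr_ge0//)).
have [mn on] := part (fun y => Num.max (- y) 0) (measurable_maxr (measurableT_comp (@oppr_measurable R setT) (@measurable_id _ _ _)) (measurable_cst _)) (fun y => ltac:(
  rewrite le_max lexx orbT ge_max -normrN ler_norm normr_ge0//)).
have -> : g = (fun x => 1 * Num.max (g x) 0 + (-1) * Num.max (- g x) 0).
  apply/funext => x; rewrite mul1r mulN1r /Num.max; case: ifP; case: ifP; lra.
exact: vanishing_osc_comb.
Qed.

End mean_oscillation.

(** * Second-order conditions at a maximum *)

Section directional.
Context {R : realType} {V : normedModType R}.

Lemma is_derive_littleo (f : V -> R) (x v : V) (l : R) :
  (forall e : R, 0 < e ->
    \forall h \near (0 : R), `|f (h *: v + x) - f x - l * h| <= e * `|h|) ->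
  is_derive x v f l.
Proof.
move=> H.
suff cv : (fun h => h^-1 *: ((f \o shift x) (h *: v) - f x)) @ 0^' --> l.
  by split; [apply/cvg_ex; exists l|exact: cvg_lim].
apply/cvgrPdist_le => e e0; near=> h.
have h0 : h != 0 by near: h; exact: nbhs_dnbhs_neq.
have hn : 0 < `|h| by rewrite normr_gt0.
have hq : `|f (h *: v + x) - f x - l * h| <= e * `|h|.
  by near: h; apply: cvg_within; exact: H.
rewrite /= -normrN opprB -(ler_pM2l hn) -normrM mulrBr.
by rewrite [h * (_ *: _)]mulrA divff// mul1r [h * l]mulrC [leRHS]mulrC.
Unshelve. all: by end_near.
Qed.

(** For a polynomial the hypothesis is an algebraic identity, so explicit derivatives reduce to
    [ring]. *)
Lemma is_derive_quad (f : V -> R) (x v : V) (l C : R) :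
  (\forall h \near (0 : R), `|f (h *: v + x) - f x - l * h| <= C * h ^+ 2) ->
  is_derive x v f l.
Proof.
move=> H; apply: is_derive_littleo => e e0; near=> h.
have hq : `|f (h *: v + x) - f x - l * h| <= C * h ^+ 2 by near: h.
have he : `|h| <= e / (`|C| + 1).
  by near: h; apply: (@nbhs0_le R R^o); rewrite divr_gt0// ltr_wpDl.
apply: (le_trans hq).
have -> : h ^+ 2 = `|h| * `|h| by rewrite -expr2 -normrX ger0_norm ?sqr_ge0.
rewrite mulrA ler_wpM2r//.
move: he; rewrite ler_pdivlMr ?ltr_wpDl// mulrC; apply: le_trans.
by rewrite ler_wpM2r// (le_trans (ler_norm _))// lerDl.
Unshelve. all: by end_near.
Qed.

End directional.

(** * A smooth bump supported in [-1, 1] *)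

Section bump.
Context {R : realType}.
Implicit Types (p : {poly R}) (t : R).

(** The functions p(1/t) exp(-1/t), extended by 0, form a family closed under differentiation, which
    [dpexp] expresses on the polynomial. Smoothness thus needs a single derivative computation. *)
Definition pexp p t : R := if 0 < t then p.[t^-1] * expR (- t^-1) else 0.

Definition dpexp p : {poly R} := 'X^2 * (p - p^`()).

Lemma horner_le_expR p : exists2 C : R, 0 <= C &
  forall u, 0 <= u -> `|p.[u]| <= C * expR u.
Proof.
exists (\sum_(i < size p) `|p`_i| * (i`!)%:R); first by apply: sumr_ge0 => i _; rewrite mulr_ge0.
move=> u u0; rewrite horner_coef mulr_suml; apply: le_trans (ler_norm_sum _ _ _) _.
apply: ler_sum => i _; rewrite normrM -mulrA ler_wpM2l// normrX ger0_norm//.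
case: (nat_of_ord i) => [|k].
  by rewrite expr0 fact0 mul1r -expR0 ler_expR.
have := expR_ge1Dxn k u0.
have F0 : 0 < (k.+1`!)%:R :> R by rewrite ltr0n fact_gt0.
move=> h; rewrite -ler_pdivrMl// mulrC; apply: le_trans h; rewrite lerDr//.
Qed.

Lemma is_derive_pexp p t : is_derive t 1 (pexp p) (pexp (dpexp p) t).
Proof.
have [t0|t0|<-] := ltgtP 0 t.
- have tn0 : t != 0 by rewrite gt_eqF.
  have -> : pexp (dpexp p) t = (dpexp p).[t^-1] * expR (- t^-1) by rewrite /pexp t0.
  apply: (@near_eq_is_derive R R^o R^o (fun s : R => p.[s^-1] * expR (- s^-1) : R)).
    near=> s; rewrite /pexp ifT//; near: s; exact: lt_nbhsr.
  have dV : is_derive t 1 (fun s : R => s^-1) (- t ^- 2 *: 1) by apply: is_deriveV.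
  have dp : is_derive t 1 (fun s => p.[s^-1]) (p^`().[t^-1] * (- t ^- 2 *: 1)).
    exact: (@is_derive1_comp _ (horner p) (fun s => s^-1)).
  have de : is_derive t 1 (fun s => expR (- s^-1)) (expR (- t^-1) * (- (- t ^- 2 *: 1))).
    exact: (@is_derive1_comp _ expR (fun s => - s^-1)).
  apply: is_derive_eq; rewrite /dpexp !hornerE.
  by rewrite /GRing.scale/= !mulr1 exprVn; ring.
- have -> : pexp (dpexp p) t = 0 by rewrite /pexp ltNge (ltW t0).
  have d0 : is_derive t 1 (cst 0 : R -> R) (0 : R) by exact: is_derive_cst.
  apply: (near_eq_is_derive _ d0).
  near=> s; rewrite /pexp/= ifF//; apply/negbTE; rewrite -leNgt; near: s.
  by apply: filterS (lt_nbhsl t0) => s /ltW.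
- have -> : pexp (dpexp p) 0 = 0 by rewrite /pexp ltxx.
  (* At the origin the factor X^2 makes the function at most C h^2, so its derivative there is 0. *)
  have [C C0 CP] := horner_le_expR ('X^2 * p).
  apply: (@is_derive_quad R R^o (pexp p) 0 1 0 C); near=> h.
  rewrite /pexp ltxx subr0 mul0r subr0 addr0 [h *: _]mulr1.
  case: ifPn => h0; last by rewrite normr0 mulr_ge0// sqr_ge0.
  have hn0 : h != 0 by rewrite gt_eqF.
  have := CP h^-1; rewrite invr_ge0 (ltW h0) => /(_ isT).
  rewrite !hornerE !normrM expRN [`|(expR _)^-1|]ger0_norm ?invr_ge0 ?expR_ge0//.
  rewrite [`|h^-1|]ger0_norm ?invr_ge0 ?(ltW h0)// ler_pdivrMr ?expR_gt0// => H.
  have hh : 0 <= h * h by rewrite mulr_ge0// ltW.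
  have {H} := ler_wpM2l hh H; rewrite -[h^-1 * h^-1]invfM mulrA divff ?mulf_neq0// mul1r.
  have -> : h * h * (C * expR h^-1) = C * h * h * expR h^-1 by ring.
  exact.
Unshelve. all: by end_near.
Qed.

(** The bump is exp(-1/(1+t)) exp(-1/(1-t)) on (-1, 1). Each derivative is a sum of products of a
    [pexp] at 1 + t and one at 1 - t, stored as a list of pairs of polynomials; this is Leibniz'
    rule on such a list, with the sign of the inner derivative of 1 - t. *)
Definition bump_step (s : seq ({poly R} * {poly R})) :=
  flatten [seq [:: (dpexp pq.1, pq.2); (pq.1, - dpexp pq.2)] | pq <- s].

Definition bumpf (k : nat) (t : R) : R :=
  \sum_(pq <- iter k bump_step [:: (1, 1)]) pexp pq.1 (1 + t) * pexp pq.2 (1 - t).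

Lemma pexpN p t : pexp (- p) t = - pexp p t.
Proof. by rewrite /pexp; case: ifP; rewrite ?oppr0// hornerN mulNr. Qed.

Lemma is_derive_bump k t : is_derive t 1 (bumpf k) (bumpf k.+1 t).
Proof.
rewrite /bumpf iterS; elim: (iter k _ _) => [|[p q] s IH].
  rewrite /bump_step/= big_nil; under eq_fun do rewrite big_nil; exact: is_derive_cst.
rewrite /bump_step /= !big_cons -/(bump_step s) /=.
under eq_fun do rewrite big_cons /=.
have d1 : is_derive t 1 (fun t => pexp p (1 + t)) (pexp (dpexp p) (1 + t) * 1).
  apply: (@is_derive1_comp _ (pexp p) (fun t => 1 + t)); first exact: is_derive_pexp.
  by rewrite -[X in is_derive _ _ _ X]add0r; exact: (is_deriveD (is_derive_cst (1 : R) t 1) (is_derive_id t 1)).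
have d2 : is_derive t 1 (fun t => pexp q (1 - t)) (pexp (dpexp q) (1 - t) * -1).
  apply: (@is_derive1_comp _ (pexp q) (fun t => 1 - t)); first exact: is_derive_pexp.
  by rewrite -[X in is_derive _ _ _ X]add0r; exact: (is_deriveB (is_derive_cst (1 : R) t 1) (is_derive_id t 1)).
apply: is_derive_eq; rewrite /GRing.scale/= pexpN; ring.
Qed.

Lemma bump_eq0 k t : 1 <= `|t| -> bumpf k t = 0.
Proof.
move=> t1; rewrite /bumpf; apply: big1 => pq _; rewrite /pexp.
have [h1|_] := ltP 0 (1 + t); have [h2|_] := ltP 0 (1 - t); rewrite ?mulr0 ?mul0r//.
by exfalso; move: t1; rewrite leNgt ltr_norml; move/negP; apply; apply/andP; split; lra.
Qed.

Lemma bump_bounded k : exists2 M : R, 0 < M & forall t, `|bumpf k t| <= M.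
Proof.
have cb : continuous (bumpf k).
  move=> t; apply: differentiable_continuous; apply/derivable1_diffP.
  by have [] := is_derive_bump k t.
have [|c _ cP] := @EVT_max R (fun t => `|bumpf k t|) (-1) 1 ltac:(lra).
  by apply: continuous_subspaceT => t; apply: cvg_norm; exact: cb.
exists (`|bumpf k c| + 1) => [|t]; first by rewrite ltr_wpDl.
have [t1|t1] := leP 1 `|t|; first by rewrite bump_eq0// normr0 addr_ge0.
apply: (@le_trans _ _ `|bumpf k c|); last by rewrite lerDl.
by apply: cP; rewrite in_itv/= -ler_norml ltW.
Qed.

Lemma bump0_ge0 t : 0 <= bumpf 0 t.
Proof.
rewrite /bumpf /= big_seq1 /pexp/= !hornerE.
by case: ifP; case: ifP; rewrite ?mulr0 ?mul0r// !mul1r mulr_ge0// expR_ge0.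
Qed.

Lemma bump0_ge t : `|t| <= 2^-1 -> expR (- 2) * expR (- 2) <= bumpf 0 t.
Proof.
rewrite ler_norml => /andP[t1 t2]; rewrite /bumpf /= big_seq1 /pexp/= !hornerE.
have h1 : 0 < 1 + t by lra.
have h2 : 0 < 1 - t by lra.
have inv2 (x : R) : 2^-1 <= x -> x^-1 <= 2.
  by move=> x2; rewrite -[leRHS]invrK lef_pV2// ?posrE ?(lt_le_trans _ x2)//; lra.
rewrite h1 h2; apply: ler_pM; rewrite ?expR_ge0// ler_expR lerN2 inv2//; lra.
Qed.

End bump.

Section line_derivative.
Context {R : realType} {V : normedModType R}.

Lemma is_derive_line (f : V -> R) (a v : V) (t l : R) :
  is_derive t 1 (fun s : R => f (s *: v + a)) l <-> is_derive (t *: v + a) v f l.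
Proof.
have E : (fun h : R => h^-1 *: (((fun s : R => f (s *: v + a)) \o shift t) (h *: 1) - f (t *: v + a))) =
    (fun h : R => h^-1 *: ((f \o shift (t *: v + a)) (h *: v) - f (t *: v + a))).
  by apply/funext => h /=; rewrite [h *: 1]mulr1 scalerDl addrA.
split=> -[d1 d2]; split.
- by move: d1; rewrite /derivable E.
- by rewrite -d2 /derive E.
- by move: d1; rewrite /derivable E.
- by rewrite -d2 /derive E.
Qed.

End line_derivative.

(** * Increments from partial derivatives *)

Section telescoping.
Context {R : realType} {n : nat}.
Implicit Types (x y : 'rV[R]_n).
Local Notation e_ i := (delta_mx 0 i : 'rV[R]_n).

Lemma MVT_between (f df : R -> R) (a b : R) :
  (forall x : R, Num.min a b <= x <= Num.max a b -> is_derive x 1 f (df x)) ->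
  exists2 c, Num.min a b <= c <= Num.max a b & f b - f a = df c * (b - a).
Proof.
wlog ab : a b / a < b => [H df_|df_].
  have [ab|ba|ab] := ltgtP a b.
  - have [c cab E] := H _ _ ab df_; exists c => //.
    by rewrite (min_l (ltW ab)) (max_r (ltW ab)) in cab.
  - have [|c cab E] := H _ _ ba; first by move=> x; rewrite minC maxC; exact: df_.
    exists c; first by rewrite (min_l (ltW ba)) (max_r (ltW ba)) in cab.
    by rewrite -opprB E -mulrN opprB.
  - by exists a; rewrite ?ab ?lexx// !subrr mulr0.
rewrite (min_l (ltW ab)) (max_r (ltW ab)) in df_ *.
have [||c cab E] := @MVT _ f df a b ab.
- by move=> x; rewrite in_itv/= => /andP[? ?]; apply: df_; rewrite !ltW.
- apply: derivable_within_continuous => x; rewrite in_itv/= => xab.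
  by have [] := df_ x xab.
by exists c => //; move: cab; rewrite in_itv/= => /andP[? ?]; rewrite !ltW.
Qed.

Definition between x y : set 'rV[R]_n :=
  [set z | forall j, Num.min (x 0 j) (y 0 j) <= z 0 j <= Num.max (x 0 j) (y 0 j)].

(** Coordinates are moved one at a time, by the mean value theorem; the intermediate points [mix s]
    stay in the box spanned by the two points. The slopes [m] are free: 0 gives a Lipschitz bound,
    the values at a point give differentiability there. *)
Lemma partials_increment (g : 'rV[R]_n -> R) (h : 'I_n -> 'rV[R]_n -> R)
    (m eta : 'I_n -> R) x0 x :
  (forall y, between x0 x y -> forall i, is_derive y (e_ i) g (h i y) /\
     `|h i y - m i| <= eta i) ->
  `|g x - g x0 - \sum_i m i * (x 0 i - x0 0 i)| <= \sum_i eta i * `|x 0 i - x0 0 i|.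
Proof.
move=> H.
pose mix (s : seq 'I_n) : 'rV[R]_n := \row_j (if j \in s then x 0 j else x0 0 j).
suff step (s : seq 'I_n) : uniq s ->
    `|g (mix s) - g x0 - \sum_(i <- s) m i * (x 0 i - x0 0 i)| <=
    \sum_(i <- s) eta i * `|x 0 i - x0 0 i|.
  have := step (index_enum 'I_n) (index_enum_uniq _).
  rewrite (_ : mix _ = x)//; apply/rowP => j; by rewrite mxE mem_index_enum.
elim: s => [_|i s IH /=].
  rewrite !big_nil subr0 (_ : mix _ = x0) ?subrr ?normr0//.
  by apply/rowP => j; rewrite mxE.
move=> /andP[nis /IH {}IH]; rewrite !big_cons.
have [|t tP] := @MVT_between (fun t => g (t *: e_ i + mix s)) (fun t => h i (t *: e_ i + mix s))
    0 (x 0 i - x0 0 i).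
  move=> t tP; apply/is_derive_line; apply: (H _ _ i).1 => j; rewrite !mxE eqxx/=.
  case: eqP => [->|_]; last first.
    rewrite mulr0 add0r; case: ifP => _; by rewrite ge_min le_max lexx ?orbT.
  rewrite (negbTE nis) mulr1; move: tP; rewrite /Num.min /Num.max; repeat case: ifPn; lra.
have -> : (x 0 i - x0 0 i) *: e_ i + mix s = mix (i :: s).
  apply/rowP => j; rewrite !mxE eqxx inE/=; case: eqP => [->|_].
    by rewrite (negbTE nis)/= mulr1 subrK.
  by rewrite mulr0 add0r.
rewrite scale0r add0r subr0 => E.
have -> : g (mix (i :: s)) - g x0 - (m i * (x 0 i - x0 0 i) + \sum_(j <- s) m j * (x 0 j - x0 0 j)) =
    (h i (t *: e_ i + mix s) - m i) * (x 0 i - x0 0 i) +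
    (g (mix s) - g x0 - \sum_(j <- s) m j * (x 0 j - x0 0 j)) by rewrite mulrBl -E; ring.
apply: le_trans (ler_normD _ _) _; apply: lerD => //.
rewrite normrM ler_wpM2r//; apply: (H _ _ i).2 => j; rewrite !mxE eqxx/=.
case: eqP => [->|_]; last first.
  rewrite mulr0 add0r; case: ifP => _; by rewrite ge_min le_max lexx ?orbT.
rewrite (negbTE nis) mulr1; move: tP; rewrite /Num.min /Num.max; repeat case: ifPn; lra.
Qed.

Lemma partials_lipschitz (g : 'rV[R]_n -> R) (h : 'I_n -> 'rV[R]_n -> R)
    (M : 'I_n -> R) x0 x :
  (forall y, between x0 x y -> forall i, is_derive y (e_ i) g (h i y) /\ `|h i y| <= M i) ->
  `|g x - g x0| <= \sum_i M i * `|x 0 i - x0 0 i|.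
Proof.
move=> H; have := @partials_increment g h (fun=> 0) M x0 x.
rewrite big1 ?subr0; last by move=> i _; rewrite mul0r.
by apply=> y yb i; rewrite subr0; exact: H.
Qed.

Lemma is_derive_partials (g : 'rV[R]_n -> R) (h : 'I_n -> 'rV[R]_n -> R) (a : 'rV[R]_n) :
  (\forall y \near a, forall i, is_derive y (e_ i) g (h i y)) ->
  (forall i, {for a, continuous (h i)}) ->
  forall v : 'rV[R]_n, is_derive a v g (\sum_i h i a * v 0 i).
Proof.
move=> gh hc v; apply: is_derive_littleo => e e0.
pose M : R := \sum_i `|v 0 i| + 1.
have M0 : 0 < M by rewrite ltr_wpDl// sumr_ge0.
have eM : 0 < e / M by rewrite divr_gt0.
have : \forall y \near a, (forall i, is_derive y (e_ i) g (h i y)) /\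
    (forall i, `|h i y - h i a| <= e / M).
  near=> y; split; first by near: y.
  near: y; apply: (@filter_forall _ _ (fun i (y : 'rV[R]_n) => `|h i y - h i a| <= e / M) (nbhs a)) => i.
  have /cvgrPdist_le /(_ _ eM) := hc i.
  by apply: filterS => y; rewrite distrC.
move=> /nbhs_ballP[d /= d0 dP].
near=> t.
have td : `|t| * M < d.
  rewrite -ltr_pdivlMr//; near: t; apply: (@nbhs0_lt R R^o); exact: divr_gt0.
have vM i : `|v 0 i| <= M.
  by rewrite /M (bigD1 i)//= -addrA lerDl addr_ge0// sumr_ge0.
have hyp y : between a (t *: v + a) y -> forall i,
    is_derive y (e_ i) g (h i y) /\ `|h i y - h i a| <= e / M.
  move=> yb; have [|h1 h2] := dP y; last by move=> i; split.
  split=> // i j; rewrite ord1 /ball/=; have := yb j; rewrite !mxE => yj.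
  apply: le_lt_trans td; apply: (@le_trans _ _ (`|t| * `|v 0 j|)); last by rewrite ler_wpM2l.
  rewrite -normrM; move: yj; set c := t * _.
  rewrite /Num.min /Num.max; have [c0|c0] := leP 0 c.
    rewrite (ger0_norm c0) ler_norml; repeat case: ifPn; lra.
  rewrite (ltr0_norm c0) ler_norml; repeat case: ifPn; lra.
have := @partials_increment g h (fun i => h i a) (fun=> e / M) a (t *: v + a) hyp.
have dE i : (t *: v + a) 0 i - a 0 i = t * v 0 i by rewrite !mxE addrK.
have -> : \sum_i h i a * ((t *: v + a) 0 i - a 0 i) = (\sum_i h i a * v 0 i) * t.
  by rewrite mulr_suml; apply: eq_bigr => i _; rewrite dE mulrCA mulrC.
move/le_trans; apply.
have -> : \sum_i e / M * `|(t *: v + a) 0 i - a 0 i| = (e / M * (\sum_i `|v 0 i|)) * `|t|.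
  rewrite mulr_sumr mulr_suml; apply: eq_bigr => i _.
  by rewrite dE normrM mulrCA mulrC.
rewrite ler_wpM2r// mulrAC ler_pdivrMr// ler_wpM2l ?(ltW e0)//.
by rewrite /M lerDl.
Unshelve. all: by end_near.
Qed.

(** The derivatives are data, so that both mollifications, whose derivatives are again convolutions,
    and C^2 solutions fit. *)
Definition C2_near (F : 'rV[R]_n -> R) (G : 'I_n -> 'rV[R]_n -> R)
    (H : 'I_n -> 'I_n -> 'rV[R]_n -> R) (x : 'rV[R]_n) : Prop :=
  [/\ \forall y \near x, forall i, is_derive y (e_ i) F (G i y),
      \forall y \near x, forall i, {for y, continuous (G i)},
      \forall y \near x, forall i j, is_derive y (e_ i) (G j) (H i j y) &
      forall i j, {for x, continuous (H i j)}].

Lemma local_max_second_order F G H x : C2_near F G H x ->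
  (\forall y \near x, F y <= F x) ->
  (forall i, G i x = 0) /\
  (forall z : 'rV[R]_n, \sum_i \sum_j H i j x * z 0 i * z 0 j <= 0).
Proof.
move=> [FG Gc GH Hc] Fmax.
have line (z : 'rV[R]_n) : (fun t : R => t *: z + x) @ (0 : R) --> x.
  have : (fun t : R => t *: z + x) @ (0 : R) --> 0 *: z + x.
    by apply: cvgD; [apply: cvgZ; [exact: cvg_id|exact: cvg_cst]|exact: cvg_cst].
  by rewrite scale0r add0r.
have d1 (z : 'rV[R]_n) : \forall t \near (0 : R),
    is_derive (t : R) 1 (fun s : R => F (s *: z + x)) (\sum_i G i (t *: z + x) * z 0 i).
  near=> t; apply/is_derive_line; apply: is_derive_partials.
    by near: t; exact: (line z _ (near_join FG)).
  by near: t; exact: (line z _ Gc).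
have dmax (z : 'rV[R]_n) : \forall t \near (0 : R),
    is_derive (t : R) 1 (fun s : R => F (s *: z + x)) (\sum_i G i (t *: z + x) * z 0 i) /\
    F (t *: z + x) <= F x.
  by near=> t; split; near: t; [exact: d1|exact: (line z _ Fmax)].
have {d1}G0 (z : 'rV[R]_n) : \sum_i G i x * z 0 i = 0.
  have [d /= d0 dP] := dmax z.
  have ball0 (t : R) : t \in `](- d), d[ -> is_derive t 1 (fun s : R => F (s *: z + x))
      (\sum_i G i (t *: z + x) * z 0 i) /\ F (t *: z + x) <= F x.
    by rewrite in_itv/= => td; apply: dP; rewrite /= sub0r normrN ltr_norml.
  have z0 : (0 : R) \in `](- d), d[ by rewrite in_itv/= oppr_lt0 d0.
  have [_ e1] : is_derive (0 : R) (1 : R) (fun s : R => F (s *: z + x)) 0.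
    apply: (@derive1_at_max _ _ (- d) d) => //; first lra.
      by move=> t /ball0[[]].
    by move=> t /ball0[_]; rewrite scale0r add0r.
  have [[_ +] _] := ball0 0 z0; rewrite scale0r add0r => <-.
  exact: e1.
split=> [i|z].
  have := G0 (e_ i); rewrite (bigD1 i)//= big1 => [|j /negbTE ji].
    by rewrite mxE !eqxx mulr1 addr0.
  by rewrite mxE ji andbF mulr0.
(* If the second derivative Q along z were positive, the first derivative D would be positive for
   small t > 0, and by the mean value theorem F would exceed its maximum. *)
rewrite leNgt; apply/negP => Q0; set Q := \sum_i _ in Q0.
pose D (t : R) := \sum_j G j (t *: z + x) * z 0 j.
have dD : is_derive (0 : R) (1 : R) D Q.
  have -> : D = \sum_j (fun t : R => G j (t *: z + x) * z 0 j).
    by apply/funext => t; rewrite fct_sumE.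
  have -> : Q = \sum_j (\sum_i H i j x * z 0 i) * z 0 j.
    rewrite /Q exchange_big/=; apply: eq_bigr => j _; rewrite mulr_suml.
    by apply: eq_bigr.
  apply: is_derive_sum => j.
  have dG : is_derive (0 : R) (1 : R) (fun t : R => G j (t *: z + x)) (\sum_i H i j x * z 0 i).
    apply/is_derive_line; rewrite scale0r add0r; apply: (@is_derive_partials (G j) (fun i => H i j)) => //.
    by apply: filterS GH => y Hy i; exact: Hy.
  by apply: is_derive_eq; rewrite /GRing.scale/= mulr0 add0r mulrC.
have D0 : D 0 = 0 by rewrite /D scale0r add0r; exact: G0.
have dQ : (fun h : R => h^-1 *: ((D \o shift 0) (h *: 1) - D 0)) @ 0^' --> Q.
  by case: dD => dd <-; exact: dd.
have /cvgrPdist_lt /(_ _ Q0) [d /= d0 dP] := dQ.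
have Dpos (h : R) : 0 < h -> h < d -> 0 < D h.
  move=> h0 hd; have := dP h; rewrite /= sub0r normrN gtr0_norm// => /(_ hd).
  rewrite gt_eqF// => /(_ isT); rewrite D0 subr0 addr0 [h *: 1]mulr1 ltr_norml => /andP[_].
  by rewrite ltrBlDr ltrDl pmulr_rgt0// invr_gt0.
have [d2 /= d20 d2P] := dmax z.
pose t := Num.min d d2 / 2.
have t0 : 0 < t by rewrite divr_gt0// lt_min d0.
have tm : t < Num.min d d2 by rewrite ltr_pdivrMr// ltr_pMr ?ltr1n// lt_min d0.
move: tm; rewrite lt_min => /andP[td td2].
have dF (s : R) : s \in `[0, t] -> is_derive s 1 (fun s : R => F (s *: z + x)) (D s) /\ F (s *: z + x) <= F x.
  rewrite in_itv/= => /andP[s0 st]; apply: d2P.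
  by rewrite /= sub0r normrN ger0_norm// (le_lt_trans st).
have [||c ct] := @MVT _ (fun s : R => F (s *: z + x)) D 0 t t0.
- by move=> s; rewrite in_itv/= => /andP[? ?]; apply: (dF s _).1; rewrite in_itv/= !ltW.
- by apply: derivable_within_continuous => s /dF[[]].
rewrite subr0 scale0r add0r => E.
move: ct; rewrite in_itv/= => /andP[c0 ctt].
have := (dF t _).2; rewrite in_itv/= lexx ltW// => /(_ isT).
have := mulr_gt0 (Dpos c c0 (lt_trans ctt td)) t0; rewrite -E; lra.
Unshelve. all: by end_near.
Qed.

End telescoping.

(** * Mollification *)

Section quadratic_forms.
Context {R : realType} {n : nat}.
Implicit Types (A Y : 'I_n -> 'I_n -> R) (z : 'rV[R]_n).
Local Notation e_ i := (delta_mx 0 i : 'rV[R]_n).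

Definition qform Y z : R := \sum_i \sum_j Y i j * z 0 i * z 0 j.

Lemma qform_delta Y k : qform Y (e_ k) = Y k k.
Proof.
rewrite /qform (bigD1 k)//= (bigD1 k)//= big1 => [|j /negbTE jk]; last first.
  by rewrite [(e_ k) 0 j]mxE jk andbF mulr0.
rewrite big1 => [|i /negbTE ik]; last first.
  by apply: big1 => j _; rewrite [(e_ k) 0 i]mxE ik andbF mulr0 mul0r.
by rewrite !mxE !eqxx !mulr1 !addr0.
Qed.

Lemma qform_add_delta Y z k (t : R) : (forall i j, Y i j = Y j i) ->
  qform Y (z + t *: e_ k) = qform Y z + 2 * t * (\sum_j Y k j * z 0 j) + t ^+ 2 * Y k k.
Proof.
move=> sY.
have E i : (z + t *: e_ k) 0 i = z 0 i + t * (i == k)%:R by rewrite !mxE eqxx.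
have -> : qform Y (z + t *: e_ k) = qform Y z
   + t * (\sum_i \sum_j Y i j * z 0 i * (j == k)%:R)
   + t * (\sum_i \sum_j Y i j * (i == k)%:R * z 0 j)
   + t ^+ 2 * (\sum_i \sum_j Y i j * (i == k)%:R * (j == k)%:R).
  rewrite /qform 3!mulr_sumr -!big_split/=; apply: eq_bigr => i _.
  rewrite 3!mulr_sumr -!big_split/=; apply: eq_bigr => j _; rewrite !E; ring.
have -> : \sum_i \sum_j Y i j * z 0 i * (j == k)%:R = \sum_j Y k j * z 0 j.
  apply: eq_bigr => i _; rewrite (bigD1 k)//= big1 => [|j /negbTE ->]; last by rewrite mulr0.
  by rewrite eqxx mulr1 addr0 sY.
have -> : \sum_i \sum_j Y i j * (i == k)%:R * z 0 j = \sum_j Y k j * z 0 j.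
  rewrite (bigD1 k)//= [X in _ + X]big1 => [|i /negbTE ->]; last first.
    by apply: big1 => j _; rewrite mulr0 mul0r.
  by rewrite addr0; apply: eq_bigr => j _; rewrite eqxx mulr1.
have -> : \sum_i \sum_j Y i j * (i == k)%:R * (j == k)%:R = Y k k.
  rewrite (bigD1 k)//= [X in _ + X]big1 => [|i /negbTE ->]; last first.
    by apply: big1 => j _; rewrite mulr0 mul0r.
  rewrite addr0 (bigD1 k)//= big1 => [|j /negbTE ->]; last by rewrite mulr0.
  by rewrite !eqxx !mulr1 addr0.
ring.
Qed.

(* A positive semidefinite Y is a sum of squares of linear forms: Gaussian
   elimination removes one row and column of Y at a time. *)
Lemma psd_dot_ge0_sym A Y : (forall z, 0 <= qform A z) ->
  (forall i j, Y i j = Y j i) -> (forall z, 0 <= qform Y z) ->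
  0 <= \sum_i \sum_j A i j * Y i j.
Proof.
move=> A0 sY Y0.
suff H (s : seq 'I_n) : forall Y, (forall i j, Y i j = Y j i) -> (forall z, 0 <= qform Y z) ->
    (forall i j, i \notin s -> Y i j = 0) -> 0 <= \sum_i \sum_j A i j * Y i j.
  by apply: (H (index_enum 'I_n)) => // i j; rewrite mem_index_enum.
elim: s => [|k s IH] {}Y {}sY {}Y0 Ys.
  by apply: sumr_ge0 => i _; apply: sumr_ge0 => j _; rewrite Ys ?mulr0.
have Ykk : 0 <= Y k k by rewrite -qform_delta.
have [Yk0|Yk0] := eqVneq (Y k k) 0.
  apply: IH => // i j; have [-> _|ik is_] := eqVneq i k; last first.
    by apply: Ys; rewrite inE negb_or ik.
  have key t : 0 <= Y j j + 2 * t * Y k j.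
    have := Y0 (e_ j + t *: e_ k); rewrite qform_add_delta// qform_delta Yk0 mulr0 addr0.
    rewrite (bigD1 j)//= big1 ?addr0 => [|i' /negbTE ij]; last by rewrite mxE ij andbF mulr0.
    by rewrite mxE !eqxx mulr1.
  apply/eqP; apply/negPn/negP => Ykj0.
  (* This choice of t makes the right-hand side of [key] equal to -1. *)
  have := key (- (Y j j + 1) / (2 * Y k j)).
  have -> : 2 * (- (Y j j + 1) / (2 * Y k j)) * Y k j = - (Y j j + 1) by field.
  lra.
have Ykk0 : 0 < Y k k by rewrite lt_def Yk0.
pose Y' i j := Y i j - Y k i * Y k j / Y k k.
have -> : \sum_i \sum_j A i j * Y i j =
    \sum_i \sum_j A i j * Y' i j + (Y k k)^-1 * qform A (\row_i Y k i).
  rewrite /qform mulr_sumr -big_split/=; apply: eq_bigr => i _.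
  rewrite mulr_sumr -big_split/=; apply: eq_bigr => j _; rewrite /Y' !mxE; ring.
apply: addr_ge0; last by rewrite mulr_ge0// invr_ge0.
apply: IH => [i j|z|i j].
- by rewrite /Y' sY [Y k i * _]mulrC.
- have -> : qform Y' z = qform Y (z + (- (\sum_j Y k j * z 0 j) / Y k k) *: e_ k).
    rewrite qform_add_delta//; set S := \sum_j Y k j * z 0 j.
    have -> : qform Y' z = qform Y z - S * S / Y k k.
      rewrite /qform -[S * S / _]mulrA mulr_suml -sumrN -big_split/=; apply: eq_bigr => i _.
      rewrite /S mulr_suml mulr_sumr -sumrN -big_split/=.
      by apply: eq_bigr => j _; rewrite /Y'; ring.
    by field.
  exact: Y0.
- have [-> _|ik is_] := eqVneq i k; first by rewrite /Y' mulrAC divff// mul1r subrr.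
  have Yi j' : Y i j' = 0 by apply: Ys; rewrite inE negb_or ik.
  by rewrite /Y' Yi [Y k i]sY Yi !mul0r subr0.
Qed.

(** The product of the semidefinite matrices A - lam I and Y has nonnegative trace. Y need not be
    symmetric: against a symmetric A only its symmetric part counts. *)
Lemma psd_dot_ge A Y (lam : R) : (forall i j, A i j = A j i) ->
  (forall z, lam * \sum_i z 0 i ^+ 2 <= qform A z) -> (forall z, 0 <= qform Y z) ->
  lam * \sum_i Y i i <= \sum_i \sum_j A i j * Y i j.
Proof.
move=> sA Al Y0.
pose A' i j := A i j - lam * (i == j)%:R.
pose Y' i j := (Y i j + Y j i) / 2.
have sumE (B : 'I_n -> 'I_n -> R) : \sum_i \sum_j (i == j)%:R * B i j = \sum_i B i i.
  apply: eq_bigr => i _; rewrite (bigD1 i)//= big1 => [|j ji]; last first.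
    by rewrite eq_sym (negbTE ji) mul0r.
  by rewrite eqxx mul1r addr0.
have := @psd_dot_ge0_sym A' Y'.
have -> : \sum_i \sum_j A' i j * Y' i j = \sum_i \sum_j A i j * Y i j - lam * \sum_i Y i i.
  rewrite -(sumE Y) mulr_sumr -sumrN -big_split/=.
  have -> : \sum_i \sum_j A' i j * Y' i j = (\sum_i \sum_j A' i j * Y i j +
      \sum_i \sum_j A' i j * Y j i) / 2.
    rewrite -big_split mulr_suml; apply: eq_bigr => i _.
    by rewrite -big_split mulr_suml; apply: eq_bigr => j _; rewrite /Y'/=; ring.
  have -> : \sum_i \sum_j A' i j * Y j i = \sum_i \sum_j A' i j * Y i j.
    rewrite exchange_big/=; apply: eq_bigr => i _; apply: eq_bigr => j _.
    by rewrite /A' sA eq_sym.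
  rewrite mulrDl.
  rewrite -splitr; apply: eq_bigr => i _.
  by rewrite mulr_sumr -sumrN -big_split/=; apply: eq_bigr => j _; rewrite /A'; ring.
rewrite subr_ge0; apply.
- move=> z; have := Al z; rewrite -subr_ge0 (_ : qform A z - _ = qform A' z)//.
  have -> : \sum_i z 0 i ^+ 2 = \sum_i \sum_j (i == j)%:R * (z 0 i * z 0 j) by rewrite sumE.
  rewrite mulr_sumr -sumrN -big_split/=; apply: eq_bigr => i _.
  by rewrite mulr_sumr -sumrN -big_split/=; apply: eq_bigr => j _; rewrite /A'; ring.
- by move=> i j; rewrite /Y' addrC.
move=> z; have -> : qform Y' z = qform Y z; last exact: Y0.
have -> : qform Y' z = (qform Y z + qform (fun i j => Y j i) z) / 2.
  rewrite /qform -big_split mulr_suml; apply: eq_bigr => i _.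
  by rewrite -big_split mulr_suml; apply: eq_bigr => j _; rewrite /Y'/=; ring.
have -> : qform (fun i j => Y j i) z = qform Y z.
  rewrite /qform exchange_big/=; apply: eq_bigr => i _; apply: eq_bigr => j _; ring.
by field.
Qed.

(** Testing with e_j + e_i and e_j - e_i bounds twice the entry by Y i i + Y j j. A bound on the
    trace thus controls every entry. *)
Lemma psd_entry_le Y i j : (forall i j, Y i j = Y j i) -> (forall z, 0 <= qform Y z) ->
  `|Y i j| <= \sum_k Y k k.
Proof.
move=> sY Y0; have Yk k : 0 <= Y k k by rewrite -qform_delta.
have key t : 0 <= Y j j + 2 * t * Y i j + t ^+ 2 * Y i i.
  have := Y0 (e_ j + t *: e_ i); rewrite qform_add_delta// qform_delta.
  rewrite (bigD1 j)//= big1 ?addr0 => [|k /negbTE kj]; last by rewrite mxE kj andbF mulr0.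
  by rewrite mxE !eqxx mulr1.
have [->|ij] := eqVneq i j.
  by rewrite ger0_norm// (bigD1 j)//= lerDl sumr_ge0.
have tr : Y i i + Y j j <= \sum_k Y k k.
  rewrite (bigD1 i)//= lerD2l (bigD1 j)//= 1?eq_sym// lerDl sumr_ge0//.
apply: le_trans tr; have := key 1; have := key (-1); have := Yk i; have := Yk j.
by rewrite ler_norml => *; apply/andP; split; lra.
Qed.

End quadratic_forms.

Lemma is_derive_line0 (R : realType) (V : normedModType R) (f : V -> R) (a v : V) (l : R) :
  is_derive (0 : R) (1 : R) (fun s : R => f (s *: v + a)) l -> is_derive a v f l.
Proof. by move=> /is_derive_line; rewrite scale0r add0r. Qed.

Lemma coord_le_norm (R : realType) (n : nat) (x : 'rV[R]_n) i : `|x 0 i| <= `|x|.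
Proof.
rewrite [leRHS]/Num.norm/= mx_normrE.
exact: (le_bigmax _ (fun p : 'I_1 * 'I_n => `|x p.1 p.2|) (0, i)).
Qed.

Lemma lipschitz_at_continuous (R : realType) (n : nat) (f : 'rV[R]_n -> R)
    (x : 'rV[R]_n) (L : R) : 0 < L ->
  (forall y, `|f y - f x| <= L * `|y - x|) -> {for x, continuous f}.
Proof.
move=> L0 lip; apply/(@cvgrPdist_le _ _ _ (nbhs x)) => e e0.
have eL : 0 < e / L by rewrite divr_gt0.
apply/nbhs_ballP; exists (e / L) => //= y; rewrite -ball_normE/= => xy.
rewrite distrC; apply: (le_trans (lip y)); rewrite mulrC -ler_pdivlMr// distrC.
exact: ltW.
Qed.

(** * Product kernels and convolutions *)

Section mollifier.
Context {R : realType} {n : nat}.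
Local Notation mu := (@lebesgue_rV R n).
Local Notation e_ i := (delta_mx 0 i : 'rV[R]_n).
Implicit Types (al : 'I_n -> nat) (x y z : 'rV[R]_n).

Definition incr al (i : 'I_n) : 'I_n -> nat := fun j => (al j + (j == i))%N.

(** This is the k-th derivative of t -> b(t/s), b being the bump, so that [kern s al] is the partial
    derivative of multi-index [al] of one fixed kernel. That kernel is not normalised; its mass is
    divided out in [moll]. *)
Definition kern1 (s : R) (k : nat) (t : R) : R := s^-1 ^+ k * bumpf k (t / s).

Definition kern (s : R) al z : R := \prod_i kern1 s (al i) (z 0 i).

Lemma is_derive_kern1 s k (t : R) : is_derive t 1 (kern1 s k) (kern1 s k.+1 t).
Proof.
have d1 : is_derive t 1 (fun t : R => t / s) s^-1.
  have := is_deriveM (is_derive_id t 1) (is_derive_cst (s^-1 : R) t 1).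
  by rewrite /cst scaler0 add0r [_ *: _]mulr1.
have d2 : is_derive t 1 (fun t => bumpf k (t / s)) (bumpf k.+1 (t / s) * s^-1).
  exact: (@is_derive1_comp _ (bumpf k) (fun t => t / s)) (is_derive_bump _ _) d1.
rewrite (_ : kern1 s k = s^-1 ^+ k \*: (fun t : R => bumpf k (t / s))).
  apply: is_derive_eq; rewrite /kern1 exprSr /GRing.scale/= -mulrA; congr (_ * _).
  exact: mulrC.
by apply/funext.
Qed.

Lemma is_derive_kern s al z i : is_derive z (e_ i) (kern s al) (kern s (incr al i) z).
Proof.
apply: is_derive_line0.
pose P := \prod_(j < n | j != i) kern1 s (al j) (z 0 j).
have -> : (fun t : R => kern s al (t *: e_ i + z)) =
    (fun t => kern1 s (al i) (t + z 0 i) * P).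
  apply/funext => t; rewrite /kern (bigD1 i)//=; congr (kern1 _ _ _ * _).
    by rewrite !mxE !eqxx mulr1.
  by apply: eq_bigr => j /negbTE ji; rewrite !mxE ji andbF mulr0 add0r.
have -> : kern s (incr al i) z = kern1 s (al i).+1 (0 + z 0 i) * P.
  rewrite /kern (bigD1 i)//= add0r /incr eqxx addn1; congr (_ * _).
  by apply: eq_bigr => j /negbTE ji; rewrite ji addn0.
have d1 : is_derive (0 : R) (1 : R) (fun t : R => t + z 0 i) 1.
  have := is_deriveD (is_derive_id (0 : R) 1) (is_derive_cst (z 0 i : R) (0 : R) (1 : R)).
  by rewrite addr0.
have d2 : is_derive (0 : R) (1 : R) (fun t : R => kern1 s (al i) (t + z 0 i))
    (kern1 s (al i).+1 (0 + z 0 i) * 1).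
  exact: (@is_derive1_comp _ (kern1 s (al i)) (fun t => t + z 0 i)) (is_derive_kern1 _ _ _) d1.
have := is_deriveM d2 (is_derive_cst (P : R) (0 : R) (1 : R)).
by rewrite /cst scaler0 add0r mulr1 [_ *: _]mulrC.
Qed.

Lemma kern_eq0 s al z i : 0 < s -> s <= `|z 0 i| -> kern s al z = 0.
Proof.
move=> s0 zs; rewrite /kern (bigD1 i)//= /kern1 bump_eq0 ?mulr0 ?mul0r//.
by rewrite normrM normfV (gtr0_norm s0) ler_pdivlMr// mul1r.
Qed.

Lemma kern_bounded s al : exists2 M : R, 0 < M & forall z, `|kern s al z| <= M.
Proof.
have /choice[M MP] : forall i, exists M : R, 0 < M /\ forall t, `|kern1 s (al i) t| <= M.
  move=> i; have [M M0 MP] := @bump_bounded R (al i).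
  exists (`|s^-1 ^+ al i| * M + 1); split; first by rewrite ltr_wpDl// mulr_ge0// ltW.
  by move=> t; rewrite normrM (le_trans (ler_wpM2l _ (MP _)))// lerDl.
exists (\prod_i M i); first by apply: prodr_gt0 => i _; exact: (MP i).1.
move=> z; rewrite normr_prod; apply: ler_prod => i _.
by rewrite normr_ge0/=; exact: (MP i).2.
Qed.

Lemma continuous_kern1 s k : continuous (kern1 s k).
Proof.
move=> t; apply: differentiable_continuous; apply/derivable1_diffP.
by have [] := is_derive_kern1 s k t.
Qed.

Lemma measurable_kern s al x D :
  measurable_fun D (fun y : leb_rV R n => kern s al ((y : 'rV[R]_n) - x)).
Proof.
apply: measurable_funTS; apply: measurable_prod => i _.
have -> : (fun y : leb_rV R n => kern1 s (al i) (((y : 'rV[R]_n) - x) 0 i)) =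
    (fun t => kern1 s (al i) (t - x 0 i)) \o (fun y : leb_rV R n => (y : 'rV[R]_n) 0 i).
  by apply/funext => y /=; rewrite !mxE.
apply: measurableT_comp; last exact: measurable_coord.
apply: continuous_measurable_fun => t.
apply: (@continuous_comp _ _ _ (fun t : R => t - x 0 i) (kern1 s (al i))); last exact: continuous_kern1.
by apply: cvgB; [exact: cvg_id|exact: cvg_cst].
Qed.

Variable D : set (leb_rV R n).
Hypothesis mD : measurable D.

(** The kernel is taken at y - x, so that as a function of y it is the test function of the weak
    identity; each derivative in x then costs a sign. *)
Definition kconv (f : 'rV[R]_n -> R) s al x : R :=
  \int[mu]_(y in D) (f y * kern s al (y - x)).

Variable f : 'rV[R]_n -> R.
Hypothesis intf : mu.-integrable D (EFin \o (f : leb_rV R n -> R)).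

Let mf : measurable_fun D (f : leb_rV R n -> R).
Proof. by apply/measurable_EFinP; case/integrableP: intf. Qed.

Lemma integrable_kern s al x :
  mu.-integrable D (EFin \o (fun y : leb_rV R n => f y * kern s al ((y : 'rV[R]_n) - x))).
Proof.
have [M M0 MP] := kern_bounded s al.
apply: (@le_integrable _ _ _ mu D mD _ (fun y => (M%:E * (f y)%:E)%E)).
- by apply/measurable_EFinP; apply: measurable_funM; [exact: mf|exact: measurable_kern].
- move=> y _; rewrite -EFinM lee_fin !normrM (gtr0_norm M0) mulrC.
  by rewrite ler_wpM2r.
exact: integrableZl.
Qed.

Lemma is_derive_kconv s al x i :
  is_derive x (e_ i) (kconv f s al) (- kconv f s (incr al i) x).
Proof.
apply: is_derive_line0.
pose F (t : R) (y : leb_rV R n) : R := f y * kern s al ((y : 'rV[R]_n) - (t *: e_ i + x)).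
have dF (t : R) (y : leb_rV R n) :
    is_derive t 1 (F ^~ y) (- (f y * kern s (incr al i) ((y : 'rV[R]_n) - (t *: e_ i + x)))).
  have d0 : is_derive (- t) 1 (fun u : R => kern s al (u *: e_ i + ((y : 'rV[R]_n) - x)))
      (kern s (incr al i) ((y : 'rV[R]_n) - (t *: e_ i + x))).
    apply/is_derive_line.
    have -> : (y : 'rV[R]_n) - (t *: e_ i + x) = (- t) *: e_ i + ((y : 'rV[R]_n) - x).
      by rewrite scaleNr opprD addrCA.
    exact: is_derive_kern.
  have d1 : is_derive t 1 (fun u : R => - u) (- (1 : R)) by exact: is_deriveN.
  have d2 := @is_derive1_comp _ _ (fun u : R => - u) _ _ _ d0 d1.
  have d3 := is_deriveM (is_derive_cst (f y : R) t (1 : R)) d2.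
  have -> : F ^~ y = (cst (f y) : R -> R) * ((fun u : R => kern s al (u *: e_ i + ((y : 'rV[R]_n) - x))) \o -%R).
    apply/funext => u; rewrite /F /GRing.mul/= /cst; congr (_ * kern _ _ _).
    by rewrite scaleNr opprD addrCA.
  apply: is_derive_eq; rewrite /cst scaler0 addr0 /GRing.scale/= ; ring.
have [M M0 MP] := kern_bounded s (incr al i).
pose G (y : leb_rV R n) := M * `|f y|.
have I0 : `](-1 : R), 1[%classic (0 : R) by rewrite /= in_itv/= ltrN10 ltr01.
have iF (t : R) : `](-1 : R), 1[%classic t -> mu.-integrable D (EFin \o F t).
  by move=> _; exact: integrable_kern.
have ddF (t : R) (y : leb_rV R n) : `](-1 : R), 1[%classic t -> D y -> derivable (F ^~ y) t 1.
  by move=> _ _; case: (dF t y).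
have G0 (y : leb_rV R n) : 0 <= G y by rewrite mulr_ge0// ltW.
have iG : mu.-integrable D (EFin \o G).
  rewrite (_ : _ \o _ = (fun y => M%:E * (`|f y|)%:E)%E)//.
  apply: integrableZl => //; exact: integrable_abse intf.
have p1 (t : R) (y : leb_rV R n) : partial1of2 F t y =
    - (f y * kern s (incr al i) ((y : 'rV[R]_n) - (t *: e_ i + x))).
  by rewrite partial1of2E; case: (dF t y).
have Gub (t : R) (y : leb_rV R n) : `](-1 : R), 1[%classic t -> D y -> `|partial1of2 F t y| <= G y.
  by move=> _ _; rewrite p1 normrN normrM mulrC ler_wpM2r.
have dd := @derivable_under_integral _ _ _ mu F D mD 0 (-1) 1 I0 iF ddF G G0 iG Gub.
have dE := @differentiation_under_integral _ _ _ mu F D mD 0 (-1) 1 I0 iF ddF G G0 iG Gub.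
split; first exact: dd.
rewrite -derive1E; apply: (etrans dE).
under eq_Rintegral do rewrite p1 scale0r add0r -mulN1r.
by rewrite RintegralZl// ?mulN1r//; exact: integrable_kern.
Qed.

Lemma conv_bounded s al : exists2 M : R, 0 <= M & forall x, `|kconv f s al x| <= M.
Proof.
have [M M0 MP] := kern_bounded s al.
exists (\int[mu]_(y in D) (M * `|f y|)).
  by apply: Rintegral_ge0 => y _; rewrite mulr_ge0// ltW.
move=> x; apply: (le_trans (le_normr_Rintegral mD (integrable_kern s al x))).
apply: le_Rintegral => //.
- exact: integrable_abse (integrable_kern s al x).
- rewrite (_ : _ \o _ = (fun y => M%:E * (`|f y|)%:E)%E)//.
  apply: integrableZl => //; exact: integrable_abse intf.
by move=> y _; rewrite normrM mulrC ler_wpM2r.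
Qed.

Lemma continuous_conv s al : continuous (kconv f s al).
Proof.
move=> x; have /choice[M MP] : forall i, exists M : R, 0 <= M /\
    forall y, `|kconv f s (incr al i) y| <= M.
  by move=> i; have [M M0 MP] := conv_bounded s (incr al i); exists M.
pose L : R := \sum_i M i + 1.
have L0 : 0 < L by rewrite ltr_wpDl// sumr_ge0// => i _; exact: (MP i).1.
have lip y : `|kconv f s al y - kconv f s al x| <= L * `|y - x|.
  have := @partials_lipschitz R n (kconv f s al) (fun i z => - kconv f s (incr al i) z) M x y.
  move=> /(_ _)/le_trans; apply.
    by move=> z _ i; rewrite normrN; split; [exact: is_derive_kconv|exact: (MP i).2].
  rewrite /L mulrDl mul1r mulr_suml ler_wpDr//; apply: ler_sum => i _.
  rewrite ler_wpM2l//; first exact: (MP i).1.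
  by have := coord_le_norm (y - x) i; rewrite !mxE.
exact: (lipschitz_at_continuous L0 lip).
Qed.

End mollifier.

Section kernel_test_function.
Context {R : realType} {n : nat}.
Local Notation mu := (@lebesgue_rV R n).
Local Notation e_ i := (delta_mx 0 i : 'rV[R]_n).
Implicit Types (al : 'I_n -> nat) (x y z : 'rV[R]_n).

Definition incrs (sq : seq 'I_n) : 'I_n -> nat :=
  foldr (fun i al => incr al i) (fun=> 0%N) sq.

Lemma is_derive_kern_shift s al x y i :
  is_derive y (e_ i) (fun y => kern s al (y - x)) (kern s (incr al i) (y - x)).
Proof.
apply: is_derive_line0.
have -> : (fun t : R => kern s al (t *: e_ i + y - x)) =
    (fun t : R => kern s al (t *: e_ i + (y - x))).
  by apply/funext => t; rewrite addrA.
apply/is_derive_line; rewrite scale0r add0r; exact: is_derive_kern.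
Qed.

Lemma partials_kern s sq x :
  partials sq (fun y => kern s (fun=> 0%N) (y - x)) = (fun y => kern s (incrs sq) (y - x)).
Proof.
elim: sq => [//|i sq IH] /=; rewrite -/(partials sq _) IH; apply/funext => y.
by have [_ ->] := is_derive_kern_shift s (incrs sq) x y i.
Qed.

Lemma continuous_kern_shift s al x y : {for y, continuous (fun y => kern s al (y - x))}.
Proof.
have /choice[M MP] : forall i, exists M : R, 0 <= M /\
    forall z, `|kern s (incr al i) z| <= M.
  by move=> i; have [M M0 MP] := kern_bounded s (incr al i); exists M; split=> //; exact: ltW.
pose L : R := \sum_i M i + 1.
have L0 : 0 < L by rewrite ltr_wpDl// sumr_ge0// => i _; exact: (MP i).1.
apply: (lipschitz_at_continuous L0) => y'.
have := @partials_lipschitz R n (fun y => kern s al (y - x))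
  (fun i z => kern s (incr al i) (z - x)) M y y'.
move=> /(_ _)/le_trans; apply.
  by move=> z _ i; split; [exact: is_derive_kern_shift|exact: (MP i).2].
rewrite /L mulrDl mul1r mulr_suml ler_wpDr//; apply: ler_sum => i _.
rewrite ler_wpM2l//; first exact: (MP i).1.
by have := coord_le_norm (y' - y) i; rewrite !mxE.
Qed.

Lemma test_function_kern (s : R) x (Omega : set 'rV[R]_n) : 0 < s ->
  [set y : 'rV[R]_n | forall i, (x - const_mx s) 0 i <= y 0 i <= (x + const_mx s) 0 i] `<=` Omega ->
  test_function Omega (fun y => kern s (fun=> 0%N) (y - x)).
Proof.
move=> s0 xO; split.
  move=> k y _ sq; rewrite partials_kern; split=> [_|_ i].
    exact: continuous_kern_shift.
  by case: (is_derive_kern_shift s (incrs sq) x y i).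
set K := [set y | _] in xO.
have cK : compact K by exact: compact_closed_box.
have clK : closed K by apply: compact_closed => //; exact: norm_hausdorff.
have supp : closure [set y | kern s (fun=> 0%N) (y - x) != 0] `<=` K.
  move: clK => /closure_id ->; apply: closureS => y /= ky i; rewrite !mxE.
  have : `|y 0 i - x 0 i| < s.
    rewrite ltNge; apply/negP => h; move: ky; rewrite (@kern_eq0 _ _ _ _ _ i)// ?eqxx//.
    by rewrite !mxE.
  by rewrite ltr_norml => /andP[? ?]; apply/andP; split; lra.
split; last exact: subset_trans supp xO.
by apply: subclosed_compact cK supp; exact: closed_closure.
Qed.

End kernel_test_function.

Section weak_identity.
Context {R : realType} {n : nat}.
Local Notation mu := (@lebesgue_rV R n).
Variables (c : 'rV[R]_n) (rho : R) (Omega : set 'rV[R]_n).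
Hypothesis rho0 : 0 < rho.

Definition ccube (r : R) : set 'rV[R]_n :=
  [set y | forall i, `|y 0 i - c 0 i| <= r].

Hypothesis DO : ccube (2 * rho) `<=` Omega.
Local Notation D := (cube c (2 * rho)).

Lemma ccubeE r : ccube r =
  [set y : 'rV[R]_n | forall i, (c - const_mx r) 0 i <= y 0 i <= (c + const_mx r) 0 i].
Proof.
apply/seteqP; split=> y h i; have := h i; rewrite /= !mxE ler_norml => /andP[? ?];
  apply/andP; split; lra.
Qed.

Lemma cube_sub_ccube r : cube c r `<=` ccube r.
Proof. by rewrite ccubeE => y h i; have /andP[/ltW -> ->] := h i. Qed.

Lemma Rintegral_kern_restrict (f : 'rV[R]_n -> R) s al x : 0 < s <= rho -> ccube rho x ->
  \int[mu]_(y in Omega) (f y * kern s al (y - x)) = kconv D f s al x.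
Proof.
move=> /andP[s0 sr] xr; rewrite /kconv /Rintegral; congr fine.
rewrite integral_mkcond [RHS]integral_mkcond; apply: eq_integral => y _.
rewrite !patchE; case: ifPn => yO; case: ifPn => yD => //.
  have [i iP] : exists i, ~ (c 0 i - 2 * rho < y 0 i <= c 0 i + 2 * rho).
    apply/existsNP => h; move: yD; rewrite notin_setE; apply=> i.
    by have := h i; rewrite /= !mxE.
  rewrite (@kern_eq0 _ _ _ _ _ i) ?mulr0// !mxE leNgt; apply/negP.
  have := xr i; rewrite ler_norml ltr_norml => /andP[? ?] /andP[? ?]; apply: iP.
  by apply/andP; split; lra.
exfalso; move: yO; rewrite notin_setE; apply; apply: DO; apply: cube_sub_ccube.
by rewrite inE in yD.
Qed.

(** The kernel centred at x is a test function of Omega, because its support stays in the doubled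
    cube. *)
Lemma weak_partials_conv sq (u v : 'rV[R]_n -> R) s x :
  weak_partials Omega sq u v -> 0 < s <= rho -> ccube rho x ->
  kconv D u s (incrs sq) x = (-1) ^+ size sq * kconv D v s (fun=> 0%N) x.
Proof.
move=> [_ _ uv] sr xr; have := uv (fun y => kern s (fun=> 0%N) (y - x)).
rewrite partials_kern => /(_ _).
rewrite Rintegral_kern_restrict// Rintegral_kern_restrict//; apply.
case/andP: sr => s0 sr.
apply: test_function_kern => // y yx; apply: DO => i.
have := yx i; rewrite !mxE => /andP[? ?]; have := xr i; rewrite !ler_norml => /andP[? ?].
by apply/andP; split; lra.
Qed.

End weak_identity.

(** * Jensen's inequality for powers *)

Section jensen.
Context d (T : measurableType d) (R : realType) (mu : {measure set T -> \bar R}).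

(** The convex function t^(q+1) lies above its tangent at a. The induction step adds the product of
    the like-signed factors t - a and t^(q+1) - a^(q+1). *)
Lemma tangent_power (a t : R) (q : nat) : 0 <= a -> 0 <= t ->
  q.+1%:R * a ^+ q * t <= t ^+ q.+1 + q%:R * a ^+ q.+1.
Proof.
move=> a0 t0; elim: q => [|q IH].
  by rewrite expr0 !mul1r mul0r addr0 expr1.
have h : 0 <= (t - a) * (t ^+ q.+1 - a ^+ q.+1).
  have [ta|at_] := leP t a.
    rewrite -mulrNN mulr_ge0// opprB subr_ge0//.
    by apply: lerXn2r; rewrite ?nnegrE.
  rewrite mulr_ge0// subr_ge0 ?(ltW at_)//.
  by apply: lerXn2r; rewrite ?nnegrE ?(ltW at_).
have := ler_wpM2r a0 IH; rewrite -[q.+2%:R]natr1 !exprSr -[q.+1%:R]natr1 in h *.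
move: (a ^+ q) (t ^+ q) (q%:R : R) h => A B Q h IH'; lra.
Qed.

(** The tangent inequality is integrated with tangent point a = S / V; this needs only that V bounds
    the measure of A from above. *)
Lemma jensen_power (A : set T) (h : T -> R) (V : R) (q : nat) :
  measurable A -> (mu A <= V%:E)%E -> measurable_fun A h -> (forall x, 0 <= h x) ->
  mu.-integrable A (EFin \o h) ->
  (((\int[mu]_(x in A) h x) ^+ q.+1)%:E <= (V ^+ q)%:E * \int[mu]_(x in A) (h x ^+ q.+1)%:E)%E.
Proof.
move=> mA AV mh h0 ih.
set S := \int[mu]_(x in A) h x.
have S0 : 0 <= S by apply: Rintegral_ge0 => x _.
have SE : (\int[mu]_(x in A) (h x)%:E = S%:E)%E.
  by rewrite /S /Rintegral fineK//; exact: integrable_fin_num.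
have hq0 x : 0 <= h x ^+ q.+1 by rewrite exprn_ge0.
have mhq : measurable_fun A (fun x => h x ^+ q.+1) by exact: measurable_funX.
have I0 : (0 <= \int[mu]_(x in A) (h x ^+ q.+1)%:E)%E.
  by apply: integral_ge0 => x _; rewrite lee_fin.
have [S_0|Spos] := eqVneq S 0.
  rewrite S_0 expr0n/=; apply: mule_ge0 => //; rewrite lee_fin exprn_ge0//.
  by rewrite -lee_fin; apply: le_trans AV.
have {}Spos : 0 < S by rewrite lt_def Spos.
have V0 : 0 < V.
  rewrite ltNge; apply/negP => V0.
  have A0 : mu A = 0%E.
    by apply/eqP; rewrite eq_le measure_ge0 andbT (le_trans AV)// lee_fin.
  have : (\int[mu]_(x in A) (h x)%:E = 0)%E by apply: null_set_integral => //; exact/measurable_EFinP.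
  by rewrite SE => -[] S0'; rewrite S0' ltxx in Spos.
case IE : (\int[mu]_(x in A) (h x ^+ q.+1)%:E)%E => [I| |].
- pose a := S / V.
  have a0 : 0 <= a by rewrite divr_ge0// ltW.
  have := @ge0_le_integral_comb _ _ _ mu A (fun x => q.+1%:R * a ^+ q * h x)
     (fun x => h x ^+ q.+1) (fun=> 1) 1 (q%:R * a ^+ q.+1) mA ler01.
  have qa0 : 0 <= q%:R * a ^+ q.+1 by rewrite mulr_ge0// exprn_ge0.
  have mqh : measurable_fun A (fun x => q.+1%:R * a ^+ q * h x).
    by apply: measurable_funM => //; exact: measurable_cst.
  have qh0 x : A x -> 0 <= q.+1%:R * a ^+ q * h x.
    by move=> _; rewrite !mulr_ge0// exprn_ge0.
  move=> /(_ qa0 mqh mhq (measurable_cst _) qh0 (fun x _ => hq0 x) (fun _ _ => ler01)).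
  have le x : A x -> q.+1%:R * a ^+ q * h x <= 1 * h x ^+ q.+1 + q%:R * a ^+ q.+1 * 1.
    by move=> _; rewrite mul1r mulr1; exact: tangent_power.
  move=> /(_ le); rewrite mul1e IE integral_cst// mul1e.
  have -> : (\int[mu]_(x in A) (q.+1%:R * a ^+ q * h x)%:E = (q.+1%:R * a ^+ q * S)%:E)%E.
    rewrite [RHS]EFinM -SE -ge0_integralZl_EFin//.
    - by move=> x _; rewrite lee_fin.
    - exact/measurable_EFinP.
    - by rewrite mulr_ge0// exprn_ge0.
  move=> H.
  have {H} : ((q.+1%:R * a ^+ q * S)%:E <= I%:E + (q%:R * a ^+ q.+1 * V)%:E)%E.
    by apply: (le_trans H); rewrite leeD2l// EFinM lee_wpmul2l// lee_fin.
  rewrite -EFinD -EFinM !lee_fin => H.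
  have SaV : S = a * V by rewrite divfK ?gt_eqF.
  have : a ^+ q.+1 * V <= I.
    by move: H; rewrite [in X in X <= _ -> _]SaV mulrA -(mulrA q.+1%:R) -exprSr -natr1; nra.
  move=> H2; rewrite SaV exprMn exprSr [V ^+ q.+1]exprSr.
  have := ler_wpM2l (exprn_ge0 q (ltW V0)) H2; rewrite exprSr; nra.
- by rewrite gt0_muley ?leey// lte_fin exprn_gt0.
- by rewrite IE in I0.
Qed.

End jensen.

(** * Mollification estimated by oscillation *)

Section mollifier_estimates.
Context {R : realType} {n : nat}.
Local Notation mu := (@lebesgue_rV R n).
Implicit Types (x y z : 'rV[R]_n) (f : 'rV[R]_n -> R).
Local Notation kern0 s := (kern s (fun=> 0%N)).

Lemma kern0_ge0 (s : R) z : 0 <= kern0 s z.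
Proof. by apply: prodr_ge0 => i _; rewrite /kern1 expr0 mul1r bump0_ge0. Qed.

Definition kmass (s : R) : R := \int[mu]_y kern0 s y.

Lemma kern0_le : exists2 M : R, 0 < M & forall (s : R) z, kern0 s z <= M.
Proof.
have [M M0 MP] := @bump_bounded R 0.
exists (M ^+ n); first by rewrite exprn_gt0.
move=> s z; rewrite (_ : M ^+ n = \prod_(i < n) M); last by rewrite prodr_const card_ord.
apply: ler_prod => i _; rewrite /kern1 expr0 mul1r bump0_ge0/=.
exact: le_trans (ler_norm _) (MP _).
Qed.

Lemma integral_kern0_ge : exists2 c0 : R, 0 < c0 & forall s : R, 0 < s ->
  ((c0 * s ^+ n)%:E <= \int[mu]_y (kern0 s y)%:E)%E.
Proof.
pose c1 : R := expR (- 2) * expR (- 2).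
have c10 : 0 < c1 by rewrite mulr_gt0// expR_gt0.
exists (c1 ^+ n) => [|s s0]; first by rewrite exprn_gt0.
pose Q : set (leb_rV R n) := box (const_mx (- (s / 2)), const_mx (s / 2)).
have mQ : measurable Q by exact: measurable_box.
have mk D : measurable_fun D (fun y : leb_rV R n => (kern0 s (y : 'rV[R]_n))%:E).
  apply/measurable_EFinP; have := @measurable_kern R n s (fun=> 0%N) (0 : 'rV[R]_n) D.
  by under eq_fun do rewrite subr0.
have k0 (y : leb_rV R n) : (0 <= (kern0 s (y : 'rV[R]_n))%:E)%E by rewrite lee_fin kern0_ge0.
apply: (@le_trans _ _ (\int[mu]_(y in Q) (kern0 s y)%:E)%E); last first.
  by apply: (@ge0_subset_integral _ _ _ mu _ _ mQ measurableT).
apply: (@le_trans _ _ (\int[mu]_(y in Q) (c1 ^+ n)%:E)%E).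
  rewrite integral_cst// EFinM; apply: lee_wpmul2l; first by rewrite lee_fin exprn_ge0// ltW.
  have := @lebesgue_box_ge R n (const_mx (- (s / 2))) (const_mx (s / 2)).
  rewrite (_ : \prod_i _ = s ^+ n).
    by apply=> i; rewrite !mxE; lra.
  rewrite -[in RHS](card_ord n) -prodr_const; apply: eq_bigr => i _; rewrite !mxE.
  by rewrite opprK -splitr.
apply: (@ge0_le_integral _ _ _ mu _ mQ).
- by move=> y _; rewrite lee_fin exprn_ge0// ltW.
- exact: measurable_cst.
- exact: mk.
move=> y Qy; rewrite lee_fin -[n in leLHS](card_ord n) -prodr_const.
apply: ler_prod => i _; rewrite (ltW c10)/= /kern1 expr0 mul1r; apply: bump0_ge.
have := Qy i; rewrite /= !mxE normrM normfV (gtr0_norm s0) => /andP[/ltW h1 h2].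
by rewrite ler_pdivrMr// mulrC ler_norml h1.
Qed.

Variables (c : 'rV[R]_n) (rho : R).
Hypothesis rho0 : 0 < rho.
Local Notation D := (cube c (2 * rho)).

Let mD : measurable D. Proof. exact: measurable_cube. Qed.

Lemma integrable_cst_cube (k : R) : mu.-integrable D (EFin \o (fun=> k)).
Proof.
apply/integrableP; split; first exact: measurable_cst.
rewrite (_ : (fun x => _) = cst (`|k|%:E))//.
rewrite integral_cst//; apply: lte_mul_pinfty => //; exact: lebesgue_cube_lty.
Qed.

Lemma integral_kern_cube (s : R) x : 0 < s <= rho -> ccube c rho x ->
  (\int[mu]_(y in D) (kern0 s (y - x))%:E = \int[mu]_y (kern0 s y)%:E)%E.
Proof.
move=> /andP[s0 sr] xr.
have mk : measurable_fun [set: leb_rV R n] (fun y : leb_rV R n => (kern0 s (y : 'rV[R]_n))%:E).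
  apply/measurable_EFinP; have := @measurable_kern R n s (fun=> 0%N) (0 : 'rV[R]_n) setT.
  by under eq_fun do rewrite subr0.
rewrite -(ge0_integral_translate (- x) mk); last by move=> y; rewrite lee_fin kern0_ge0.
rewrite integral_mkcond; apply: eq_integral => y _; rewrite patchE; case: ifPn => // yD.
have [i iP] : exists i, ~ (c 0 i - 2 * rho < y 0 i <= c 0 i + 2 * rho).
  apply/existsNP => h; move: yD; rewrite notin_setE; apply=> i.
  by have := h i; rewrite /= !mxE.
rewrite (@kern_eq0 _ _ _ _ _ i)// !mxE leNgt; apply/negP.
have := xr i; rewrite ler_norml ltr_norml => /andP[? ?] /andP[? ?]; apply: iP.
by apply/andP; split; lra.
Qed.

Lemma kmassE (s : R) : 0 < s <= rho -> (\int[mu]_y (kern0 s y)%:E = (kmass s)%:E)%E.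
Proof.
move=> sr; rewrite /kmass /Rintegral fineK//.
have cr : ccube c rho c by move=> i; rewrite subrr normr0 ltW.
rewrite -(integral_kern_cube sr cr).
have := integrable_kern mD (integrable_cst_cube 1) s (fun=> 0%N) c.
move=> /(integrable_fin_num mD); congr (_ \is a fin_num).
by apply: eq_integral => y _ /=; rewrite mul1r.
Qed.

Definition moll f s x : R := (kmass s)^-1 * kconv D f s (fun=> 0%N) x.

Lemma moll_dist : exists2 C : R, 0 < C & forall f s x m (Q : set (leb_rV R n)),
  mu.-integrable D (EFin \o (f : leb_rV R n -> R)) ->
  0 < s <= rho -> ccube c rho x -> measurable Q -> Q `<=` D ->
  (forall y : 'rV[R]_n, D y -> (forall i, `|y 0 i - x 0 i| < s) -> Q y) ->
  `|moll f s x - m| <= C / s ^+ n * \int[mu]_(y in Q) `|f y - m|.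
Proof.
have [M M0 MP] := kern0_le; have [c0 c00 c0P] := integral_kern0_ge.
exists (M / c0) => [|f s x m Q intf sr xr mQ QD Qx]; first by rewrite divr_gt0.
have s0 : 0 < s by case/andP: sr.
have k0 : c0 * s ^+ n <= kmass s by rewrite -lee_fin -kmassE// c0P.
have cs0 : 0 < c0 * s ^+ n by rewrite mulr_gt0// exprn_gt0.
have km0 : 0 < kmass s by exact: lt_le_trans k0.
have ifm : mu.-integrable D (EFin \o (fun y : leb_rV R n => f y - m)).
  rewrite (_ : _ \o _ = (EFin \o (f : leb_rV R n -> R)) \- (EFin \o (fun=> m)))%E//.
  by apply: integrableB => //; exact: integrable_cst_cube.
have E : moll f s x - m = (kmass s)^-1 * kconv D (fun y => f y - m) s (fun=> 0%N) x.
  have -> : kconv D (fun y => f y - m) s (fun=> 0%N) x =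
      kconv D f s (fun=> 0%N) x - m * kmass s.
    have -> : m * kmass s = \int[mu]_(y in D) (m * kern0 s (y - x)).
      have kk : kmass s = \int[mu]_(y in D) kern0 s (y - x).
        by rewrite /kmass /Rintegral integral_kern_cube.
      rewrite kk -RintegralZl//.
      have := integrable_kern mD (integrable_cst_cube 1) s (fun=> 0%N) x.
      by under eq_fun do rewrite mul1r.
    rewrite /kconv -RintegralB//.
    - by apply: eq_Rintegral => y _; rewrite mulrBl.
    - exact: integrable_kern.
    - exact: integrable_kern (integrable_cst_cube m) _ _ _.
  by rewrite /moll; field; rewrite gt_eqF.
rewrite E normrM (ger0_norm (ltW _)) ?invr_gt0//.
have ifmQ : mu.-integrable Q (EFin \o (fun y : leb_rV R n => f y - m)).
  exact: integrableS mD mQ QD ifm.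
have ifQ : mu.-integrable Q (EFin \o (fun y : leb_rV R n => `|f y - m|)).
  exact: integrable_abse ifmQ.
have step : `|kconv D (fun y => f y - m) s (fun=> 0%N) x| <= M * \int[mu]_(y in Q) `|f y - m|.
  have -> : kconv D (fun y => f y - m) s (fun=> 0%N) x =
      \int[mu]_(y in Q) ((f y - m) * kern0 s (y - x)).
    rewrite /kconv /Rintegral; congr fine.
    rewrite -[in RHS](setIidr QD) integral_mkcondr; apply: eq_integral => y yD.
    rewrite patchE; case: ifPn => // yQ.
    have [i iP] : exists i, ~ (`|y 0 i - x 0 i| < s).
      apply/existsNP => h; move: yQ; rewrite notin_setE; apply; apply: Qx => //.
      by rewrite inE in yD.
    rewrite (@kern_eq0 _ _ _ _ _ i) ?mulr0// !mxE leNgt; exact/negP.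
  have ik := integrable_kern mQ ifmQ s (fun=> 0%N) x.
  apply: (le_trans (le_normr_Rintegral mQ ik)).
  rewrite -RintegralZl//; apply: (@le_Rintegral _ _ _ mu Q).
  - exact: mQ.
  - exact: integrable_abse ik.
  - rewrite (_ : _ \o _ = (fun y => M%:E * (`|f y - m|)%:E)%E)//.
    exact: integrableZl.
  move=> y _; rewrite normrM mulrC ler_wpM2r// ger0_norm ?kern0_ge0//.
apply: (@le_trans _ _ ((c0 * s ^+ n)^-1 * (M * \int[mu]_(y in Q) `|f y - m|))).
  apply: ler_pM => //; first by rewrite invr_ge0 ltW.
  by rewrite lef_pV2.
by rewrite le_eqVlt; apply/orP; left; apply/eqP; rewrite invfM; ring.
Qed.

(** Jensen's inequality on a set of volume at most (3 s)^n cancels all powers of s but one factor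
    s^n, so the constant is independent of the scale. For q + 1 = n and a weak second derivative f,
    the left-hand side measures the volume of slopes produced by one cell. *)
Lemma moll_dist_power (q : nat) : exists2 C : R, 0 < C & forall f s x m (Q : set (leb_rV R n)),
  mu.-integrable D (EFin \o (f : leb_rV R n -> R)) ->
  0 < s <= rho -> ccube c rho x -> measurable Q -> Q `<=` D ->
  (mu Q <= ((3 * s) ^+ n)%:E)%E ->
  (forall y : 'rV[R]_n, D y -> (forall i, `|y 0 i - x 0 i| < s) -> Q y) ->
  ((`|moll f s x - m| ^+ q.+1 * s ^+ n)%:E <=
    C%:E * \int[mu]_(y in Q) (`|f y - m| ^+ q.+1)%:E)%E.
Proof.
have [C C0 CP] := moll_dist.
exists (C ^+ q.+1 * (3 ^+ n) ^+ q) => [|f s x m Q intf sr xr mQ QD QV Qx].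
  by rewrite mulr_gt0 ?exprn_gt0.
have s0 : 0 < s by case/andP: sr.
have sn0 : 0 < s ^+ n by rewrite exprn_gt0.
have H := CP f s x m Q intf sr xr mQ QD Qx.
have mf : measurable_fun D (f : leb_rV R n -> R).
  by apply/measurable_EFinP; case/integrableP: intf.
have ifm : mu.-integrable Q (EFin \o (fun y : leb_rV R n => f y - m)).
  apply: (integrableS mD mQ QD).
  rewrite (_ : _ \o _ = (EFin \o (f : leb_rV R n -> R)) \- (EFin \o (fun=> m)))%E//.
  by apply: integrableB => //; exact: integrable_cst_cube.
have mfm : measurable_fun Q (fun y : leb_rV R n => `|f y - m|).
  apply: (measurableT_comp (@normr_measurable R setT)).
  by apply: measurable_funB; [exact: measurable_funS mD QD mf|exact: measurable_cst].
have J := @jensen_power _ _ R mu Q (fun y => `|f y - m|) _ q mQ QV mfm (fun=> normr_ge0 _)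
  (integrable_abse ifm).
set S := \int[mu]_(y in Q) `|f y - m| in H J.
have S0 : 0 <= S by apply: Rintegral_ge0.
apply: (@le_trans _ _ ((C ^+ q.+1 / (s ^+ n) ^+ q)%:E * (S ^+ q.+1)%:E)%E).
  rewrite -EFinM lee_fin.
  have -> : C ^+ q.+1 / (s ^+ n) ^+ q * S ^+ q.+1 = (C / s ^+ n * S) ^+ q.+1 * s ^+ n.
    by rewrite !exprMn exprVn [(s ^+ n) ^+ q.+1]exprSr; field; rewrite !gt_eqF ?exprn_gt0.
  rewrite ler_wpM2r ?(ltW sn0)//; apply: lerXn2r => //; rewrite nnegrE//.
  by rewrite mulr_ge0// divr_ge0// ltW.
apply: (@le_trans _ _ ((C ^+ q.+1 / (s ^+ n) ^+ q)%:E * ((((3 * s) ^+ n) ^+ q)%:E *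
   \int[mu]_(y in Q) (`|f y - m| ^+ q.+1)%:E))%E).
  by apply: lee_wpmul2l => //; rewrite lee_fin divr_ge0// ?exprn_ge0// ltW.
rewrite muleA -EFinM; apply: lee_wpmul2r.
  by apply: integral_ge0 => y _; rewrite lee_fin exprn_ge0.
rewrite lee_fin le_eqVlt; apply/orP; left; apply/eqP.
by rewrite !exprMn; field; rewrite !gt_eqF ?exprn_gt0.
Qed.

Lemma moll_uniform : exists2 C : R, 0 < C & forall f s x e,
  mu.-integrable D (EFin \o (f : leb_rV R n -> R)) ->
  0 < s <= rho -> ccube c rho x -> 0 <= e ->
  (forall y : 'rV[R]_n, (forall i, `|y 0 i - x 0 i| <= s) -> `|f y - f x| <= e) ->
  `|moll f s x - f x| <= C * e.
Proof.
have [C C0 CP] := moll_dist.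
exists (C * 2 ^+ n) => [|f s x e intf sr xr e0 fe]; first by rewrite mulr_gt0// exprn_gt0.
have s0 : 0 < s by case/andP: sr.
have sr' : s <= rho by case/andP: sr.
have sn0 : 0 < s ^+ n by rewrite exprn_gt0.
pose Q : set (leb_rV R n) := box (x - const_mx s, x + const_mx s).
have mQ : measurable Q by exact: measurable_box.
have QD : Q `<=` D.
  move=> y Qy i; have := Qy i; have := xr i; rewrite /= !mxE ler_norml => /andP[? ?] /andP[? ?].
  by apply/andP; split; lra.
have QE : mu Q = ((2 * s) ^+ n)%:E.
  rewrite lebesgue_box; last by move=> i; rewrite !mxE; lra.
  rewrite -[in RHS](card_ord n) -prodr_const; congr EFin; apply: eq_bigr => i _.
  by rewrite !mxE; ring.
apply: (le_trans (CP f s x (f x) Q intf sr xr mQ QD _)).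
  move=> y _ yx i; have := yx i; rewrite /= !mxE ltr_norml => /andP[? ?].
  by apply/andP; split; lra.
have ifm : mu.-integrable Q (EFin \o (fun y : leb_rV R n => f y - f x)).
  apply: (integrableS mD mQ QD).
  rewrite (_ : _ \o _ = (EFin \o (f : leb_rV R n -> R)) \- (EFin \o (fun=> f x)))%E//.
  by apply: integrableB => //; exact: integrable_cst_cube.
have : \int[mu]_(y in Q) `|f y - f x| <= \int[mu]_(y in Q) e.
  apply: (@le_Rintegral _ _ _ mu Q).
  - exact: mQ.
  - exact: integrable_abse ifm.
  - exact: integrableS mD mQ QD (integrable_cst_cube e).
  move=> y Qy; apply: fe => i; have := Qy i; rewrite /= !mxE ler_norml => /andP[? ?].
  by apply/andP; split; lra.
have -> : \int[mu]_(y in Q) e = e * (2 * s) ^+ n.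
  by rewrite /Rintegral integral_cst// QE -EFinM.
have Cs : 0 <= C / s ^+ n by rewrite divr_ge0// ltW.
move=> /(ler_wpM2l Cs) /le_trans; apply; rewrite le_eqVlt; apply/orP; left; apply/eqP.
by rewrite exprMn; field; rewrite gt_eqF.
Qed.

Lemma cell0_ccube N (f : {ffun 'I_n -> 'I_N.+1}) : cell c rho 0 f `<=` ccube c rho.
Proof.
move=> x fx i; have := fx i; rewrite /= !mxE subr0 addr0 => /andP[h1 h2].
have s0 := mesh_gt0 rho0 N; have sE := meshE rho N.
have F0 : 0 <= (f i)%:R :> R by [].
have F1 : (f i)%:R + 1 <= N.+1%:R :> R by rewrite natr1 ler_nat.
have := ler_wpM2l (ltW s0) F1; have := mulr_ge0 (ltW s0) F0; rewrite sE => *.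
by rewrite ler_norml; apply/andP; split; lra.
Qed.

Lemma cell0_near N (f : {ffun 'I_n -> 'I_N.+1}) (x y : 'rV[R]_n) : cell c rho 0 f x ->
  (forall i, `|y 0 i - x 0 i| < mesh rho N) -> cell c rho 1 f y.
Proof.
move=> fx yx i; have := fx i; have := yx i; rewrite /= !mxE subr0 addr0 ltr_norml.
by move=> /andP[? ?] /andP[? ?]; apply/andP; split; lra.
Qed.

Lemma lebesgue_cell1_le N (f : {ffun 'I_n -> 'I_N.+1}) :
  (mu (cell c rho 1 f) <= ((3 * mesh rho N) ^+ n)%:E)%E.
Proof.
have s0 := mesh_gt0 rho0 N.
apply: (le_trans (lebesgue_box_le _)); rewrite lee_fin.
rewrite -[n in leRHS](card_ord n) -prodr_const; apply: ler_prod => i _.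
by rewrite le_max lexx orbT/= !mxE ge_max; apply/andP; split; lra.
Qed.

Lemma lebesgue_cell0 N (f : {ffun 'I_n -> 'I_N.+1}) :
  mu (cell c rho 0 f) = (mesh rho N ^+ n)%:E.
Proof.
have s0 := mesh_gt0 rho0 N.
rewrite lebesgue_box => [|i]; last by rewrite !mxE; lra.
rewrite -[in RHS](card_ord n) -prodr_const; congr EFin; apply: eq_bigr => i _.
by rewrite !mxE; ring.
Qed.

Lemma cell0_cover N (x : 'rV[R]_n) : cube c rho x ->
  exists f : {ffun 'I_n -> 'I_N.+1}, cell c rho 0 f x.
Proof.
move=> xc; have s0 := mesh_gt0 rho0 N; have sE := meshE rho N.
have /choice[j jP] : forall i, exists j : 'I_N.+1,
    c 0 i - rho + mesh rho N * j%:R < x 0 i <= c 0 i - rho + mesh rho N * (j%:R + 1).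
  move=> i; have := xc i; rewrite /= !mxE => /andP[x1 x2].
  pose P (k : nat) := x 0 i <= c 0 i - rho + mesh rho N * k%:R.
  have exP : exists k, P k by exists N.+1; rewrite /P sE; lra.
  case: (ex_minnP exP) => k Pk kmin.
  have k0 : (0 < k)%N.
    by rewrite lt0n; apply/negP => /eqP k0; move: Pk; rewrite /P k0 mulr0 addr0; lra.
  have kN : (k.-1 < N.+1)%N by rewrite prednK//; apply: kmin; rewrite /P sE; lra.
  exists (Ordinal kN) => /=; rewrite natr1 prednK//; apply/andP; split=> //.
  by rewrite ltNge; apply/negP => /kmin; lia.
exists [ffun i => j i] => i; have := jP i; rewrite /= !mxE ffunE subr0 addr0.
exact.
Qed.

Lemma integral_cube_le_cells N (g : 'rV[R]_n -> R) :
  measurable_fun D (g : leb_rV R n -> R) -> (forall x, 0 <= g x) ->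
  (\int[mu]_(x in cube c rho) (g x)%:E <=
    \sum_(f : {ffun 'I_n -> 'I_N.+1}) \int[mu]_(x in cell c rho 0 f) (g x)%:E)%E.
Proof.
move=> mg g0; have mC := measurable_cube c rho.
have CD : cube c rho `<=` D.
  by move=> y Cy i; have := Cy i; rewrite /= !mxE => /andP[? ?]; apply/andP; split; lra.
have cellC (f : {ffun 'I_n -> 'I_N.+1}) : cell c rho 0 f `<=` cube c rho.
  move=> x fx i; have := fx i; rewrite /= !mxE subr0 addr0 => /andP[h1 h2].
  have s0 := mesh_gt0 rho0 N; have sE := meshE rho N.
  have F0 : 0 <= (f i)%:R :> R by [].
  have F1 : (f i)%:R + 1 <= N.+1%:R :> R by rewrite natr1 ler_nat.
  have := ler_wpM2l (ltW s0) F1; have := mulr_ge0 (ltW s0) F0; rewrite sE => *.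
  by apply/andP; split; lra.
have mgC : measurable_fun (cube c rho) (g : leb_rV R n -> R) by exact: measurable_funS mD CD mg.
pose F (f : {ffun 'I_n -> 'I_N.+1}) (x : leb_rV R n) : \bar R := (g x * \1_(cell c rho 0 f) x)%:E.
have mF (f : {ffun 'I_n -> 'I_N.+1}) : measurable_fun (cube c rho) (F f).
  apply/measurable_EFinP; apply: measurable_funM => //.
  by apply: measurable_indic; exact: measurable_cell.
have F0 (f : {ffun 'I_n -> 'I_N.+1}) (x : leb_rV R n) : cube c rho x -> (0 <= F f x)%E.
  by move=> _; rewrite lee_fin mulr_ge0.
rewrite [leRHS](_ : _ = \sum_(f : {ffun 'I_n -> 'I_N.+1}) \int[mu]_(x in cube c rho) F f x)%E; last first.
  apply: eq_bigr => f _; rewrite -[in LHS](setIidr (cellC f)) integral_mkcondr.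
  by apply: eq_integral => x _; rewrite patchE /F indicE; case: ifP => _; rewrite ?mulr1 ?mulr0.
rewrite -(@ge0_integral_sum _ _ _ mu _ mC _ F mF F0).
apply: (@ge0_le_integral _ _ _ mu _ mC).
- by move=> x _; rewrite lee_fin.
- exact/measurable_EFinP.
- exact: emeasurable_sum.
move=> x Cx; have [f fx] := cell0_cover N Cx.
rewrite (bigD1 f)//= /F indicE (mem_set fx) mulr1 leeDl// sume_ge0// => f' _.
by rewrite lee_fin mulr_ge0.
Qed.

(** The du Bois-Reymond lemma. On a cell the integral of |g| is at most that of |g - m| plus |m|
    s^n, and |m| is the distance of m to the vanishing mollification, which [moll_dist_power] bounds
    by the oscillation. *)
Lemma moll_eq0_integral (g : 'rV[R]_n -> R) :
  mu.-integrable D (EFin \o (g : leb_rV R n -> R)) ->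
  (forall s x, 0 < s <= rho -> ccube c rho x -> moll g s x = 0) ->
  (\int[mu]_(x in cube c rho) (`|g x|)%:E = 0)%E.
Proof.
move=> ig g0.
have mg : measurable_fun D (g : leb_rV R n -> R).
  by apply/measurable_EFinP; case/integrableP: ig.
have og : vanishing_osc c rho 1 g.
  by apply: vanishing_osc_Lq => //; have /integrableP[_] := ig.
have [C C0 CP] := moll_dist_power 0.
have mag : measurable_fun D (fun x : leb_rV R n => `|g x|).
  exact: (measurableT_comp (@normr_measurable R setT)).
apply/eqP; rewrite eq_le integral_ge0 ?andbT; last by move=> x _; rewrite lee_fin.
apply/lee_addgt0Pr => e e0; rewrite add0e.
have d0 : 0 < e / (1 + C) by rewrite divr_gt0// addr_gt0.
have [N0 /(_ N0.+1 (leqnSn _)) [m mP]] := og _ d0.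
have s0 := mesh_gt0 rho0 N0.+1.
have sr : 0 < mesh rho N0.+1 <= rho.
  rewrite s0/= /mesh ler_pdivrMr// mulrC ler_pM2l//; have : 2 <= N0.+2%:R :> R by rewrite ler_nat.
  exact.
apply: (le_trans (integral_cube_le_cells N0.+1 mag (fun=> normr_ge0 _))).
apply: (@le_trans _ _ ((1 + C)%:E * osc_sum c rho 1 g m)%E); last first.
  apply: (@le_trans _ _ ((1 + C)%:E * (e / (1 + C))%:E)%E).
    by apply: lee_wpmul2l => //; rewrite lee_fin addr_ge0// ltW.
  by rewrite -EFinM lee_fin mulrC divfK// gt_eqF// addr_gt0.
rewrite /osc_sum ge0_sume_distrr; last first.
  by move=> f _; apply: integral_ge0 => x _; rewrite lee_fin exprn_ge0.
apply: lee_sum => f _.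
have cD := @cell_sub_cube R n c rho rho0 N0 f.
have mc1 := measurable_cell c rho 1 f; have mc0 := measurable_cell c rho 0 f.
have c01 : cell c rho 0 f `<=` cell c rho 1 f.
  by move=> x fx; apply: (cell0_near fx) => i; rewrite subrr normr0.
have mgm : measurable_fun (cell c rho 1 f) (fun x : leb_rV R n => `|g x - m f| ^+ 1).
  apply: measurable_absX; apply: measurable_funB; last exact: measurable_cst.
  exact: measurable_funS mD cD mg.
have mgm0 := measurable_funS mc1 c01 mgm.
apply: (@le_trans _ _ (\int[mu]_(x in cell c rho 0 f) (`|g x - m f| ^+ 1)%:E +
   `|m f|%:E * \int[mu]_(x in cell c rho 0 f) (cst 1 x)%:E)%E).
  have := @ge0_le_integral_comb _ _ _ mu (cell c rho 0 f) (fun x => `|g x|)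
    (fun x => `|g x - m f| ^+ 1) (cst 1) 1 `|m f| mc0 ler01 (normr_ge0 _).
  rewrite mul1e; apply.
  - exact: (measurable_funS mD (subset_trans c01 cD) mag).
  - exact: mgm0.
  - exact: measurable_cst.
  - by move=> x _.
  - by move=> x _; rewrite exprn_ge0.
  - by move=> x _.
  - move=> x _; rewrite mul1r mulr1 expr1 -[in leLHS](subrK (m f) (g x)); exact: ler_normD.
have -> : (\int[mu]_(x in cell c rho 0 f) (cst 1 x)%:E = (mesh rho N0.+1 ^+ n)%:E)%E.
  by rewrite (@integral_cst _ _ _ mu _ mc0 1%E) mul1e (lebesgue_cell0 f).
rewrite EFinD ge0_muleDl ?lee_fin ?(ltW C0)// mul1e.
apply: leeD.
  have mg1 : measurable_fun (cell c rho 1 f) (fun x : leb_rV R n => (`|g x - m f| ^+ 1)%:E).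
    exact/measurable_EFinP.
  by apply: (@ge0_subset_integral _ _ _ mu _ _ mc0 mc1 _ mg1 _ c01) => x _; rewrite lee_fin exprn_ge0.
rewrite -EFinM.
pose x0 : 'rV[R]_n := \row_i (c 0 i - rho + mesh rho N0.+1 * ((f i)%:R + 1)).
have fx0 : cell c rho 0 f x0.
  by move=> i; rewrite /= !mxE subr0 addr0 lexx andbT ltrD2l ltr_pM2l// ltrDl.
have := CP g (mesh rho N0.+1) x0 (m f) (cell c rho 1 f) ig sr (cell0_ccube fx0) mc1 cD
  (lebesgue_cell1_le f) (fun y _ yx => cell0_near fx0 yx).
by rewrite g0// ?sub0r ?normrN ?expr1//; exact: cell0_ccube.
Qed.

End mollifier_estimates.

(** * The Aleksandrov-Bakelman-Pucci argument *)

Lemma cvg_sumr (R : realType) (T : Type) (F : set_system T) (FF : Filter F) (I : finType)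
    (f : I -> T -> R) (l : I -> R) :
  (forall i, f i x @[x --> F] --> l i) -> \sum_i f i x @[x --> F] --> \sum_i l i.
Proof. by move=> fl; apply: cvg_big => //; exact: add_continuous. Qed.

Section quadratic_polynomial.
Context {R : realType} {n : nat}.
Local Notation e_ i := (delta_mx 0 i : 'rV[R]_n).
Implicit Types (z : 'rV[R]_n) (p : 'I_n -> R) (X : 'I_n -> 'I_n -> R).

Definition quadp p X z : R := \sum_i p i * z 0 i + 2^-1 * qform X z.

Lemma continuous_coordB (c : 'rV[R]_n) i : continuous (fun x : 'rV[R]_n => (x - c) 0 i).
Proof.
move=> x; rewrite (_ : (fun x => _) = (fun x : 'rV[R]_n => x 0 i - c 0 i)); last first.
  by apply/funext => y; rewrite !mxE.
have cx : (fun y : 'rV[R]_n => y 0 i) @ x --> x 0 i by exact: coord_continuous.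
by apply: cvgB cx _; exact: cvg_cst.
Qed.

Lemma continuous_lform p (c : 'rV[R]_n) : continuous (fun x : 'rV[R]_n => \sum_i p i * (x - c) 0 i).
Proof.
by move=> x; apply: (@cvg_sumr _ _ (nbhs x)) => i; apply: cvgMl_tmp; exact: continuous_coordB.
Qed.

Lemma continuous_quadp p X (c : 'rV[R]_n) : continuous (fun x : 'rV[R]_n => quadp p X (x - c)).
Proof.
move=> x; have cl := @continuous_lform p c x.
have cq i j : (fun y : 'rV[R]_n => X i j * (y - c) 0 i * (y - c) 0 j) @ x -->
    X i j * (x - c) 0 i * (x - c) 0 j.
  have ci := @continuous_coordB c i x; have cj := @continuous_coordB c j x.
  by apply: cvgM cj; apply: cvgMl_tmp.
have FF : Filter (nbhs x) := nbhs_filter x.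
have cQ := @cvg_sumr R _ (nbhs x) FF _ _ _ (fun i => @cvg_sumr R _ (nbhs x) FF _ _ _ (cq i)).
exact: cvgD cl (@cvgMl_tmp _ _ _ _ _ 2^-1 _ cQ).
Qed.

Lemma quadp0 p X : quadp p X 0 = 0.
Proof.
rewrite /quadp /qform big1 => [|i _]; last by rewrite !mxE !mulr0.
rewrite big1 ?mulr0 ?addr0// => i _; apply: big1 => j _; by rewrite !mxE !mulr0.
Qed.

Lemma is_derive_quadp p X (c y : 'rV[R]_n) i : (forall i j, X i j = X j i) ->
  is_derive y (e_ i) (fun x => quadp p X (x - c)) (p i + \sum_j X i j * (y - c) 0 j).
Proof.
move=> sX; apply: (@is_derive_quad _ _ _ _ _ _ `|X i i|); near=> h.
have -> : h *: e_ i + y - c = (y - c) + h *: e_ i by rewrite -addrA addrC.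
rewrite /quadp qform_add_delta//.
have -> : \sum_j p j * (y - c + h *: e_ i) 0 j = \sum_j p j * (y - c) 0 j + p i * h.
  under eq_bigr do rewrite [(y - c + h *: e_ i) 0 _]mxE mulrDr.
  rewrite big_split/=; congr (_ + _).
  rewrite (bigD1 i)//= big1 => [|j /negbTE ji]; last by rewrite !mxE ji andbF mulr0 mulr0.
  by rewrite !mxE !eqxx mulr1 addr0.
set S := \sum_j X i j * _; set T := \sum_j p j * _.
rewrite (_ : _ - _ - _ = 2^-1 * (h ^+ 2 * X i i)); last by field.
rewrite normrM normrM (ger0_norm (sqr_ge0 h)) mulrCA [leRHS]mulrC ler_wpM2l ?sqr_ge0//.
rewrite ger0_norm ?ler_piMl//; first by rewrite invf_le1 ?ler1n.
Unshelve. all: by end_near.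
Qed.

Lemma is_derive_quadp_grad p X (c y : 'rV[R]_n) i j :
  is_derive y (e_ i) (fun x => p j + \sum_k X j k * (x - c) 0 k) (X j i).
Proof.
apply: (@is_derive_quad _ _ _ _ _ _ 0); near=> h; rewrite mul0r.
have -> : h *: e_ i + y - c = (y - c) + h *: e_ i by rewrite -addrA addrC.
under eq_bigr do rewrite [(y - c + h *: e_ i) 0 _]mxE mulrDr.
rewrite big_split/= (_ : \sum_k X j k * (h *: e_ i) 0 k = X j i * h); last first.
  rewrite (bigD1 i)//= big1 => [|k /negbTE ki]; last by rewrite !mxE ki andbF !mulr0.
  by rewrite !mxE !eqxx mulr1 addr0.
set S := \sum_k _; rewrite (_ : _ - _ - _ = 0) ?normr0//; ring.
Unshelve. all: by end_near.
Qed.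

End quadratic_polynomial.

Lemma compact_continuous_uniform (R : realType) (n : nat) (K : set 'rV[R]_n) (w : 'rV[R]_n -> R) (e : R) :
  compact K -> (forall x, K x -> {for x, continuous w}) -> 0 < e ->
  exists2 s0 : R, 0 < s0 & forall x y, K x -> `|y - x| <= s0 -> `|w y - w x| <= e.
Proof.
move=> cK cw e0.
have := compact_near_coveringP K; move=> [+ _] => /(_ cK).
move=> /(_ R (0^'+) (fun s x => forall y, `|y - x| <= s -> `|w y - w x| <= e) _) [].
  move=> x Kx.
  have /cvgrPdist_lt /(_ (e / 2)) := cw x Kx; rewrite divr_gt0// => /(_ isT).
  move=> /nbhs_ballP[r /= r0 rP].
  have r20 : 0 < r / 2 by rewrite divr_gt0.
  exists (ball x (r / 2), [set s : R | s < r / 2]).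
    by split; [exact: nbhsx_ballx|exact: nbhs_right_lt].
  move=> [x' s] /= [xx' sr] y yx'.
  have x'r : `|x - x'| < r / 2 by move: xx'; rewrite -ball_normE.
  have h1 : `|w x - w x'| < e / 2.
    by apply: rP; rewrite -ball_normE /=; apply: (lt_trans x'r); rewrite ltr_pdivrMr// ltr_pMr// ltr1n.
  have h2 : `|w x - w y| < e / 2.
    apply: rP; rewrite -ball_normE /=.
    have -> : x - y = (x - x') - (y - x') by rewrite opprB addrA subrK.
    by apply: (le_lt_trans (ler_normB _ _)); lra.
  have -> : w y - w x' = (w x - w x') - (w x - w y) by ring.
  by apply: (le_trans (ler_normB _ _)); lra.
move=> s /= s0 sP; exists (s / 2); first by rewrite divr_gt0.
move=> x y Kx yx; apply: (sP (s / 2)) => //=; last by rewrite divr_gt0.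
by rewrite sub0r normrN gtr0_norm ?divr_gt0// ltr_pdivrMr// ltr_pMr// ltr1n.
Qed.

(** * Contact points of the mollification *)

Section contact_points.
Context {R : realType} {n : nat}.
Local Notation mu := (@lebesgue_rV R n).
Local Notation e_ i := (delta_mx 0 i : 'rV[R]_n).
Variables (c : 'rV[R]_n) (rho : R).
Hypothesis rho0 : 0 < rho.
Local Notation D := (cube c (2 * rho)).
Variable w : 'rV[R]_n -> R.
Hypothesis iw : mu.-integrable D (EFin \o (w : leb_rV R n -> R)).

Let mD : measurable D. Proof. exact: measurable_cube. Qed.

(** The sign undoes those of [is_derive_kconv], which makes this the derivative along [sq] of the
    mollification of w. *)
Definition dmoll (sq : seq 'I_n) (s : R) (x : 'rV[R]_n) : R :=
  (-1) ^+ size sq * ((kmass (n := n) s)^-1 * kconv D w s (incrs sq) x).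

Lemma dmoll0 s x : dmoll [::] s x = moll c rho w s x.
Proof. by rewrite /dmoll expr0 mul1r. Qed.

Lemma is_derive_dmoll sq s x i : is_derive x (e_ i) (dmoll sq s) (dmoll (i :: sq) s x).
Proof.
have dk := is_derive_kconv mD iw s (incrs sq) x i.
have -> : dmoll sq s = ((-1) ^+ size sq * (kmass (n := n) s)^-1) \*: kconv D w s (incrs sq).
  by apply/funext => y; rewrite /dmoll mulrA.
apply: is_derive_eq; rewrite /dmoll/= exprS -[_ *: _]/(_ * _); ring.
Qed.

Lemma continuous_dmoll sq s : continuous (dmoll sq s).
Proof.
move=> x; have ck := @continuous_conv _ _ _ mD _ iw s (incrs sq) x.
have -> : dmoll sq s = (fun y => (-1) ^+ size sq * (kmass (n := n) s)^-1 * kconv D w s (incrs sq) y).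
  by apply/funext => y; rewrite /dmoll mulrA.
have FF : Filter (nbhs x) := nbhs_filter x.
exact: (@cvgMl_tmp R _ (nbhs x) FF (kconv D w s (incrs sq)) _ _ ck).
Qed.

Lemma dmoll_sym i j s x : dmoll [:: i; j] s x = dmoll [:: j; i] s x.
Proof.
rewrite /dmoll (_ : incrs [:: i; j] = incrs [:: j; i])//.
by apply/funext => k; rewrite /= /incr addnAC.
Qed.

Variables (p : 'I_n -> R) (X : 'I_n -> 'I_n -> R) (eta del : R).
Hypothesis sX : forall i j, X i j = X j i.
Hypothesis del_eta : n%:R * del < eta * rho.
Hypothesis eta0 : 0 < eta.
Hypothesis cw : forall x, ccube c (2 * rho) x -> {for x, continuous w}.
Hypothesis touch : forall x, ccube c rho x ->
  w x + eta * \sum_i (x 0 i - c 0 i) ^+ 2 <= w c + quadp p X (x - c).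

(** The mollification minus the quadratic polynomial, tilted by any small slope q, attains its
    maximum over the closed cube in the interior: on the faces the strictness eta rho^2 beats the
    tilt, which is at most n del rho. So every slope in a fixed cube is reached. *)
Lemma contact_point : exists2 s0 : R, 0 < s0 & forall s, 0 < s <= rho -> s <= s0 ->
  forall q : 'I_n -> R, (forall i, `|q i| <= del) ->
  exists x : 'rV[R]_n, [/\ (forall i, `|x 0 i - c 0 i| < rho),
    (forall i, dmoll [:: i] s x - (p i + \sum_j X i j * (x - c) 0 j) = q i) &
    forall z : 'rV[R]_n, 0 <= qform (fun i j => X i j - dmoll [:: i; j] s x) z].
Proof.
(* A third of the gap: the mollification error is paid once at the centre and once at the maximum,
   and a third remains. *)
pose kap := (eta * rho ^+ 2 - n%:R * del * rho) / 3.
have kap0 : 0 < kap.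
  by rewrite divr_gt0// subr_gt0 expr2 mulrA ltr_pM2r.
have [C C0 CP] := @moll_uniform R n c rho rho0.
have cK (r : R) : compact (ccube c r) by rewrite ccubeE; exact: compact_closed_box.
have [s0 s00 s0P] := compact_continuous_uniform (cK (2 * rho)) cw (divr_gt0 kap0 C0).
exists s0 => // s srho ss0 q qd; have s_gt0 : 0 < s by case/andP: srho.
have sub2 x : ccube c rho x -> ccube c (2 * rho) x.
  by move=> xr i; apply: (le_trans (xr i)); rewrite ler_peMl ?(ltW rho0)// ler1n.
have near_w x : ccube c rho x -> `|moll c rho w s x - w x| <= kap.
  move=> xr; have := CP w s x (kap / C) iw srho xr (ltW (divr_gt0 kap0 C0)).
  rewrite [C * _]mulrC divfK ?gt_eqF//; apply => y yx; apply: s0P; first exact: sub2.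
  rewrite [leLHS]/Num.norm/= mx_normrE; apply: (le_trans _ ss0).
  apply/bigmax_leP; split=> [|[k i] _/=]; first exact: ltW.
  by rewrite ord1 !mxE.
pose W x := moll c rho w s x - (quadp p X (x - c) + \sum_i q i * (x - c) 0 i).
pose G i x := dmoll [:: i] s x - (p i + \sum_j X i j * (x - c) 0 j) - q i.
pose H i j x := dmoll [:: i; j] s x - X j i.
have dW x i : is_derive x (e_ i) W (G i x).
  have d1 := is_derive_dmoll [::] s x i.
  have d2 := is_derive_quadp p c x i sX.
  have d3 := is_derive_quadp_grad (fun=> 0) (fun _ => q) c x i i.
  have -> : W = (dmoll [::] s) - ((fun x => quadp p X (x - c)) +
      (fun x => 0 + \sum_k q k * (x - c) 0 k)).
    by apply/funext => y; rewrite /W -dmoll0 -[RHS]/(_ - (_ + (0 + _))) add0r.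
  apply: (is_derive_eq (is_deriveB d1 (is_deriveD d2 d3))).
  by rewrite /G opprD addrA.
have dG x i j : is_derive x (e_ i) (G j) (H i j x).
  have d1 := is_derive_dmoll [:: j] s x i.
  have d2 := is_derive_quadp_grad p X c x i j.
  have -> : G j = (dmoll [:: j] s) - (fun x => p j + \sum_k X j k * (x - c) 0 k) - cst (q j).
    by apply/funext => y.
  apply: (is_derive_eq (is_deriveB (is_deriveB d1 d2) (is_derive_cst (q j) x (e_ i)))).
  by rewrite subr0.
have cG i : continuous (G i).
  move=> x; have FF : Filter (nbhs x) := nbhs_filter x.
  have c1 := @continuous_dmoll [:: i] s x; have c2 := @continuous_lform _ _ (X i) c x.
  exact: (cvgB (cvgB c1 (cvgD (cvg_cst (p i)) c2)) (cvg_cst (q i))).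
have cW : {within ccube c rho, continuous W}.
  apply: continuous_subspaceT => x; have FF : Filter (nbhs x) := nbhs_filter x.
  have c1 := @continuous_dmoll [::] s x; have c2 := @continuous_lform _ _ q c x.
  have c3 := @continuous_quadp _ _ p X c x.
  have -> : W = (fun x => dmoll [::] s x - (quadp p X (x - c) + \sum_i q i * (x - c) 0 i)).
    by apply/funext => y; rewrite dmoll0.
  exact: (cvgB c1 (cvgD c3 c2)).
have cc : ccube c rho c by move=> i; rewrite subrr normr0 ltW.
have [x xr xmax] := EVT_max_rV (ex_intro _ c cc) (cK rho) cW.
have xi i : `|x 0 i - c 0 i| < rho.
  rewrite lt_neqAle; apply/andP; split; last by move: xr; rewrite inE; apply.
  apply/negP => /eqP xE.
  have h1 : w c - kap <= W c.
    have := near_w c cc; rewrite /W subrr quadp0 ler_norml => /andP[+ _].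
    rewrite add0r big1 => [|k _]; last by rewrite mxE mulr0.
    by rewrite subr0; lra.
  have h2 : W c <= W x by apply: xmax; rewrite inE.
  have h3 : moll c rho w s x <= w x + kap.
    by have := near_w x; rewrite -in_setE => /(_ xr); rewrite ler_norml => /andP[_]; lra.
  have h4 := touch; have {h4} := h4 x; rewrite -in_setE => /(_ xr) h4.
  have h5 : rho ^+ 2 <= \sum_i (x 0 i - c 0 i) ^+ 2.
    rewrite (bigD1 i)//= -xE -normrX ger0_norm ?sqr_ge0// lerDl sumr_ge0// => k _.
    exact: sqr_ge0.
  have h6 : - (n%:R * del * rho) <= \sum_k q k * (x - c) 0 k.
    have : `|\sum_k q k * (x - c) 0 k| <= \sum_(k < n) del * rho.
      apply: (le_trans (ler_norm_sum _ _ _)); apply: ler_sum => k _.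
      rewrite normrM; apply: ler_pM => //; rewrite !mxE.
      by move: xr; rewrite inE; apply.
    rewrite sumr_const card_ord -[_ *+ n]mulr_natl mulrA ler_norml.
    by move=> /andP[].
  have h7 := ler_wpM2l (ltW eta0) h5; move: h2 h1; rewrite {2}/W; move: h7 kap0.
  move: h3 h4 h6; rewrite /kap; set T := \sum_k q k * _; set S := \sum_i _; set Q := quadp _ _ _.
  move: (eta * rho ^+ 2) (eta * S) (n%:R * del * rho) (moll _ _ _ _ _) (w x) (w c) (W c).
  by move=> *; lra.
have xnear : \forall y \near x, W y <= W x.
  have : nbhs x [set y : 'rV[R]_n | forall i, (c - const_mx rho) 0 i < y 0 i < (c + const_mx rho) 0 i].
    apply: open_nbhs_nbhs; split; first exact: open_open_box.
    by move=> i; have := xi i; rewrite ltr_norml !mxE => /andP[? ?]; apply/andP; split; lra.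
  apply: filterS => y yc; apply: xmax; rewrite inE => i; have := yc i; rewrite !mxE.
  by rewrite ler_norml => /andP[? ?]; apply/andP; split; lra.
have C2W : C2_near W G H x.
  split.
  - near=> y => i; exact: dW.
  - near=> y => i; exact: cG.
  - near=> y => i j; exact: dG.
  move=> i j; have FF : Filter (nbhs x) := nbhs_filter x.
  exact: (cvgB (@continuous_dmoll [:: i; j] s x) (cvg_cst (X j i))).
have [Gx Hx] := local_max_second_order C2W xnear.
exists x; split=> // [i|z].
  by apply/eqP; rewrite -subr_eq0; apply/eqP; exact: Gx.
rewrite -oppr_le0; apply: le_trans (Hx z); rewrite /qform -sumrN.
rewrite le_eqVlt; apply/orP; left; apply/eqP; apply: eq_bigr => i _.
by rewrite -sumrN; apply: eq_bigr => j _; rewrite /H sX; ring.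
Unshelve. all: by end_near.
Qed.

End contact_points.

(** Some point is at most average and also avoids a null set; the strict inequality E < E' leaves
    room for this. *)
Lemma exists_le_average d (T : measurableType d) (R : realType) (mu : {measure set T -> \bar R})
    (A : set T) (g : T -> R) (P : T -> Prop) (V E E' : R) :
  measurable A -> measurable_fun A g -> (forall y, 0 <= g y) ->
  mu A = V%:E -> 0 < V -> (\int[mu]_(y in A) (g y)%:E <= E%:E)%E -> 0 <= E -> E < E' ->
  {ae mu, forall y, A y -> P y} -> exists y, [/\ A y, P y & g y * V <= E'].
Proof.
move=> mA mg g0 AV V0 gE E0 EE' aeP; apply: contrapT => /forallNP H.
have E'0 : 0 <= E' / V by rewrite divr_ge0 ?(ltW V0)//; lra.
have : (\int[mu]_(y in A) (E' / V)%:E <= \int[mu]_(y in A) (g y)%:E)%E.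
  apply: (@ae_ge0_le_integral _ _ _ mu A mA).
  - by move=> y _; rewrite lee_fin.
  - exact: measurable_cst.
  - by move=> y _; rewrite lee_fin.
  - exact/measurable_EFinP.
  apply: filterS aeP => y Py Ay; rewrite lee_fin ler_pdivrMr// leNgt; apply/negP => /ltW h.
  by apply: (H y); split=> //; exact: Py.
rewrite integral_cst// AV -EFinM divfK ?gt_eqF// => /le_trans/(_ gE).
by rewrite lee_fin leNgt EE'.
Qed.

Lemma ae_imply d (T : measurableType d) (R : realType) (mu : {measure set T -> \bar R})
    (P Q : T -> Prop) : (forall y, P y -> Q y) ->
  {ae mu, forall y, P y} -> {ae mu, forall y, Q y}.
Proof. by move=> PQ; apply: filterS. Qed.

Lemma root_bound (R : realType) (q : nat) (x : R) : (0 < q)%N -> 0 < x ->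
  exists2 B : R, 0 < B & B ^+ q = x.
Proof.
move=> q0 x0; exists (x `^ q%:R^-1); first exact: powR_gt0.
by rewrite -powR_mulrn ?powR_ge0// -powRrM mulVf ?powRr1 ?(ltW x0)// pnatr_eq0 -lt0n.
Qed.

(** A, B, D1 and D2 come from a point where the equation holds, m1 and m2 from a contact point. At
    equal jets the touching polynomial would be a supersolution, so X - m2 >= 0 can only be as large
    as the jets differ. The surplus [eps] is 0 for the contact argument and positive for C^2
    solutions. *)
Lemma contact_trace (R : realType) (n : nat) (A X D2 m2 : 'I_n -> 'I_n -> R)
    (B D1 m1 : 'I_n -> R) (lam M t eps : R) :
  (forall i j, A i j = A j i) -> (forall z : 'rV[R]_n, lam * \sum_i z 0 i ^+ 2 <= qform A z) ->
  (forall i j, `|A i j| <= M) -> (forall i, `|B i| <= M) ->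
  (forall z : 'rV[R]_n, 0 <= qform (fun i j => X i j - m2 i j) z) ->
  \sum_i \sum_j A i j * X i j + \sum_i B i * m1 i + eps <=
    \sum_i \sum_j A i j * D2 i j + \sum_i B i * D1 i ->
  (forall i j, `|D2 i j - m2 i j| <= t) -> (forall i, `|D1 i - m1 i| <= t) ->
  lam * \sum_i (X i i - m2 i i) + eps <= M * t * (n%:R * n%:R + n%:R).
Proof.
move=> sA lA AM BM Xm H D2m D1m.
have := psd_dot_ge sA lA Xm.
have -> : \sum_i \sum_j A i j * (X i j - m2 i j) =
    \sum_i \sum_j A i j * X i j - \sum_i \sum_j A i j * m2 i j.
  rewrite -sumrB; apply: eq_bigr => i _; rewrite -sumrB; apply: eq_bigr => j _.
  by rewrite mulrBr.
have h2 : \sum_i \sum_j A i j * D2 i j - \sum_i \sum_j A i j * m2 i j <= M * t * (n%:R * n%:R).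
  rewrite -sumrB; apply: (@le_trans _ _ (\sum_(i < n) \sum_(j < n) M * t)).
    apply: ler_sum => i _; rewrite -sumrB; apply: ler_sum => j _.
    by rewrite -mulrBr (le_trans (ler_norm _))// normrM ler_pM.
  by rewrite !sumr_const card_ord -mulrnA -[_ *+ _]mulr_natr natrM.
have h1 : \sum_i B i * D1 i - \sum_i B i * m1 i <= M * t * n%:R.
  rewrite -sumrB; apply: (@le_trans _ _ (\sum_(i < n) M * t)).
    apply: ler_sum => i _.
    by rewrite -mulrBr (le_trans (ler_norm _))// normrM ler_pM.
  by rewrite sumr_const card_ord -[_ *+ _]mulr_natr.
move: (lam * _) => T; rewrite [M * t * (_ + _)]mulrDr; move: H h1 h2.
set a1 := \sum_i \sum_j _; set a2 := \sum_i \sum_j _; set a3 := \sum_i \sum_j _.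
set a4 := \sum_i _; set a5 := \sum_i _; lra.
Qed.

Lemma box_between (R : realType) (n : nat) (B : 'rV[R]_n * 'rV[R]_n) x y z :
  box B x -> box B y -> between x y z -> box B z.
Proof.
move=> Bx By xyz i; have /andP[z1 z2] := xyz i; have /andP[x1 x2] := Bx i.
have /andP[y1 y2] := By i; apply/andP; split.
  by apply: lt_le_trans z1; rewrite lt_min x1.
by apply: (le_trans z2); rewrite ge_max x2.
Qed.

Lemma cell0_dist (R : realType) (n N : nat) (c : 'rV[R]_n) rho (f : {ffun 'I_n -> 'I_N.+1})
    (x y : 'rV[R]_n) k : cell c rho 0 f x -> cell c rho 0 f y -> `|y 0 k - x 0 k| <= mesh rho N.
Proof.
move=> /(_ k) + /(_ k); rewrite /= !mxE => /andP[? ?] /andP[? ?].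
by rewrite ler_norml; apply/andP; split; lra.
Qed.

Lemma norm_chain (R : realType) (u v m X V T : R) : `|X - u| <= T -> `|u - m| <= V ->
  `|v - m| <= V -> `|v - X| <= 2 * V + T.
Proof.
rewrite !ler_norml => /andP[? ?] /andP[? ?] /andP[? ?].
by apply/andP; split; lra.
Qed.

Lemma norm_lt_double (R : realType) (V u v : R) : 0 < V -> `|u - v| <= V ->
  v - 2 * V < u < v + 2 * V.
Proof. by rewrite ler_norml => ? /andP[? ?]; apply/andP; split; lra. Qed.

(** One grid serves all derivatives at once, with a finite error [E f] for each cell. *)
Lemma approx_cells (R : realType) (n : nat) (c : 'rV[R]_n) (rho : R) (I : finType)
    (d : I -> 'rV[R]_n -> R) (q : nat) (e : R) : 0 < rho -> 0 < e ->
  (forall k, vanishing_osc c rho q (d k)) ->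
  (forall k, measurable_fun (cube c (2 * rho)) (d k : leb_rV R n -> R)) ->
  forall N0, exists2 N, (N0 <= N)%N &
  exists m : I -> {ffun 'I_n -> 'I_N.+2} -> R, exists E : {ffun 'I_n -> 'I_N.+2} -> R,
  [/\ \sum_f E f <= e, forall f, 0 <= E f &
    forall f, (\sum_k \int[@lebesgue_rV R n]_(x in cell c rho 1 f) (`|d k x - m k f| ^+ q)%:E
      <= (E f)%:E)%E].
Proof.
move=> rho0 e0 od md N0.
have d0 : 0 < e / (#|I|%:R + 1) by rewrite divr_gt0// ltr_wpDl.
have /choice[Nk NkP] : forall k, exists N1, forall N, (N1 <= N)%N ->
    exists m : {ffun 'I_n -> 'I_N.+1} -> R, (osc_sum c rho q (d k) m <= (e / (#|I|%:R + 1))%:E)%E.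
  by move=> k; exact: od.
pose N := maxn N0 (\max_k Nk k); exists N; first exact: leq_maxl.
have /choice[m mP] : forall k, exists m : {ffun 'I_n -> 'I_N.+2} -> R,
    (osc_sum c rho q (d k) m <= (e / (#|I|%:R + 1))%:E)%E.
  by move=> k; apply: NkP; rewrite /N leqW// leq_max (leq_bigmax k) orbT.
exists m.
pose Ee (f : {ffun 'I_n -> 'I_N.+2}) : \bar R :=
  (\sum_k \int[@lebesgue_rV R n]_(x in cell c rho 1 f) (`|d k x - m k f| ^+ q)%:E)%E.
have Ee0 f : (0 <= Ee f)%E.
  by apply: sume_ge0 => k _; apply: integral_ge0 => x _; rewrite lee_fin exprn_ge0.
have Esum : (\sum_f Ee f <= e%:E)%E.
  rewrite /Ee exchange_big/=.
  apply: (@le_trans _ _ (\sum_(k in I) (e / (#|I|%:R + 1))%:E)%E).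
    by apply: lee_sum => k _; exact: mP.
  rewrite sumEFin lee_fin sumr_const -[_ *+ _]mulr_natr mulrAC ler_pdivrMr ?ltr_wpDl//.
  by rewrite ler_pM2l// lerDl.
have Efin f : Ee f \is a fin_num.
  rewrite ge0_fin_numE//; apply: le_lt_trans (ltry e); apply: le_trans Esum.
  by rewrite (bigD1 f)//= leeDl// sume_ge0.
exists (fun f => fine (Ee f)); split=> [|f|f].
- rewrite -lee_fin -sumEFin; apply: le_trans Esum.
  by apply: lee_sum => f _; rewrite fineK.
- exact: fine_ge0.
by rewrite fineK.
Qed.

(** * Volume of the slopes of contact points *)

Section abp.
Context {R : realType} {n : nat}.
Local Notation mu := (@lebesgue_rV R n).
Local Notation e_ i := (delta_mx 0 i : 'rV[R]_n).
Local Notation J := ('I_n + 'I_n * 'I_n)%type.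

Definition jet_index (k : J) : seq 'I_n :=
  match k with inl i => [:: i] | inr ij => [:: ij.1; ij.2] end.

Variables (c : 'rV[R]_n) (rho : R).
Hypothesis n0 : (0 < n)%N.
Hypothesis rho0 : 0 < rho.
Local Notation D := (cube c (2 * rho)).
Variables (w : 'rV[R]_n -> R) (d : J -> 'rV[R]_n -> R).
Hypothesis iw : mu.-integrable D (EFin \o (w : leb_rV R n -> R)).
Hypothesis id : forall k, mu.-integrable D (EFin \o (d k : leb_rV R n -> R)).
Hypothesis od : forall k, vanishing_osc c rho n (d k).
Hypothesis wd : forall k s x, 0 < s <= rho -> ccube c rho x ->
  dmoll c rho w (jet_index k) s x = moll c rho (d k) s x.
Hypothesis cw : forall x, ccube c (2 * rho) x -> {for x, continuous w}.
Variables (p : 'I_n -> R) (X : 'I_n -> 'I_n -> R) (eta del lam M : R).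
Hypothesis sX : forall i j, X i j = X j i.
Hypothesis eta0 : 0 < eta.
Hypothesis del0 : 0 < del.
Hypothesis lam0 : 0 < lam.
Hypothesis M0 : 0 <= M.
Hypothesis del_eta : n%:R * del < eta * rho.
Hypothesis touch : forall x, ccube c rho x ->
  w x + eta * \sum_i (x 0 i - c 0 i) ^+ 2 <= w c + quadp p X (x - c).
Variables (a : 'I_n -> 'I_n -> 'rV[R]_n -> R) (b : 'I_n -> 'rV[R]_n -> R).

(** The contact point x and the point y where the equation is used are different points of a cell.
    Hence the inequality is asked with the coefficients at y and the gradient of the tilted
    polynomial at every x. *)
Definition good_point (y : 'rV[R]_n) : Prop :=
  [/\ (forall i j, a i j y = a j i y),
    (forall z : 'rV[R]_n, lam * \sum_i z 0 i ^+ 2 <= qform (fun i j => a i j y) z),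
    (forall i j, `|a i j y| <= M) /\ (forall i, `|b i y| <= M) &
    forall (x : 'rV[R]_n) (q : 'I_n -> R), ccube c rho x -> (forall i, `|q i| <= del) ->
      \sum_i \sum_j a i j y * X i j +
        \sum_i b i y * (p i + \sum_j X i j * (x - c) 0 j + q i) <=
      \sum_i \sum_j a i j y * d (inr (i, j)) y + \sum_i b i y * d (inl i) y].

Local Notation dm k := (dmoll c rho w (jet_index k)).

Definition contact (s : R) (q : 'I_n -> R) (x : 'rV[R]_n) : Prop :=
  [/\ (forall i, `|x 0 i - c 0 i| < rho),
    (forall i, dmoll c rho w [:: i] s x - (p i + \sum_j X i j * (x - c) 0 j) = q i) &
    forall z : 'rV[R]_n, 0 <= qform (fun i j => X i j - dmoll c rho w [:: i; j] s x) z].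

(* On a cell of the grid the Hessian of the mollification at a contact point is
   controlled by the oscillations of the weak derivatives, so that the slopes
   of the contact points in the cell fill a box of small volume. *)
Lemma contact_cell : exists2 C : R, 0 < C &
  forall N (f : {ffun 'I_n -> 'I_N.+2}) (m : J -> R) (E E' : R),
  (\sum_k \int[mu]_(x in cell c rho 1 f) (`|d k x - m k| ^+ n)%:E <= E%:E)%E ->
  0 <= E -> E < E' ->
  {ae mu, forall y, ccube c rho y -> good_point y} ->
  exists B : 'rV[R]_n * 'rV[R]_n, box_volume B <= C * E' /\
    forall (q x : 'rV[R]_n), (forall i, `|q 0 i| <= del) ->
      contact (mesh rho N.+1) (fun i => q 0 i) x -> cell c rho 0 f x ->
      forall i, B.1 0 i < q 0 i < B.2 0 i.
Proof.
have [C1 C10 C1P] := @moll_dist_power R n c rho rho0 n.-1.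
rewrite prednK// in C1P.
(* A constant whose n-th power exceeds C1, without taking a root. *)
pose C2 := Num.max 1 C1.
have C2n : C1 <= C2 ^+ n.
  have C21 : 1 <= C2 by rewrite le_max lexx.
  by apply: (@le_trans _ _ C2); [rewrite le_max lexx orbT|exact: ler_eXnr].
have C20 : 0 < C2 by rewrite lt_max ltr01.
(* The first term compares two mollified Hessians of the same cell through m, the second is the
   trace bound [tr] at a contact point. *)
pose C3 := 2 * C2 + M * (1 + C2) * (n%:R * n%:R + n%:R) / lam.
have C30 : 0 < C3.
  apply: ltr_wpDr; last by rewrite mulr_gt0.
  by rewrite divr_ge0 ?(ltW lam0)// !mulr_ge0// ?addr_ge0// ltW.
exists ((4 * n%:R * C3) ^+ n); first by rewrite exprn_gt0// !mulr_gt0// ltr0n.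
move=> N f m E E' dmE E0 EE' good.
have s0 := mesh_gt0 rho0 N.+1; set s := mesh rho N.+1 in s0 *.
have sr : 0 < s <= rho.
  rewrite s0/= /s /mesh ler_pdivrMr// mulrC ler_pM2l//.
  by have : 2 <= N.+2%:R :> R by rewrite ler_nat.
have sn0 : 0 < s ^+ n by rewrite exprn_gt0.
have E'0 : 0 < E' by lra.
(* B is the size of the oscillation on this cell, normalised so that (B s)^n = E'. *)
have [B B0 BE] := root_bound n0 (divr_gt0 E'0 sn0).
have cD := @cell_sub_cube R n c rho rho0 N f.
have mc1 := measurable_cell c rho 1 f; have mc0 := measurable_cell c rho 0 f.
have c01 : cell c rho 0 f `<=` cell c rho 1 f.
  by move=> x fx; apply: (cell0_near fx) => i; rewrite subrr normr0 mesh_gt0.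
have mdf k : measurable_fun (cell c rho 1 f) (fun x : leb_rV R n => `|d k x - m k| ^+ n).
  apply: measurable_absX; apply: measurable_funB; last exact: measurable_cst.
  by apply: (measurable_funS _ cD); [exact: measurable_cube|apply/measurable_EFinP; case/integrableP: (id k)].
have leE k : (\int[mu]_(x in cell c rho 1 f) (`|d k x - m k| ^+ n)%:E <= E%:E)%E.
  apply: le_trans dmE; rewrite (bigD1 k)//= leeDl// sume_ge0// => k' _.
  by apply: integral_ge0 => x _; rewrite lee_fin exprn_ge0.
have dmB k x : cell c rho 0 f x -> `|dm k s x - m k| <= C2 * B.
  move=> fx; rewrite wd//; last exact: cell0_ccube fx.
  rewrite -(@ler_pXn2r _ n)// ?nnegrE// ?mulr_ge0 ?(ltW B0) ?(ltW C20)//.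
  rewrite exprMn BE mulrA ler_pdivlMr// -lee_fin.
  apply: (le_trans (C1P (d k) s x (m k) (cell c rho 1 f) (id k) sr (cell0_ccube rho0 fx) mc1 cD
    (lebesgue_cell1_le c rho0 f) (fun y _ yx => cell0_near fx yx))).
  rewrite EFinM; apply: lee_pmul => //; first by rewrite lee_fin ltW.
    by apply: integral_ge0 => y _; rewrite lee_fin exprn_ge0.
  by apply: (le_trans (leE k)); rewrite lee_fin ltW.
(* One point of the cell where the equation holds and all weak derivatives are within B of their
   constants; it serves for every contact point of the cell. *)
have [y [fy gy yE]] : exists y, [/\ cell c rho 0 f y, good_point y &
    (\sum_k `|d k y - m k| ^+ n) * s ^+ n <= E'].
  have mdf0 k : measurable_fun (cell c rho 0 f) (fun x : leb_rV R n => `|d k x - m k| ^+ n).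
    exact: measurable_funS mc1 c01 (mdf k).
  apply: (@exists_le_average _ _ _ mu _ _ _ _ E _ mc0 _ _ (lebesgue_cell0 c rho0 f) sn0 _ E0 EE').
  - exact: measurable_sum.
  - by move=> y; apply: sumr_ge0 => k _; rewrite exprn_ge0.
  - apply: le_trans dmE; under eq_integral do rewrite -sumEFin.
    rewrite (@ge0_integral_sum _ _ _ mu _ mc0 _ (fun k y => (`|d k y - m k| ^+ n)%:E)); last 2 first.
      by move=> k; exact/measurable_EFinP.
      by move=> k y _; rewrite lee_fin exprn_ge0.
    apply: lee_sum => k _.
    have mdE : measurable_fun (cell c rho 1 f) (fun x : leb_rV R n => (`|d k x - m k| ^+ n)%:E).
      exact/measurable_EFinP.
    by apply: (@ge0_subset_integral _ _ _ mu _ _ mc0 mc1 _ mdE _ c01) => x _; rewrite lee_fin exprn_ge0.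
  by apply: (ae_imply _ good) => y gy fy; apply: gy; exact: cell0_ccube fy.
have dyB k : `|d k y - m k| <= B.
  rewrite -(@ler_pXn2r _ n)// ?nnegrE ?(ltW B0)// BE ler_pdivlMr//.
  apply: le_trans yE; rewrite ler_wpM2r ?(ltW sn0)// (bigD1 k)//= lerDl sumr_ge0//.
have tr (q : 'I_n -> R) x : (forall i, `|q i| <= del) -> contact s q x -> cell c rho 0 f x ->
    \sum_i (X i i - dmoll c rho w [:: i; i] s x) <= M * (1 + C2) * (n%:R * n%:R + n%:R) / lam * B.
  move=> qd [xr xq xX] fx; have [sa la [aM bM] gxq] := gy.
  have := gxq x q (cell0_ccube rho0 fx) qd.
  have -> : \sum_i b i y * (p i + \sum_j X i j * (x - c) 0 j + q i) =
      \sum_i b i y * dmoll c rho w [:: i] s x.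
    by apply: eq_bigr => i _; rewrite -xq addrCA subrr addr0.
  move=> H; rewrite mulrAC ler_pdivlMr// mulrC.
  have -> : M * (1 + C2) * (n%:R * n%:R + n%:R) * B = M * ((1 + C2) * B) * (n%:R * n%:R + n%:R).
    by ring.
  have dd k : `|d k y - dm k s x| <= (1 + C2) * B.
    have -> : d k y - dm k s x = (d k y - m k) - (dm k s x - m k) by ring.
    by apply: (le_trans (ler_normB _ _)); rewrite mulrDl mul1r lerD ?dyB ?dmB.
  rewrite -[leLHS]addr0; apply: (contact_trace (eps := 0) (A := fun i j => a i j y) (B := fun i => b i y)
    (D2 := fun i j => d (inr (i, j)) y) (D1 := fun i => d (inl i) y)
    (m2 := fun i j => dmoll c rho w [:: i; j] s x) (m1 := fun i => dmoll c rho w [:: i] s x)) => //; first by rewrite addr0.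
(* Without a contact point in the cell the box is empty, of volume 0 because n > 0. *)
have [[q0 [x0 [q0d x0q fx0]]]|none] := pselect (exists q0 : 'rV[R]_n, exists x0 : 'rV[R]_n, [/\ forall i, `|q0 0 i| <= del,
    contact s (fun i => q0 0 i) x0 & cell c rho 0 f x0]); last first.
  exists (0, 0); split; last by move=> q x qd qx fx; exfalso; apply: none; exists q, x.
  by rewrite /box_volume; under eq_bigr do rewrite subrr maxxx; rewrite prodr_const card_ord expr0n eqn0Ngt n0 mulr_ge0// ?exprn_ge0 ?(ltW E'0) ?mulr_ge0// ltW.
(* Twice the bound on the variation of the slope, so that the slopes lie strictly inside. *)
pose r := 2 * (n%:R * C3 * B * s).
have r0 : 0 < r by rewrite !mulr_gt0// ltr0n.
exists (q0 - const_mx r, q0 + const_mx r); split.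
  rewrite /box_volume (eq_bigr (fun=> 2 * r)); last first.
    by move=> i _; rewrite !mxE max_l; [ring|lra].
  rewrite prodr_const card_ord (_ : 2 * r = 4 * n%:R * C3 * (B * s)); last by rewrite /r; ring.
  by rewrite exprMn [(B * s) ^+ n]exprMn BE divfK// gt_eqF.
move=> q x qd xq fx i.
have [x0r x0G x0X] := x0q; have [xr xG _] := xq.
(* Only x0 need be a contact point: its Hessian is close to X, and the mollified Hessian varies
   little over the cell, which is convex. *)
have hess z k : between x0 x z -> `|dmoll c rho w [:: k; i] s z - X i k| <= C3 * B.
  move=> /(box_between fx0 fx) fz.
  pose Y i j := X i j - dmoll c rho w [:: i; j] s x0.
  have sY j l : Y j l = Y l j by rewrite /Y sX dmoll_sym.
  have := psd_entry_le k i sY x0X; rewrite /Y.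
  have := tr _ _ q0d x0q fx0; set T := \sum_j _ => Tle /le_trans/(_ Tle) h.
  have := dmB (inr (k, i)) _ fz; have := dmB (inr (k, i)) _ fx0; rewrite /=.
  move: h; rewrite sX /C3 mulrDl.
  move: (M * (1 + C2) * (n%:R * n%:R + n%:R) / lam * B) => T2.
  by rewrite -mulrA; exact: norm_chain.
have sx (k : 'I_n) : `|x 0 k - x0 0 k| <= s.
  exact: (cell0_dist k fx0 fx).
pose G (z : 'rV[R]_n) := dmoll c rho w [:: i] s z - (p i + \sum_j X i j * (z - c) 0 j).
have dG z k : is_derive z (e_ k) G (dmoll c rho w [:: k; i] s z - X i k).
  have d1 := is_derive_dmoll iw [:: i] s z k.
  have d2 := is_derive_quadp_grad p X c z k i.
  exact: is_deriveB d1 d2.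
have := @partials_lipschitz R n G (fun k z => dmoll c rho w [:: k; i] s z - X i k)
  (fun=> C3 * B) x0 x (fun z zb k => conj (dG z k) (hess z k zb)).
have -> : G x = q 0 i by exact: xG.
have -> : G x0 = q0 0 i by exact: x0G.
move=> /le_trans h.
have : `|q 0 i - q0 0 i| <= n%:R * C3 * B * s.
  apply: h; apply: (@le_trans _ _ (\sum_(k < n) C3 * B * s)).
    by apply: ler_sum => k _; rewrite ler_wpM2l// mulr_ge0// ltW.
  by rewrite sumr_const card_ord -[_ *+ _]mulr_natl !mulrA.
have : 0 < n%:R * C3 * B * s by move: r0; rewrite /r pmulr_rgt0.
rewrite /= !mxE /r; move: (n%:R * C3 * B * s) => V V0 h1.
exact: norm_lt_double.
Qed.

(** The boxes given by the cells cover the whole cube of slopes, of volume (2 del)^n, while their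
    total volume is as small as the total oscillation. *)
Lemma touch_contradiction : ~ {ae mu, forall y, ccube c rho y -> good_point y}.
Proof.
move=> good.
have [C C0 CP] := contact_cell.
have [s0 s00 cont] := contact_point rho0 iw sX del_eta eta0 cw touch.
(* The total volume is at most C (e + e), half of that of the cube of slopes; the second e is shared
   among the cells to make E < E'. *)
pose e := (2 * del) ^+ n / (4 * C).
have e0 : 0 < e by rewrite divr_gt0 ?exprn_gt0 ?mulr_gt0.
have md k : measurable_fun D (d k : leb_rV R n -> R).
  by apply/measurable_EFinP; case/integrableP: (id k).
have [N1 N1P] := mesh_small rho0 1 s00.
have [N leN [m [E [Esum E0 EP]]]] := approx_cells rho0 e0 od md N1.
set s := mesh rho N.+1.
have s_gt0 : 0 < s := mesh_gt0 rho0 N.+1.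
have ss0 : s <= s0 by have := N1P N.+1 (leqW leN); rewrite mulr1.
have sr : 0 < s <= rho.
  rewrite s_gt0/= /s /mesh ler_pdivrMr// mulrC ler_pM2l//.
  by have : 2 <= N.+2%:R :> R by rewrite ler_nat.
pose card : R := #|{ffun 'I_n -> 'I_N.+2}|%:R.
have card0 : 0 < card by rewrite ltr0n card_ffun !card_ord expn_gt0.
have kap0 : 0 < e / card by rewrite divr_gt0.
have /choice[B BP] : forall f : {ffun 'I_n -> 'I_N.+2}, exists B : 'rV[R]_n * 'rV[R]_n,
    box_volume B <= C * (E f + e / card) /\
    forall (q x : 'rV[R]_n), (forall i, `|q 0 i| <= del) ->
      contact s (fun i => q 0 i) x -> cell c rho 0 f x ->
      forall i, B.1 0 i < q 0 i < B.2 0 i.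
  by move=> f; apply: (CP N f (m ^~ f) (E f)) => //; rewrite ltrDl.
have vol : \prod_(i < n) ((const_mx del : 'rV[R]_n) 0 i - (const_mx (- del) : 'rV[R]_n) 0 i)
    <= \sum_(b <- [seq B f | f <- index_enum {ffun 'I_n -> 'I_N.+2}]) box_volume b.
  apply: finite_box_cover_volume => [i|q qd]; first by rewrite !mxE gtrN.
  have {}qd i : `|q 0 i| <= del by have := qd i; rewrite !mxE ler_norml.
  have [x xq] := cont s sr ss0 (fun i => q 0 i) qd.
  have [f fx] : exists f : {ffun 'I_n -> 'I_N.+2}, cell c rho 0 f x.
    apply: cell0_cover => // i; have [+ _ _] := xq => /(_ i).
    by rewrite /= !mxE ltr_norml => /andP[? ?]; apply/andP; split; lra.
  exists (B f); first by rewrite map_f// mem_index_enum.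
  exact: (BP f).2 q x qd xq fx.
have : (2 * del) ^+ n <= \sum_f (C * (E f + e / card)).
  apply: le_trans (le_trans vol _).
    rewrite (eq_bigr (fun=> 2 * del)) ?prodr_const ?card_ord// => i _.
    by rewrite !mxE; ring.
  by rewrite big_map; apply: ler_sum => f _; exact: (BP f).1.
rewrite -mulr_sumr big_split/= sumr_const -[(e / card) *+ _]mulr_natr divfK ?gt_eqF//.
have := ler_wpM2l (ltW C0) Esum; rewrite mulrDr.
have Ce : C * e = (2 * del) ^+ n / 4 by rewrite /e; field; rewrite gt_eqF.
have : 0 < (2 * del) ^+ n by rewrite exprn_gt0// mulr_gt0.
by rewrite Ce; move: (C * _) => T; lra.
Qed.

End abp.

(** * Touching from above *)

Section local_regularity.
Context {R : realType} {n : nat}.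
Local Notation mu := (@lebesgue_rV R n).
Implicit Types (c x : 'rV[R]_n) (u v : 'rV[R]_n -> R).

Lemma compact_ccube c (r : R) : compact (ccube c r).
Proof. by rewrite ccubeE; exact: compact_closed_box. Qed.

Lemma closed_ccube c (r : R) : closed (ccube c r).
Proof. by apply: compact_closed; [exact: norm_hausdorff|exact: compact_ccube]. Qed.

Lemma Lq_loc_cube (Omega : set 'rV[R]_n) (q : R) v c (r r' : R) :
  open Omega -> Lq_loc Omega q v -> ccube c r `<=` Omega -> 0 < r' < r ->
  measurable_fun (cube c r') (v : leb_rV R n -> R) /\
  (\int[mu]_(x in cube c r') (`|v x| `^ q)%:E < +oo)%E.
Proof.
move=> oO [mv iv] cO /andP[r'0 rr'].
pose U := [set x : 'rV[R]_n | forall i, (c - const_mx r) 0 i < x 0 i < (c + const_mx r) 0 i].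
have oU : open U by exact: open_open_box.
have Uc : U `<=` ccube c r.
  by rewrite ccubeE => x Ux i; have /andP[/ltW -> /ltW ->] := Ux i.
have cU : cube c r' `<=` U.
  move=> x Cx i; have := Cx i; rewrite /= !mxE => /andP[? ?]; apply/andP; split; lra.
have mU : measurable (U : set (leb_rV R n)) by exact: measurable_open_rV.
have clU : closure U `<=` Omega.
  apply: subset_trans cO; have /closure_id -> := @closed_ccube c r; exact: closureS.
have bU : bounded_set U.
  have := compact_bounded (@compact_ccube c r).
  by move=> [M [Mr MP]]; exists M; split=> // k /MP h x /Uc; exact: h.
have UO : U `<=` Omega by apply: subset_trans clU; exact: subset_closure.
have mvU : measurable_fun (U : set (leb_rV R n)) (v : leb_rV R n -> R).
  have mO : measurable (Omega : set (leb_rV R n)).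
    exact: measurable_open_rV.
  exact: measurable_funS mO UO mv.
have mC := measurable_cube c r'.
split; first exact: measurable_funS mU cU mvU.
apply: le_lt_trans (iv U bU oU clU).
apply: (@ge0_subset_integral _ _ _ mu _ _ mC mU _ _ _ cU).
  apply/measurable_EFinP.
  apply: (measurableT_comp (measurable_powR q)).
  exact: (measurableT_comp (@normr_measurable R setT)).
by move=> x _; rewrite lee_fin powR_ge0.
Qed.

Lemma kconv_comb D (f g : 'rV[R]_n -> R) (k l s : R) al x : measurable D ->
  mu.-integrable D (EFin \o (f : leb_rV R n -> R)) ->
  mu.-integrable D (EFin \o (g : leb_rV R n -> R)) ->
  kconv D (fun y => k * f y + l * g y) s al x = k * kconv D f s al x + l * kconv D g s al x.
Proof.
move=> mD intf intg; rewrite /kconv.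
have if1 := integrable_kern mD intf s al x; have ig1 := integrable_kern mD intg s al x.
have ik (m : R) (h : leb_rV R n -> R) : mu.-integrable D (EFin \o h) ->
    mu.-integrable D (EFin \o (fun y => m * h y)).
  by move=> ih; apply: (integrableZl mD m ih).
rewrite -!RintegralZl// -RintegralD//.
- by apply: eq_Rintegral => y _; ring.
- exact: ik if1.
- exact: ik ig1.
Qed.

Lemma integrable_comb D (f g : 'rV[R]_n -> R) (k l : R) : measurable D ->
  mu.-integrable D (EFin \o (f : leb_rV R n -> R)) ->
  mu.-integrable D (EFin \o (g : leb_rV R n -> R)) ->
  mu.-integrable D (EFin \o (fun y : leb_rV R n => k * f y + l * g y)).
Proof.
move=> mD intf intg.
rewrite (_ : _ \o _ = (fun y => k%:E * (EFin \o f) y) \+ (fun y => l%:E * (EFin \o g) y))%E//.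
by apply: integrableD => //; exact: integrableZl.
Qed.

Lemma dmoll_comb c rho (f g : 'rV[R]_n -> R) (k l s : R) sq x :
  mu.-integrable (cube c (2 * rho)) (EFin \o (f : leb_rV R n -> R)) ->
  mu.-integrable (cube c (2 * rho)) (EFin \o (g : leb_rV R n -> R)) ->
  dmoll c rho (fun y => k * f y + l * g y) sq s x =
    k * dmoll c rho f sq s x + l * dmoll c rho g sq s x.
Proof.
move=> intf intg; rewrite /dmoll kconv_comb//; last exact: measurable_cube.
ring.
Qed.

Lemma integrable_L1_loc (Omega : set 'rV[R]_n) v c (r r' : R) :
  open Omega -> Lq_loc Omega 1 v -> ccube c r `<=` Omega -> 0 < r' < r ->
  mu.-integrable (cube c r') (EFin \o (v : leb_rV R n -> R)).
Proof.
move=> oO vL cO rr'; have [mv iv] := Lq_loc_cube oO vL cO rr'.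
apply/integrableP; split; first exact/measurable_EFinP.
by move: iv; under eq_integral do rewrite powRr1//.
Qed.

Lemma dmoll_weak (Omega : set 'rV[R]_n) c (rho : R) sq u v s x :
  ccube c (2 * rho) `<=` Omega -> weak_partials Omega sq u v ->
  0 < s <= rho -> ccube c rho x ->
  dmoll c rho u sq s x = moll c rho v s x.
Proof.
move=> cO uv sr xr.
rewrite /dmoll (weak_partials_conv cO uv sr xr) /moll mulrCA.
by congr (_ * _); rewrite mulrA -expr2 sqrr_sign mul1r.
Qed.

(** Membership in W^{2,n} provides a weak derivative v in L^n, the equation may use another one, d,
    known only to be locally integrable; uniqueness identifies them. It is applied on the cube of
    size 2 rho, hence uses its double, which the room 5 rho contains. *)
Lemma weak_partials_vanishing_osc (Omega : set 'rV[R]_n) c (rho : R) sq u v d : (0 < n)%N ->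
  open Omega -> 0 < rho -> ccube c (5 * rho) `<=` Omega ->
  weak_partials Omega sq u v -> Lq_loc Omega n%:R v -> weak_partials Omega sq u d ->
  vanishing_osc c rho n d.
Proof.
move=> n0 oO rho0 cO uv vn ud.
have [_ v1 _] := uv; have [_ d1 _] := ud.
have r1 : 0 < 2 * (2 * rho) < 5 * rho by apply/andP; split; lra.
have r2 : 0 < 2 * rho < 5 * rho by apply/andP; split; lra.
have r20 : 0 < 2 * rho by lra.
have iv := integrable_L1_loc oO v1 cO r1; have id := integrable_L1_loc oO d1 cO r1.
have c4O : ccube c (2 * (2 * rho)) `<=` Omega.
  by apply: subset_trans cO => x xr i; apply: (le_trans (xr i)); lra.
have ig := integrable_comb 1 (-1) (measurable_cube c _) id iv.
have mC := measurable_cube c (2 * rho).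
have g0 s x : 0 < s <= 2 * rho -> ccube c (2 * rho) x ->
    moll c (2 * rho) (fun y => 1 * d y + -1 * v y) s x = 0.
  move=> sr xr; rewrite -dmoll0 dmoll_comb// !dmoll0.
  rewrite -(dmoll_weak c4O ud sr xr) -(dmoll_weak c4O uv sr xr); ring.
have := moll_eq0_integral r20 ig g0.
have [mv iv2] := Lq_loc_cube oO vn cO r2; have [md _] := Lq_loc_cube oO d1 cO r2.
have mg : measurable_fun (cube c (2 * rho)) (EFin \o (fun y : leb_rV R n => 1 * d y + -1 * v y)).
  by apply/measurable_EFinP; apply: measurable_funD; apply: measurable_funM.
move=> /(ae_eq_integral_abs mu mC mg) dv.
apply: vanishing_osc_Lq => //.
have mX (h : leb_rV R n -> R) : measurable_fun (cube c (2 * rho)) h ->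
    measurable_fun (cube c (2 * rho)) (fun x => (`|h x| ^+ n)%:E).
  by move=> mh; apply/measurable_EFinP; exact: measurable_absX.
rewrite (@ae_eq_integral _ _ _ mu _ (fun x => (`|v x| ^+ n)%:E) _ mC (mX _ md) (mX _ mv)).
  apply: le_lt_trans iv2; rewrite le_eqVlt; apply/orP; left; apply/eqP.
  by apply: eq_integral => x _; rewrite powR_mulrn.
apply: (ae_imply _ dv) => y /[apply] -[] yE.
by rewrite (_ : d y = v y)//; move: yE; rewrite mul1r mulN1r; lra.
Qed.

End local_regularity.

Section touching.
Context {R : realType} {n : nat}.
Local Notation mu := (@lebesgue_rV R n).
Implicit Types (p : 'I_n -> R) (X : 'I_n -> 'I_n -> R) (u v w f g h : 'rV[R]_n -> R).

(** A second-order jet instead of a polynomial above w: a C^2 barrier that touches w can then be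
    replaced by its Taylor expansion. *)
Definition touch_above w (x0 : 'rV[R]_n) p X : Prop :=
  forall eta : R, 0 < eta -> \forall x \near x0,
    w x <= w x0 + quadp p X (x - x0) + eta * \sum_i (x 0 i - x0 0 i) ^+ 2.

Variables (Omega : set 'rV[R]_n) (a : 'I_n -> 'I_n -> 'rV[R]_n -> R)
  (b : 'I_n -> 'rV[R]_n -> R) (c : 'rV[R]_n -> R).

(* [w] cannot be touched from above by a strict supersolution of [L w = g]. *)
Definition touch_subsolution w g : Prop :=
  forall (x0 : 'rV[R]_n) p X (e r : R), Omega x0 -> (forall i j, X i j = X j i) ->
  touch_above w x0 p X -> 0 < e -> 0 < r ->
  ~ {ae mu, forall y, ccube x0 r y -> Omega y ->
      \sum_i \sum_j a i j y * X i j + \sum_i b i y * p i + e <= g y + c y * w y}.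

Definition elliptic_bounded (lam M : R) : Prop := forall x, Omega x ->
  [/\ (forall i j, a i j x = a j i x),
    (forall z : 'rV[R]_n, lam * \sum_i z 0 i ^+ 2 <= qform (fun i j => a i j x) z),
    (forall i j, `|a i j x| <= M) & (forall i, `|b i x| <= M)].

Lemma qform_addD X (k : R) (z : 'rV[R]_n) :
  qform (fun i j => X i j + k * (i == j)%:R) z = qform X z + k * \sum_i z 0 i ^+ 2.
Proof.
rewrite /qform mulr_sumr -big_split/=; apply: eq_bigr => i _.
transitivity (\sum_j (X i j * z 0 i * z 0 j + k * ((i == j)%:R * z 0 i * z 0 j))).
  by apply: eq_bigr => j _; ring.
rewrite big_split/= -mulr_sumr; congr (_ + k * _).
rewrite (bigD1 i)//= big1 => [|j ji]; last by rewrite eq_sym (negbTE ji) !mul0r.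
by rewrite eqxx mul1r addr0.
Qed.

Lemma quadp_addD p X (k : R) (z : 'rV[R]_n) :
  quadp p (fun i j => X i j + k * (i == j)%:R) z = quadp p X z + k / 2 * \sum_i z 0 i ^+ 2.
Proof. by rewrite /quadp qform_addD; field. Qed.

Lemma ae_and2 d (T : measurableType d) (m : {measure set T -> \bar R}) (P Q S : T -> Prop) :
  (forall y, P y -> Q y -> S y) ->
  {ae m, forall y, P y} -> {ae m, forall y, Q y} -> {ae m, forall y, S y}.
Proof. by move=> PQS; apply: filterS2. Qed.

(** The cost of making the contact strict by 4 eta on the diagonal, of evaluating the gradient away
    from the centre and of tilting by q. *)
Lemma perturbed_operator_le (A X : 'I_n -> 'I_n -> R) (B p q : 'I_n -> R) (z : 'rV[R]_n)
    (M eta rho del S : R) :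
  (forall i j, `|A i j| <= M) -> (forall i, `|B i| <= M) -> 0 <= eta ->
  (forall i j, `|X i j + 4 * eta * (i == j)%:R| <= S) -> (forall i, `|z 0 i| <= rho) ->
  (forall i, `|q i| <= del) ->
  \sum_i \sum_j A i j * (X i j + 4 * eta * (i == j)%:R) +
  \sum_i B i * (p i + \sum_j (X i j + 4 * eta * (i == j)%:R) * z 0 j + q i) <=
  \sum_i \sum_j A i j * X i j + \sum_i B i * p i +
    (n%:R * M * (4 * eta) + n%:R * M * (n%:R * S * rho + del)).
Proof.
move=> AM BM eta0 XS zr qd.
have h1 : \sum_i \sum_j A i j * (X i j + 4 * eta * (i == j)%:R) <=
    \sum_i \sum_j A i j * X i j + n%:R * M * (4 * eta).
  have -> : \sum_i \sum_j A i j * (X i j + 4 * eta * (i == j)%:R) =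
      \sum_i \sum_j A i j * X i j + \sum_i A i i * (4 * eta).
    rewrite -big_split/=; apply: eq_bigr => i _.
    transitivity (\sum_j (A i j * X i j + (A i j * (i == j)%:R) * (4 * eta))).
      by apply: eq_bigr => j _; ring.
    rewrite big_split/=; congr (_ + _).
    rewrite (bigD1 i)//= big1 => [|j ji]; last by rewrite eq_sym (negbTE ji) mulr0 mul0r.
    by rewrite eqxx mulr1 addr0.
  rewrite lerD2l; apply: (@le_trans _ _ (\sum_(i < n) M * (4 * eta))).
    by apply: ler_sum => i _; rewrite ler_wpM2r ?mulr_ge0// (le_trans (ler_norm _)).
  by rewrite sumr_const card_ord -[_ *+ n]mulr_natl mulrA.
have h2 : \sum_i B i * (p i + \sum_j (X i j + 4 * eta * (i == j)%:R) * z 0 j + q i) <=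
    \sum_i B i * p i + n%:R * M * (n%:R * S * rho + del).
  apply: (@le_trans _ _ (\sum_(i < n) (B i * p i + M * (n%:R * S * rho + del)))); last first.
    by rewrite big_split/= sumr_const card_ord -[(M * _) *+ n]mulr_natl mulrA.
  apply: ler_sum => i _; rewrite -addrA mulrDr lerD2l.
  apply: (le_trans (ler_norm _)); rewrite normrM; apply: ler_pM => //.
  apply: (le_trans (ler_normD _ _)); apply: lerD => //.
  apply: (le_trans (ler_norm_sum _ _ _)).
  apply: (@le_trans _ _ (\sum_(j < n) S * rho)).
    by apply: ler_sum => j _; rewrite normrM ler_pM.
  by rewrite sumr_const card_ord -[_ *+ n]mulr_natl mulrA.
by apply: (le_trans (lerD h1 h2)); rewrite addrACA.
Qed.

Lemma norm_rV_le (x : 'rV[R]_n) (r : R) : 0 <= r -> (forall i, `|x 0 i| <= r) -> `|x| <= r.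
Proof.
move=> r0 xr; rewrite [leLHS]/Num.norm/= mx_normrE.
by apply/bigmax_leP; split=> [|[k i] _/=]; [exact: r0|rewrite ord1; exact: xr].
Qed.

Lemma near_ccube (x0 : 'rV[R]_n) (P : 'rV[R]_n -> Prop) : (\forall x \near x0, P x) ->
  exists2 r : R, 0 < r & forall x, ccube x0 r x -> P x.
Proof.
move=> /nbhs_ballP[r /= r0 rP]; exists (r / 2); first by rewrite divr_gt0.
move=> x xr; apply: rP; rewrite -ball_normE /= -normrN opprB.
have r20 : 0 < r / 2 by rewrite divr_gt0.
apply: (@le_lt_trans _ _ (r / 2)); last by rewrite ltr_pdivrMr// ltr_pMr// ltr1n.
by apply: norm_rV_le => [|i]; [exact: ltW|have := xr i; rewrite !mxE].
Qed.

Lemma sum_norm_ge (X : 'I_n -> 'I_n -> R) i j : `|X i j| <= \sum_i \sum_j `|X i j|.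
Proof.
rewrite (bigD1 i)//= (bigD1 j)//= -addrA lerDl addr_ge0// !sumr_ge0// => k _.
by rewrite sumr_ge0.
Qed.

Lemma nondiv_op_comb (du dv : seq 'I_n -> 'rV[R]_n -> R) (s t : R) u v (y : 'rV[R]_n) :
  \sum_i \sum_j a i j y * (s * du [:: i; j] y + t * dv [:: i; j] y) +
  \sum_i b i y * (s * du [:: i] y + t * dv [:: i] y) =
  s * nondiv_op a b c u du y + t * nondiv_op a b c v dv y + c y * (s * u y + t * v y).
Proof.
have -> : \sum_i \sum_j a i j y * (s * du [:: i; j] y + t * dv [:: i; j] y) =
    s * (\sum_i \sum_j a i j y * du [:: i; j] y) + t * (\sum_i \sum_j a i j y * dv [:: i; j] y).
  rewrite !mulr_sumr -big_split/=; apply: eq_bigr => i _.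
  by rewrite !mulr_sumr -big_split/=; apply: eq_bigr => j _; ring.
have -> : \sum_i b i y * (s * du [:: i] y + t * dv [:: i] y) =
    s * (\sum_i b i y * du [:: i] y) + t * (\sum_i b i y * dv [:: i] y).
  by rewrite !mulr_sumr -big_split/=; apply: eq_bigr => i _; ring.
rewrite /nondiv_op; ring.
Qed.

(** A strict supersolution remains a supersolution after a small addition to its Hessian. That
    addition makes the contact quadratic, which is what [touch_contradiction] excludes. *)
Lemma W2n_touch (lam M s t : R) u v f h : (0 < n)%N -> open Omega -> 0 < lam ->
  elliptic_bounded lam M -> W2n_solution a b c Omega u f -> W2n_solution a b c Omega v h ->
  touch_subsolution (fun x => s * u x + t * v x) (fun x => s * f x + t * h x).
Proof.
move=> n0 oO lam0 ell [cu [uL uW] [du duW duE]] [cv [vL vW] [dv dvW dvE]].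
move=> x0 p X e r Ox0 sX tau e0 r0 good.
have M0 : 0 <= M.
  have [_ _ _ bM] := ell x0 Ox0; exact: le_trans (bM (Ordinal n0)).
pose m : R := n%:R * M.
have m0 : 0 <= m by rewrite mulr_ge0.
(* The perturbations cost m (4 k) for the Hessian and m (k + k) for gradient and tilt, together less
   than 8 m k. *)
have [k k0 mk] : exists2 k : R, 0 < k & 8 * (m * k) <= e.
  exists (e / (8 * (m + 1))); first by rewrite divr_gt0// mulr_gt0// ltr_wpDl.
  have -> : 8 * (m * (e / (8 * (m + 1)))) = e * (m / (m + 1)).
    by field; rewrite gt_eqF// ltr_wpDl.
  by rewrite ler_piMr ?(ltW e0)// ler_pdivrMr ?ltr_wpDl// mul1r lerDl.
pose S := \sum_i \sum_j `|X i j| + 4 * k.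
have S0 : 0 <= S.
  apply: addr_ge0; last by rewrite mulr_ge0// ltW.
  by apply: sumr_ge0 => i _; exact: sumr_ge0.
have XS i j : `|X i j + 4 * k * (i == j)%:R| <= S.
  apply: (le_trans (ler_normD _ _)); apply: lerD; first exact: sum_norm_ge.
  rewrite ger0_norm ?mulr_ge0// ?(ltW k0)//.
  by rewrite ler_piMr ?mulr_ge0 ?(ltW k0)//; case: (i == j).
have [r1 r10 r1P] := near_ccube (tau k k0).
have [r2 r20 r2P] := near_ccube (open_nbhs_nbhs (conj oO Ox0)).
pose nS := n%:R * S + 1.
have nS0 : 0 < nS by rewrite ltr_wpDl ?mulr_ge0.
(* In order: the touching inequality holds, the cubes lie in Omega, the supersolution is strict, and
   the gradient of the polynomial varies by at most k. *)
have [rho rho0 [rr1 rr2 rr rk]] : exists2 rho : R, 0 < rho & [/\ rho <= r1, 5 * rho <= r2,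
    rho <= r & nS * rho <= k].
  pose rho := Num.min (Num.min r1 (r2 / 5)) (Num.min r (k / nS)).
  exists rho; first by rewrite !lt_min r10 r0 !divr_gt0.
  have := lexx rho; rewrite {2}/rho !le_min => /andP[/andP[? h1] /andP[? h2]].
  by split=> //; [move: h1; rewrite ler_pdivlMr// mulrC|move: h2; rewrite ler_pdivlMr// mulrC].
pose del := Num.min k (k * rho / (n%:R + 1)).
have del0 : 0 < del by rewrite lt_min k0 divr_gt0 ?mulr_gt0// ltr_wpDl.
have delk : del <= k by rewrite ge_min lexx.
have deln : n%:R * del < k * rho.
  have : del <= k * rho / (n%:R + 1) by rewrite ge_min lexx orbT.
  rewrite ler_pdivlMr ?ltr_wpDl// mulrDr mulr1 mulrC; lra.
have c5O : ccube x0 (5 * rho) `<=` Omega.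
  by move=> y yr; apply: r2P => i; exact: le_trans (yr i) rr2.
have c2O : ccube x0 (2 * rho) `<=` Omega.
  by move=> y yr; apply: c5O => i; rewrite (le_trans (yr i))// ler_pM2r// ler_nat.
have rho5 : 0 < 2 * rho < 5 * rho by rewrite mulr_gt0//= ltr_pM2r// ltr_nat.
have js (l : 'I_n + 'I_n * 'I_n) : (1 <= size (jet_index l) <= 2)%N by case: l.
have iu : mu.-integrable (cube x0 (2 * rho)) (EFin \o (u : leb_rV R n -> R)).
  have [u1 _ _] := duW _ (js (inl (Ordinal n0))); exact: integrable_L1_loc oO u1 c5O rho5.
have iv : mu.-integrable (cube x0 (2 * rho)) (EFin \o (v : leb_rV R n -> R)).
  have [u1 _ _] := dvW _ (js (inl (Ordinal n0))); exact: integrable_L1_loc oO u1 c5O rho5.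
have idu l : mu.-integrable (cube x0 (2 * rho)) (EFin \o (du (jet_index l) : leb_rV R n -> R)).
  have [_ u1 _] := duW _ (js l); exact: integrable_L1_loc oO u1 c5O rho5.
have idv l : mu.-integrable (cube x0 (2 * rho)) (EFin \o (dv (jet_index l) : leb_rV R n -> R)).
  have [_ u1 _] := dvW _ (js l); exact: integrable_L1_loc oO u1 c5O rho5.
have mC := measurable_cube x0 (2 * rho).
pose d l x := s * du (jet_index l) x + t * dv (jet_index l) x.
have id l : mu.-integrable (cube x0 (2 * rho)) (EFin \o (d l : leb_rV R n -> R)).
  exact: integrable_comb mC (idu l) (idv l).
have od l : vanishing_osc x0 rho n (d l).
  have [v1 uv1 v1n] := uW _ (js l); have [v2 uv2 v2n] := vW _ (js l).
  have ou := weak_partials_vanishing_osc n0 oO rho0 c5O uv1 v1n (duW _ (js l)).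
  have ov := weak_partials_vanishing_osc n0 oO rho0 c5O uv2 v2n (dvW _ (js l)).
  apply: vanishing_osc_comb ou ov; first exact: rho0.
    by apply/measurable_EFinP; case/integrableP: (idu l).
  by apply/measurable_EFinP; case/integrableP: (idv l).
have wd l s' x : 0 < s' <= rho -> ccube x0 rho x ->
    dmoll x0 rho (fun x => s * u x + t * v x) (jet_index l) s' x = moll x0 rho (d l) s' x.
  move=> sr xr; rewrite dmoll_comb// -dmoll0 dmoll_comb// !dmoll0.
  by rewrite -(dmoll_weak c2O (duW _ (js l)) sr xr) -(dmoll_weak c2O (dvW _ (js l)) sr xr).
have cw x : ccube x0 (2 * rho) x -> {for x, continuous (fun x => s * u x + t * v x)}.
  move=> /c2O Ox; have FF : Filter (nbhs x) := nbhs_filter x.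
  exact: (cvgD (@cvgMl_tmp R _ (nbhs x) FF u s _ (cu x Ox)) (@cvgMl_tmp R _ (nbhs x) FF v t _ (cv x Ox))).
(* This adds 2 k |x - x0|^2 to the polynomial: one half absorbs the error allowed by [touch_above],
   the other is the strictness of the contact. *)
pose X' i j := X i j + 4 * k * (i == j)%:R.
have sX' i j : X' i j = X' j i by rewrite /X' sX eq_sym.
have touch x : ccube x0 rho x -> s * u x + t * v x + k * \sum_i (x 0 i - x0 0 i) ^+ 2 <=
    s * u x0 + t * v x0 + quadp p X' (x - x0).
  move=> xr; have := r1P x (fun i => le_trans (xr i) rr1).
  rewrite quadp_addD (_ : \sum_i (x - x0) 0 i ^+ 2 = \sum_i (x 0 i - x0 0 i) ^+ 2); last first.
    by apply: eq_bigr => i _; rewrite !mxE.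
  by move: (\sum_i _) (quadp _ _ _) => T Q; rewrite (_ : 4 * k / 2 * T = 2 * (k * T)); [lra|field].
apply: (@touch_contradiction R n x0 rho n0 rho0 _ d (integrable_comb s t mC iu iv) id od wd cw p X' k del lam M sX' k0 del0 lam0 M0 deln touch a b).
have duvE : {ae mu, forall y, Omega y -> nondiv_op a b c u du y = f y /\ nondiv_op a b c v dv y = h y}.
  by apply: (ae_and2 _ duE dvE) => y uy vy Oy; split; [exact: uy|exact: vy].
apply: (ae_and2 _ duvE good) => y duvy gy yr.
have Oy : Omega y.
  by apply: c2O => i; rewrite (le_trans (yr i))// ler_peMl ?(ltW rho0)// ler1n.
have [uy vy] := duvy Oy; have [sa la aM bM] := ell y Oy.
have {}gy := gy (fun i => le_trans (yr i) rr) Oy.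
split=> // x q xr qd.
have zr i : `|(x - x0) 0 i| <= rho by have := xr i; rewrite !mxE.
apply: (le_trans (@perturbed_operator_le (fun i j => a i j y) X (fun i => b i y) p q (x - x0)
  M k rho del S aM bM (ltW k0) XS zr qd)).
have -> : \sum_i \sum_j a i j y * d (inr (i, j)) y + \sum_i b i y * d (inl i) y =
    s * f y + t * h y + c y * (s * u y + t * v y).
  by rewrite -uy -vy; exact: nondiv_op_comb.
apply: le_trans gy; rewrite lerD2l -/m.
have : m * (n%:R * S * rho + del) <= m * (k + k).
  rewrite ler_wpM2l// lerD//; apply: le_trans rk.
  by rewrite ler_wpM2r ?(ltW rho0)// lerDl.
move: (m * (n%:R * S * rho + del)) => T mT.
apply: (@le_trans _ _ (m * (4 * k) + m * (k + k))); first by rewrite lerD2l.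
rewrite (_ : _ + _ = 6 * (m * k)); last by ring.
by apply: le_trans mk; rewrite ler_wpM2r ?ler_nat// mulr_ge0// ltW.
Qed.

End touching.

Lemma shrink_lt (R : realFieldType) (M Q E : R) : 0 <= M -> 0 <= Q -> 0 < E ->
  M * (E / (2 * (M + 1) * (Q + 1))) * Q < E.
Proof.
move=> M0 Q0 E0.
have -> : M * (E / (2 * (M + 1) * (Q + 1))) * Q = E * (2^-1 * (M / (M + 1)) * (Q / (Q + 1))).
  by field; rewrite !gt_eqF// ltr_wpDl.
rewrite gtr_pMr//.
have h1 : 0 <= M / (M + 1) <= 1 by rewrite divr_ge0/= ?ler_pdivrMr ?mul1r; lra.
have h2 : 0 <= Q / (Q + 1) <= 1 by rewrite divr_ge0/= ?ler_pdivrMr ?mul1r; lra.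
by move: (M / _) (Q / _) h1 h2 => A B /andP[? ?] /andP[? ?]; nra.
Qed.

(** * Touching for C^2 solutions *)

Section classical_touching.
Context {R : realType} {n : nat}.
Local Notation mu := (@lebesgue_rV R n).
Local Notation e_ i := (delta_mx 0 i : 'rV[R]_n).
Implicit Types (u v w f g h : 'rV[R]_n -> R).
Variables (Omega : set 'rV[R]_n) (a : 'I_n -> 'I_n -> 'rV[R]_n -> R)
  (b : 'I_n -> 'rV[R]_n -> R) (c : 'rV[R]_n -> R).

Lemma ae_exists_ccube (P : 'rV[R]_n -> Prop) (x0 : 'rV[R]_n) (r : R) : 0 < r ->
  {ae mu, forall y, P y} -> exists2 y, ccube x0 r y & P y.
Proof.
move=> r0 aeP; have mC := measurable_cube x0 r.
have V0 : 0 < (2 * r) ^+ n by rewrite exprn_gt0// mulr_gt0.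
have CV : mu (cube x0 r) = ((2 * r) ^+ n)%:E.
  rewrite /cube lebesgue_box => [|i]; last by rewrite !mxE; lra.
  rewrite -[in RHS](card_ord n) -prodr_const; congr EFin; apply: eq_bigr => i _.
  by rewrite !mxE; ring.
have [y [Cy Py _]] : exists y, [/\ cube x0 r y, P y & 0 * (2 * r) ^+ n <= (1 : R)].
  apply: (@exists_le_average _ _ _ mu _ (fun=> 0) P _ 0 1 mC _ _ CV V0) => //.
    by rewrite integral0.
  by apply: (ae_imply _ aeP) => y Py _.
by exists y => //; exact: cube_sub_ccube.
Qed.

Lemma Ck_on_is_derive (k : nat) u x sq i : Ck_on k Omega u -> Omega x -> (size sq < k)%N ->
  is_derive x (e_ i) (partials sq u) (partials (i :: sq) u x).
Proof. by move=> /(_ x) + Ox szk => /(_ Ox sq)[_ /(_ szk i) d]; split. Qed.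

(** The second-order test holds at x0, the equation perhaps only elsewhere. A null set contains no
    cube, so the equation holds at some y where the derivatives are within [del] of those at x0, and
    the strictness absorbs the difference. *)
Lemma C2_touch (lam M s t : R) u v f h : (0 < n)%N -> open Omega -> 0 < lam ->
  elliptic_bounded Omega a b lam M ->
  C2_solution a b c Omega u f -> C2_solution a b c Omega v h ->
  touch_subsolution Omega a b c (fun x => s * u x + t * v x) (fun x => s * f x + t * h x).
Proof.
move=> n0 oO lam0 ell [Cu duE] [Cv dvE] x0 p X e r Ox0 sX tau e0 r0 good.
have M0 : 0 <= M.
  have [_ _ _ bM] := ell x0 Ox0; exact: le_trans (bM (Ordinal n0)).
pose m : R := n%:R * M.
have m0 : 0 <= m by rewrite mulr_ge0.
have [k k0 mk] : exists2 k : R, 0 < k & 2 * (m * k) < e.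
  exists (e / (2 * (m + 1))); first by rewrite divr_gt0// mulr_gt0// ltr_wpDl.
  have -> : 2 * (m * (e / (2 * (m + 1)))) = e * (m / (m + 1)).
    by field; rewrite gt_eqF// ltr_wpDl.
  by rewrite gtr_pMr// ltr_pdivrMr ?ltr_wpDl// mul1r ltrDl.
pose w x := s * u x + t * v x.
pose dw sq x := s * partials sq u x + t * partials sq v x.
pose X' i j := X i j + 2 * k * (i == j)%:R.
have sX' i j : X' i j = X' j i by rewrite /X' sX eq_sym.
pose F x := w x - quadp p X' (x - x0).
pose G i x := dw [:: i] x - (p i + \sum_j X' i j * (x - x0) 0 j).
pose H i j x := dw [:: i; j] x - X' j i.
have ddw sq x i : Omega x -> (size sq < 2)%N -> is_derive x (e_ i) (dw sq) (dw (i :: sq) x).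
  move=> Ox sz; have d1 := Ck_on_is_derive i Cu Ox sz; have d2 := Ck_on_is_derive i Cv Ox sz.
  exact: is_deriveD (is_deriveZ s d1) (is_deriveZ t d2).
have cdw sq x : Omega x -> (size sq <= 2)%N -> {for x, continuous (dw sq)}.
  move=> Ox sz; have FF : Filter (nbhs x) := nbhs_filter x.
  have c1 := (Cu x Ox sq).1 sz; have c2 := (Cv x Ox sq).1 sz.
  exact: (cvgD (@cvgMl_tmp R _ (nbhs x) FF _ s _ c1) (@cvgMl_tmp R _ (nbhs x) FF _ t _ c2)).
have Onear : \forall x \near x0, Omega x by exact: open_nbhs_nbhs (conj oO Ox0).
have C2F : C2_near F G H x0.
  split.
  - apply: filterS Onear => x Ox i.
    have d1 := ddw [::] x i Ox isT; have d2 := is_derive_quadp p x0 x i sX'.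
    exact: is_deriveB d1 d2.
  - apply: filterS Onear => x Ox i; have FF : Filter (nbhs x) := nbhs_filter x.
    have c2 := @continuous_lform _ _ (X' i) x0 x.
    exact: (cvgB (cdw [:: i] x Ox isT) (cvgD (cvg_cst (p i)) c2)).
  - apply: filterS Onear => x Ox i j.
    exact: is_deriveB (ddw [:: j] x i Ox isT) (is_derive_quadp_grad p X' x0 x i j).
  move=> i j; have FF : Filter (nbhs x0) := nbhs_filter x0.
  exact: (cvgB (cdw [:: i; j] x0 Ox0 isT) (cvg_cst (X' j i))).
have Fmax : \forall x \near x0, F x <= F x0.
  apply: filterS (tau k k0) => x.
  rewrite /F subrr quadp0 quadp_addD (_ : \sum_i (x - x0) 0 i ^+ 2 = \sum_i (x 0 i - x0 0 i) ^+ 2); last first.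
    by apply: eq_bigr => i _; rewrite !mxE.
  rewrite -/(w x) -/(w x0) (_ : 2 * k / 2 = k); last by field.
  by move=> wx; rewrite lerBlDr subr0 addrA.
have [G0 H0] := local_max_second_order C2F Fmax.
have dp i : dw [:: i] x0 = p i.
  have := G0 i; rewrite /G subrr big1 => [|j _]; last by rewrite mxE mulr0.
  by rewrite addr0 => /eqP; rewrite subr_eq0 => /eqP.
(* What is left of e after the perturbation of the Hessian, divided so that the error of
   [contact_trace] stays strictly below it ([shrink_lt]). *)
pose del := (e - 2 * (m * k)) / (2 * (M + 1) * (n%:R * n%:R + n%:R + 1)).
have N0 : 0 < n%:R * n%:R + n%:R + 1 :> R by rewrite ltr_wpDl// addr_ge0// mulr_ge0.
have del0 : 0 < del.
  by rewrite divr_gt0// ?subr_gt0// !mulr_gt0// ltr_wpDl.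
have close (sq : seq 'I_n) : (size sq <= 2)%N -> \forall y \near x0, `|dw sq x0 - dw sq y| <= del.
  move=> sz; have /cvgrPdist_le := cdw sq x0 Ox0 sz; exact.
have [r1 r10 r1P] := near_ccube Onear.
have [r2 r20 r2P] : exists2 r2 : R, 0 < r2 & forall y, ccube x0 r2 y -> forall k : 'I_n + 'I_n * 'I_n,
    `|dw (jet_index k) x0 - dw (jet_index k) y| <= del.
  apply: near_ccube.
  apply: (@filter_forall _ _ (fun k y => `|dw (jet_index k) x0 - dw (jet_index k) y| <= del) (nbhs x0)) => l.
  by apply: close; case: l.
pose rr := Num.min r (Num.min r1 r2).
have rr0 : 0 < rr by rewrite !lt_min r0 r10 r20.
have : rr <= rr by []; rewrite {2}/rr !le_min => /andP[rle /andP[r1le r2le]].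
have duvE : {ae mu, forall y, Omega y -> nondiv_op a b c u (fun sq => partials sq u) y = f y /\
    nondiv_op a b c v (fun sq => partials sq v) y = h y}.
  by apply: (ae_and2 _ duE dvE) => y uy vy Oy; split; [exact: uy|exact: vy].
have [y yr [Pd Pg]] := ae_exists_ccube x0 rr0 (ae_and2 (fun y P1 P2 => conj P1 P2) duvE good).
have Oy : Omega y by apply: r1P => i; exact: le_trans (yr i) r1le.
have [uy vy] := Pd Oy; have [sa la aM bM] := ell y Oy.
have {}Pg := Pg (fun i => le_trans (yr i) rle) Oy.
have dy l := r2P y (fun i => le_trans (yr i) r2le) l.
have XE : \sum_i \sum_j a i j y * X' i j <= \sum_i \sum_j a i j y * X i j + 2 * (m * k).
  rewrite /X'; have -> : \sum_i \sum_j a i j y * (X i j + 2 * k * (i == j)%:R) =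
      \sum_i \sum_j a i j y * X i j + \sum_i a i i y * (2 * k).
    rewrite -big_split/=; apply: eq_bigr => i _.
    transitivity (\sum_j (a i j y * X i j + (a i j y * (i == j)%:R) * (2 * k))).
      by apply: eq_bigr => j _; ring.
    rewrite big_split/=; congr (_ + _).
    rewrite (bigD1 i)//= big1 => [|j ji]; last by rewrite eq_sym (negbTE ji) mulr0 mul0r.
    by rewrite eqxx mulr1 addr0.
  rewrite lerD2l; apply: (@le_trans _ _ (\sum_(i < n) M * (2 * k))).
    by apply: ler_sum => i _; rewrite ler_wpM2r ?mulr_ge0 ?(ltW k0)// (le_trans (ler_norm _)).
  rewrite sumr_const card_ord -[_ *+ n]mulr_natl /m le_eqVlt; apply/orP; left; apply/eqP; ring.
have gE : s * f y + t * h y + c y * (s * u y + t * v y) =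
    \sum_i \sum_j a i j y * dw [:: i; j] y + \sum_i b i y * dw [:: i] y.
  rewrite -uy -vy; symmetry.
  exact: (nondiv_op_comb a b c (fun sq => partials sq u) (fun sq => partials sq v)).
pose eps := e - 2 * (m * k).
have psd (z : 'rV[R]_n) : 0 <= qform (fun i j => X' i j - dw [:: i; j] x0) z.
  rewrite -oppr_le0; apply: le_trans (H0 z); rewrite /qform -sumrN.
  rewrite le_eqVlt; apply/orP; left; apply/eqP; apply: eq_bigr => i _.
  by rewrite -sumrN; apply: eq_bigr => j _; rewrite /H sX'; ring.
have HE : \sum_i \sum_j a i j y * X' i j + \sum_i b i y * dw [:: i] x0 + eps <=
    \sum_i \sum_j a i j y * dw [:: i; j] y + \sum_i b i y * dw [:: i] y.
  rewrite -gE (_ : \sum_i b i y * dw [:: i] x0 = \sum_i b i y * p i); last first.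
    by apply: eq_bigr => i _; rewrite dp.
  by move: Pg XE; rewrite /eps; lra.
have d2 i j : `|dw [:: i; j] y - dw [:: i; j] x0| <= del by rewrite distrC; exact: dy (inr (i, j)).
have d1 i : `|dw [:: i] y - dw [:: i] x0| <= del by rewrite distrC; exact: dy (inl i).
have := @contact_trace R n (fun i j => a i j y) X' (fun i j => dw [:: i; j] y)
  (fun i j => dw [:: i; j] x0) (fun i => b i y) (fun i => dw [:: i] y) (fun i => dw [:: i] x0) lam M
  del eps sa la aM bM psd HE d2 d1.
apply/negP; rewrite -ltNge.
apply: (@lt_le_trans _ _ eps); last first.
  rewrite lerDr mulr_ge0 ?(ltW lam0)// sumr_ge0// => i _.
  by have := psd (e_ i); rewrite qform_delta.
have eps0 : 0 < eps by rewrite subr_gt0.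
have Qge : 0 <= n%:R * n%:R + n%:R :> R by rewrite addr_ge0// mulr_ge0.
exact: shrink_lt.
Qed.

End classical_touching.

(** * Radial barriers *)

Section taylor.
Context {R : realType}.

Lemma taylor2 (phi phi' : R -> R) (t0 phi2 : R) :
  (\forall t \near t0, is_derive (t : R) (1 : R) phi (phi' t)) ->
  is_derive (t0 : R) (1 : R) phi' phi2 ->
  forall eta : R, 0 < eta -> \forall t \near t0,
    `|phi t - phi t0 - phi' t0 * (t - t0) - phi2 / 2 * (t - t0) ^+ 2| <= eta * (t - t0) ^+ 2.
Proof.
move=> dphi dphi' eta eta0.
have dQ : (fun h : R => h^-1 *: ((phi' \o shift t0) (h *: 1) - phi' t0)) @ 0^' --> phi2.
  by case: dphi' => dd <-; exact: dd.
have /cvgrPdist_le /(_ _ eta0) [d /= d0 dP] := dQ.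
have [d1 /= d10 d1P] := dphi.
have mm : 0 < Num.min d d1 by rewrite lt_min d0.
have slope (t : R) : `|t - t0| < Num.min d d1 ->
    `|phi' t - phi' t0 - phi2 * (t - t0)| <= eta * `|t - t0|.
  rewrite lt_min => /andP[td _]; have [->|tt0] := eqVneq t t0.
    by rewrite !subrr mulr0 subr0 !normr0 mulr0.
  have h0 : t - t0 != 0 by rewrite subr_eq0.
  have := dP (t - t0); rewrite /= sub0r normrN => /(_ td h0).
  rewrite [_ *: 1]mulr1 subrK => H.
  have -> : phi' t - phi' t0 - phi2 * (t - t0) =
      - ((phi2 - (t - t0)^-1 *: (phi' t - phi' t0)) * (t - t0)).
    by rewrite /GRing.scale/=; field.
  by rewrite normrN normrM ler_wpM2r.
near=> t.
have tt : `|t - t0| < Num.min d d1.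
  by near: t; exists (Num.min d d1) => //= t; rewrite distrC.
pose G (s : R) := phi s - phi' t0 * (s - t0) - phi2 / 2 * (s - t0) ^+ 2.
have sle (s : R) : Num.min t0 t <= s <= Num.max t0 t -> `|s - t0| <= `|t - t0|.
  rewrite ge_min le_max => /andP[h1 h2]; have [tt0|tt0] := leP t0 t.
    by rewrite !ger0_norm ?subr_ge0//; move: h1 h2 => /orP[?|?] /orP[?|?]; lra.
  by rewrite !ler0_norm ?subr_le0 ?(ltW tt0)//; move: h1 h2 => /orP[?|?] /orP[?|?]; lra.
have [|s sP] := @MVT_between R G (fun s => phi' s - phi' t0 - phi2 * (s - t0)) t0 t.
  move=> s sP; have d1s : is_derive (s : R) (1 : R) phi (phi' s).
    apply: d1P; rewrite /= distrC; apply: (le_lt_trans (sle s sP)).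
    by apply: lt_le_trans tt _; rewrite ge_min lexx orbT.
  have dq : is_derive (s : R) (1 : R) (fun s => phi' t0 * (s - t0) + phi2 / 2 * (s - t0) ^+ 2 : R)
      (phi' t0 + phi2 * (s - t0)).
    apply: (@is_derive_quad _ _ _ _ _ _ `|phi2 / 2|); near=> h; rewrite [h *: 1]mulr1.
    rewrite (_ : _ - _ - _ = phi2 / 2 * h ^+ 2); last by field.
    by rewrite normrM [`|h ^+ 2|]ger0_norm ?sqr_ge0.
  have -> : G = phi - (fun s => phi' t0 * (s - t0) + phi2 / 2 * (s - t0) ^+ 2).
    by apply/funext => y; rewrite /G -[RHS]/(_ - (_ + _)) opprD addrA.
  by apply: (is_derive_eq (is_deriveB d1s dq)); rewrite opprD addrA.
rewrite /G subrr expr0n/= !mulr0 !subr0 => E.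
have -> : phi t - phi t0 - phi' t0 * (t - t0) - phi2 / 2 * (t - t0) ^+ 2 =
  (phi' s - phi' t0 - phi2 * (s - t0)) * (t - t0) by rewrite -E; ring.
rewrite normrM; apply: (@le_trans _ _ (eta * `|t - t0| * `|t - t0|)); last first.
  by rewrite -mulrA -expr2 -normrX ger0_norm// sqr_ge0.
rewrite ler_wpM2r//; apply: (le_trans (slope s (le_lt_trans (sle s sP) tt))).
by rewrite ler_wpM2l ?(ltW eta0)// sle.
Unshelve. all: by end_near.
Qed.

End taylor.

Section radial.
Context {R : realType} {n : nat}.
Implicit Types (x y z h : 'rV[R]_n).

Definition nsq x : R := \sum_i x 0 i ^+ 2.
Definition dotp z h : R := \sum_i z 0 i * h 0 i.

Lemma nsq_ge0 x : 0 <= nsq x.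
Proof. by apply: sumr_ge0 => i _; exact: sqr_ge0. Qed.

Lemma nsq0 : nsq 0 = 0.
Proof. by apply: big1 => i _; rewrite mxE expr0n. Qed.

Lemma dotp0 z : dotp z 0 = 0.
Proof. by apply: big1 => i _; rewrite mxE mulr0. Qed.

Lemma nsqN x : nsq (- x) = nsq x.
Proof. by apply: eq_bigr => i _; rewrite mxE sqrrN. Qed.

Lemma nsqBC x y : nsq (x - y) = nsq (y - x).
Proof. by rewrite -nsqN opprB. Qed.

Lemma nsqD z h : nsq (z + h) = nsq z + 2 * dotp z h + nsq h.
Proof.
rewrite /nsq /dotp mulr_sumr -!big_split/=; apply: eq_bigr => i _; rewrite mxE; ring.
Qed.

Lemma nsqD_le z h : nsq (z + h) <= 2 * nsq z + 2 * nsq h.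
Proof.
rewrite /nsq !mulr_sumr -big_split/=; apply: ler_sum => i _; rewrite mxE.
by have := sqr_ge0 (z 0 i - h 0 i); nra.
Qed.

Lemma sqr_coord_le x i : x 0 i ^+ 2 <= nsq x.
Proof. by rewrite /nsq (bigD1 i)//= lerDl sumr_ge0// => j _; exact: sqr_ge0. Qed.

Lemma dotp_sqr_le z h : dotp z h ^+ 2 <= nsq z * nsq h.
Proof.
have [h0|h0] := eqVneq (nsq h) 0.
  have hi i : h 0 i = 0.
    by apply/eqP; rewrite -sqrf_eq0 eq_le sqr_ge0 andbT -h0; exact: sqr_coord_le.
  by rewrite /dotp big1 ?expr0n ?mulr_ge0 ?nsq_ge0// => i _; rewrite hi mulr0.
have hp : 0 < nsq h by rewrite lt_neqAle eq_sym h0 nsq_ge0.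
have := nsq_ge0 (nsq h *: z + (- dotp z h) *: h); rewrite nsqD.
have -> : nsq (nsq h *: z) = nsq h ^+ 2 * nsq z.
  by rewrite /nsq mulr_sumr; apply: eq_bigr => i _; rewrite mxE; ring.
have -> : nsq (- dotp z h *: h) = dotp z h ^+ 2 * nsq h.
  by rewrite /nsq mulr_sumr; apply: eq_bigr => i _; rewrite mxE; ring.
have -> : dotp (nsq h *: z) (- dotp z h *: h) = - nsq h * dotp z h * dotp z h.
  by rewrite [in LHS]/dotp [in RHS]/dotp mulr_sumr; apply: eq_bigr => i _; rewrite !mxE /dotp; ring.
move: (nsq h) (nsq z) (dotp z h) hp => q Z d q0 H.
have : 0 <= q * (q * Z - d ^+ 2) by apply: le_trans H _; lra.
by rewrite pmulr_rge0// subr_ge0 mulrC.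
Qed.

Lemma continuous_nsq y : continuous (fun x => nsq (x - y)).
Proof.
move=> x; have FF : Filter (nbhs x) := nbhs_filter x.
have ci i : (fun x => (x - y) 0 i ^+ 2) @ x --> (x - y) 0 i ^+ 2.
  have cx := @continuous_coordB R n y i x; exact: (cvgM cx cx).
exact: (@cvg_sumr R _ (nbhs x) FF _ _ _ ci).
Qed.

Lemma quadp_radial (f1 f2 : R) z h :
  quadp (fun i => 2 * f1 * z 0 i) (fun i j => 2 * f1 * (i == j)%:R + 4 * f2 * z 0 i * z 0 j) h =
  f1 * (2 * dotp z h + nsq h) + 2 * f2 * dotp z h ^+ 2.
Proof.
rewrite /quadp (_ : \sum_i 2 * f1 * z 0 i * h 0 i = 2 * f1 * dotp z h); last first.
  by rewrite /dotp mulr_sumr; apply: eq_bigr => i _; ring.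
have -> : qform (fun i j => 2 * f1 * (i == j)%:R + 4 * f2 * z 0 i * z 0 j) h =
    2 * f1 * nsq h + 4 * f2 * dotp z h ^+ 2.
  transitivity (qform (fun i j => 4 * f2 * z 0 i * z 0 j + 2 * f1 * (i == j)%:R) h).
    by apply: eq_bigr => i _; apply: eq_bigr => j _; rewrite addrC.
  rewrite qform_addD addrC; congr (_ + _).
  rewrite expr2 {1}/dotp mulr_suml mulr_sumr /qform; apply: eq_bigr => i _.
  by rewrite /dotp !mulr_sumr; apply: eq_bigr => j _; ring.
by field.
Qed.

(** The increment of |x - y|^2 is 2 d + q with d = z.h and q = |h|^2. Inserted into the one-variable
    expansion of phi it gives the jet plus f2 (4 d + q) q / 2 and the Taylor error, both o(q). *)
Lemma radial_touch (w : 'rV[R]_n -> R) (phi : R -> R) (f1 f2 : R) (x0 y : 'rV[R]_n) :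
  (forall eta : R, 0 < eta -> \forall t \near nsq (x0 - y),
    `|phi t - phi (nsq (x0 - y)) - f1 * (t - nsq (x0 - y)) - f2 / 2 * (t - nsq (x0 - y)) ^+ 2|
      <= eta * (t - nsq (x0 - y)) ^+ 2) ->
  (\forall x \near x0, w x - phi (nsq (x - y)) <= w x0 - phi (nsq (x0 - y))) ->
  touch_above w x0 (fun i => 2 * f1 * (x0 - y) 0 i)
    (fun i j => 2 * f1 * (i == j)%:R + 4 * f2 * (x0 - y) 0 i * (x0 - y) 0 j).
Proof.
set t0 := nsq (x0 - y); set z := x0 - y => Tay wmax eta eta0.
pose Z := nsq z; have Z0 : 0 <= Z := nsq_ge0 z.
(* For q <= 1 one has (2 d + q)^2 <= 8 d^2 + 2 q^2 <= (8 Z + 2) q, so the Taylor error is at most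
   half of eta q; [ka] below does the same for the other remainder. *)
pose e1 := eta / (2 * (8 * Z + 2)).
have e10 : 0 < e1 by rewrite divr_gt0//; lra.
pose ka := Num.min 1 (eta / (5 * `|f2| + 1)).
have f20 := normr_ge0 f2.
have ka0 : 0 < ka by rewrite lt_min ltr01 divr_gt0//; lra.
have ka1 : ka <= 1 by rewrite ge_min lexx.
have ka2 : 5 * `|f2| * ka <= eta.
  have : ka <= eta / (5 * `|f2| + 1) by rewrite ge_min lexx orbT.
  rewrite ler_pdivlMr; last by lra.
  by rewrite mulrDr mulr1 [ka * _]mulrC; lra.
near=> x.
have q1 : nsq (x - x0) <= ka.
  near: x; have /cvgrPdist_le := @continuous_nsq x0 x0 => /(_ ka ka0).
  by apply: filterS => x; rewrite subrr nsq0 sub0r normrN ger0_norm ?nsq_ge0.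
have d1 : `|dotp z (x - x0)| <= ka.
  near: x; have /cvgrPdist_le := @continuous_lform R n (fun i => z 0 i) x0 x0 => /(_ ka ka0).
  by apply: filterS => x; rewrite subrr -/(dotp z 0) dotp0 sub0r normrN.
have W : w x - phi (nsq (x - y)) <= w x0 - phi t0 by near: x.
have T : `|phi (nsq (x - y)) - phi t0 - f1 * (nsq (x - y) - t0) - f2 / 2 * (nsq (x - y) - t0) ^+ 2|
    <= e1 * (nsq (x - y) - t0) ^+ 2.
  by near: x; exact: (@continuous_nsq y x0 _ (Tay e1 e10)).
pose h := x - x0; rewrite -/h in q1 d1 *.
have xy : x - y = z + h by rewrite /z /h [RHS]addrC addrA subrK.
rewrite quadp_radial.
have -> : \sum_i (x 0 i - x0 0 i) ^+ 2 = nsq h by apply: eq_bigr => i _; rewrite !mxE.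
have tE : nsq (x - y) - t0 = 2 * dotp z h + nsq h by rewrite xy nsqD /t0 -/z; ring.
have dq := dotp_sqr_le z h; rewrite -/Z in dq.
have q0 := nsq_ge0 h.
move: T; rewrite tE ler_norml => /andP[_].
move: W q0 q1 d1 dq; move: (nsq h) (dotp z h) (phi (nsq (x - y))) (phi t0) (w x) (w x0).
move=> q d ph ph0 wx wx0 W q0 q1 d1 dq T.
have h1 : f2 * (4 * d + q) <= eta.
  apply: (le_trans (ler_norm _)); apply: le_trans ka2; rewrite normrM mulrAC mulrC.
  apply: ler_pM => //; apply: (le_trans (ler_normD _ _)).
  by rewrite normrM (ger0_norm q0) ger0_norm//; lra.
have h2 : e1 * (2 * d + q) ^+ 2 <= eta / 2 * q.
  have -> : eta / 2 * q = e1 * ((8 * Z + 2) * q) by rewrite /e1; field; rewrite gt_eqF//; lra.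
  rewrite ler_wpM2l ?(ltW e10)//.
  have : q * q <= q by rewrite ler_piMr// (le_trans q1).
  by have := sqr_ge0 (2 * d - q); nra.
have := ler_wpM2r q0 h1.
have E : f2 / 2 * (2 * d + q) ^+ 2 = 2 * f2 * d ^+ 2 + f2 * (4 * d + q) * q / 2 by field.
move: T W h2; rewrite E; move: (f2 * (4 * d + q) * q) (e1 * _) (f1 * _) (2 * f2 * d ^+ 2) => A B C F.
by rewrite [eta / 2 * q]mulrAC; move: (eta * q) => G *; lra.
Unshelve. all: by end_near.
Qed.

End radial.

Section barrier.
Context {R : realType}.
Variables (al be : R).
Implicit Types (t : R) (m : nat).

(** With t = |x - y|^2 both barriers are of this form: al = 0, be = 1 outside a ball, and al = r^2,
    be = -1 inside one. *)
Lemma is_derive_inv_power m t : al + be * t != 0 ->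
  is_derive (t : R) (1 : R) (fun t => (al + be * t)^-1 ^+ m.+1 : R)
    (- be * m.+1%:R * (al + be * t)^-1 ^+ m.+2).
Proof.
move=> s0.
have d1 : is_derive (t : R) (1 : R) (fun t => al + be * t : R) be.
  apply: (@is_derive_quad _ _ _ _ _ _ 0); near=> h; rewrite [h *: 1]mulr1 mul0r.
  by rewrite (_ : _ - _ - _ = 0) ?normr0//; ring.
have d2 := @is_deriveV R (fun t => al + be * t) t be 1 s0 d1.
have d3 := is_deriveX m.+1 d2.
have -> : (fun t => (al + be * t)^-1 ^+ m.+1) = (fun t => (al + be * t)^-1) ^+ m.+1.
  by apply/funext => y; rewrite exprfctE.
apply: (is_derive_eq d3); rewrite /GRing.scale/= -exprVn !exprS; ring.
Unshelve. all: by end_near.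
Qed.

Lemma inv_power_taylor (A : R) m t0 : be ^+ 2 = 1 -> 0 < al + be * t0 ->
  forall eta : R, 0 < eta -> \forall t \near t0,
  `|A * (al + be * t)^-1 ^+ m.+1 - A * (al + be * t0)^-1 ^+ m.+1
    - (- be * m.+1%:R * A * (al + be * t0)^-1 ^+ m.+2) * (t - t0)
    - (m.+1%:R * m.+2%:R * A * (al + be * t0)^-1 ^+ m.+3) / 2 * (t - t0) ^+ 2|
  <= eta * (t - t0) ^+ 2.
Proof.
move=> be2 s0.
have spos : \forall t \near t0, 0 < al + be * t.
  near=> t; have dt : `|t0 - t| < (al + be * t0).
    by near: t; exact: (@nbhsx_ballx _ _ t0 _ s0).
  have := sqrf_eq1 be; rewrite be2 eqxx => /esym /orP[/eqP bE|/eqP bE];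
    move: dt (s0); rewrite bE ltr_norml => /andP[? ?] ?; lra.
have dZ (k : nat) (B t : R) : 0 < al + be * t ->
    is_derive (t : R) (1 : R) (fun t => B * (al + be * t)^-1 ^+ k.+1 : R) (B * (- be * k.+1%:R * (al + be * t)^-1 ^+ k.+2)).
  move=> s0'; have d := is_deriveZ B (is_derive_inv_power k (lt0r_neq0 s0')).
  exact: d.
have T := @taylor2 R (fun t => A * (al + be * t)^-1 ^+ m.+1)
  (fun t => - be * m.+1%:R * A * (al + be * t)^-1 ^+ m.+2) t0
  (m.+1%:R * m.+2%:R * A * (al + be * t0)^-1 ^+ m.+3).
apply: T.
  apply: filterS spos => t st; apply: (is_derive_eq (dZ m A t st)); ring.
apply: (is_derive_eq (dZ m.+1 _ t0 s0)).
transitivity (be ^+ 2 * (m.+1%:R * m.+2%:R * A * (al + be * t0)^-1 ^+ m.+3)); first by ring.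
by rewrite be2 mul1r.
Unshelve. all: by end_near.
Qed.

End barrier.

(** * Powers at the boundary rate *)

Section powers.
Context {R : realType}.
Variable p : R.
Hypothesis p1 : 1 < p.

(* The exact boundary rate: [growth r] satisfies [growth r `^ p = growth r / r ^+ 2]. *)
Definition growth (r : R) : R := r `^ (- (2 / (p - 1))).

Lemma growth_gt0 r : 0 < r -> 0 < growth r.
Proof. exact: powR_gt0. Qed.

Lemma growthM r s : 0 <= r -> 0 <= s -> growth (r * s) = growth r * growth s.
Proof. exact: powRM. Qed.

Lemma barrier_power r y (m : nat) : 0 < r -> 0 < y ->
  (growth r * y ^+ m) `^ p = growth r / r ^+ 2 * y ^+ m * y `^ (m%:R * (p - 1)).
Proof.
move=> r0 y0; rewrite powRM ?ltW ?growth_gt0 ?exprn_gt0//.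
have -> : (growth r) `^ p = growth r / r ^+ 2.
  have -> : (growth r) `^ p = growth r `^ (1 + (p - 1)) by congr (_ `^ _); ring.
  rewrite powRD; last by rewrite (gt_eqF (growth_gt0 r0)) implybT.
  rewrite powRr1 ?ltW ?growth_gt0//; congr (_ * _).
  rewrite /growth -powRrM mulNr divfK; last by rewrite gt_eqF// subr_gt0.
  by rewrite powRN powR_mulrn ?ltW.
have -> : (y ^+ m) `^ p = y ^+ m * y `^ (m%:R * (p - 1)).
  rewrite -[in LHS]powR_mulrn ?(ltW y0)// -powRrM.
  have -> : m%:R * p = m%:R + m%:R * (p - 1) by ring.
  rewrite powRD; last by rewrite (gt_eqF y0) implybT.
  by rewrite powR_mulrn// ltW.
by rewrite mulrA.
Qed.

(** The ratio r^2/t is at most 1, so its power m (p - 1) >= 1 is at most the ratio itself. The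
    nonlinearity is thus of the order of the second derivatives of the barrier, without a large
    constant. *)
Lemma lower_barrier_power r t (m : nat) : 0 < r -> r ^+ 2 <= t -> 1 <= m%:R * (p - 1) ->
  (growth r * (r ^+ 2 / t) ^+ m) `^ p <= growth r * (r ^+ 2 / t) ^+ m / t.
Proof.
move=> r0 rt mp; have r20 : 0 < r ^+ 2 by rewrite exprn_gt0.
have t0 : 0 < t by exact: lt_le_trans rt.
have y0 : 0 < r ^+ 2 / t by rewrite divr_gt0.
have y1 : r ^+ 2 / t <= 1 by rewrite ler_pdivrMr// mul1r.
rewrite barrier_power//.
have -> : growth r * (r ^+ 2 / t) ^+ m / t = growth r / r ^+ 2 * (r ^+ 2 / t) ^+ m * (r ^+ 2 / t).
  by field; rewrite !gt_eqF.
rewrite ler_wpM2l//; first by rewrite mulr_ge0 ?divr_ge0 ?exprn_ge0 ?ltW ?growth_gt0.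
by apply: ge1r_powR => //; rewrite y0.
Qed.

(** Here the ratio r^2/s is at least 1 and its power m (p - 1) >= 2 supplies the factor s^-2 of the
    second derivatives. The factor C^(p-1) is gained because the nonlinearity is superlinear. *)
Lemma upper_barrier_power r s (C : R) (m : nat) : 0 < s <= r ^+ 2 -> 0 < r -> 0 < C ->
  2 <= m%:R * (p - 1) ->
  C `^ (p - 1) * (C * growth r * (r ^+ 2 / s) ^+ m) * r ^+ 2 / s ^+ 2 <=
  (C * growth r * (r ^+ 2 / s) ^+ m) `^ p.
Proof.
move=> /andP[s0 sr] r0 C0 mp; have r20 : 0 < r ^+ 2 by rewrite exprn_gt0.
have y0 : 0 < r ^+ 2 / s by rewrite divr_gt0.
have y1 : 1 <= r ^+ 2 / s by rewrite ler_pdivlMr// mul1r.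
have X0 : 0 <= growth r * (r ^+ 2 / s) ^+ m by rewrite ltW// mulr_gt0 ?exprn_gt0 ?growth_gt0.
rewrite -[in leRHS]mulrA (powRM p (ltW C0) X0) barrier_power//.
have -> : C `^ p = C `^ (p - 1) * C.
  have -> : C `^ p = C `^ ((p - 1) + 1) by congr (_ `^ _); ring.
  by rewrite powRD ?powRr1 ?(ltW C0)// (gt_eqF C0) implybT.
have -> : C `^ (p - 1) * (C * growth r * (r ^+ 2 / s) ^+ m) * r ^+ 2 / s ^+ 2 =
    C `^ (p - 1) * C * (growth r / r ^+ 2 * (r ^+ 2 / s) ^+ m * (r ^+ 2 / s) ^+ 2).
  by field; rewrite !gt_eqF.
rewrite ler_wpM2l//; first by rewrite mulr_ge0 ?powR_ge0 ?ltW.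
rewrite ler_wpM2l//; first by rewrite mulr_ge0 ?divr_ge0 ?exprn_ge0 ?ltW ?growth_gt0.
by rewrite -powR_mulrn ?(ltW y0)// ler_powR.
Qed.

End powers.

Section radial_operator.
Context {R : realType} {n : nat}.
Variables (A : 'I_n -> 'I_n -> R) (B : 'I_n -> R) (lam M : R).
Hypothesis AM : forall i j, `|A i j| <= M.
Hypothesis BM : forall i, `|B i| <= M.
Implicit Types (z : 'rV[R]_n).

Lemma radial_operatorE (f1 f2 : R) z :
  \sum_i \sum_j A i j * (2 * f1 * (i == j)%:R + 4 * f2 * z 0 i * z 0 j) +
  \sum_i B i * (2 * f1 * z 0 i) =
  2 * f1 * (\sum_i A i i + \sum_i B i * z 0 i) + 4 * f2 * qform A z.
Proof.
have -> : \sum_i \sum_j A i j * (2 * f1 * (i == j)%:R + 4 * f2 * z 0 i * z 0 j) =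
    2 * f1 * (\sum_i A i i) + 4 * f2 * qform A z.
  rewrite /qform !mulr_sumr -big_split/=; apply: eq_bigr => i _.
  transitivity (\sum_j (2 * f1 * (A i j * (i == j)%:R) + 4 * f2 * (A i j * z 0 i * z 0 j))).
    by apply: eq_bigr => j _; ring.
  rewrite big_split/= -!mulr_sumr; congr (2 * f1 * _ + _).
  rewrite (bigD1 i)//= big1 => [|j ji]; last by rewrite eq_sym (negbTE ji) mulr0.
  by rewrite eqxx mulr1 addr0.
have -> : \sum_i B i * (2 * f1 * z 0 i) = 2 * f1 * \sum_i B i * z 0 i.
  by rewrite mulr_sumr; apply: eq_bigr => i _; ring.
ring.
Qed.

Lemma first_order_le (Q : R) z : (forall i, `|z 0 i| <= Q) ->
  `|\sum_i A i i + \sum_i B i * z 0 i| <= n%:R * M * (1 + Q).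
Proof.
move=> zQ; apply: (le_trans (ler_normD _ _)); rewrite mulrDr mulr1; apply: lerD.
  apply: (le_trans (ler_norm_sum _ _ _)); apply: (@le_trans _ _ (\sum_(i < n) M)).
    by apply: ler_sum.
  by rewrite sumr_const card_ord mulr_natl.
apply: (le_trans (ler_norm_sum _ _ _)); apply: (@le_trans _ _ (\sum_(i < n) M * Q)).
  by apply: ler_sum => i _; rewrite normrM ler_pM.
by rewrite sumr_const card_ord -[_ *+ _]mulr_natl mulrA.
Qed.

Lemma qform_le z : qform A z <= n%:R * M * nsq z.
Proof.
apply: (@le_trans _ _ (\sum_i \sum_j M * ((z 0 i ^+ 2 + z 0 j ^+ 2) / 2))).
  apply: ler_sum => i _; apply: ler_sum => j _; rewrite -mulrA.
  apply: (le_trans (ler_norm _)); rewrite normrM; apply: ler_pM => //.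
  rewrite ler_norml; have := sqr_ge0 (z 0 i + z 0 j); have := sqr_ge0 (z 0 i - z 0 j).
  by move=> *; apply/andP; split; nra.
have -> : \sum_i \sum_j M * ((z 0 i ^+ 2 + z 0 j ^+ 2) / 2) =
    M / 2 * (\sum_i \sum_(j < n) z 0 i ^+ 2 + \sum_(i < n) \sum_j z 0 j ^+ 2).
  rewrite -big_split mulr_sumr; apply: eq_bigr => i _.
  by rewrite -big_split mulr_sumr; apply: eq_bigr => j _ /=; field.
have -> : \sum_i \sum_(j < n) z 0 i ^+ 2 = n%:R * nsq z.
  by rewrite /nsq mulr_sumr; apply: eq_bigr => i _; rewrite sumr_const card_ord mulr_natl.
rewrite sumr_const card_ord -[nsq z *+ n]mulr_natl le_eqVlt; apply/orP; left; apply/eqP.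
by field.
Qed.

End radial_operator.

(** * Nearest boundary points and maxima in the domain *)

Section domain.
Context {R : realType} {n : nat}.
Implicit Types (x y z : 'rV[R]_n) (A Omega : set 'rV[R]_n).

Lemma eucl_norm_sqr x : eucl_norm x ^+ 2 = nsq x.
Proof. by rewrite sqr_sqrtr//; exact: nsq_ge0. Qed.

Lemma eucl_norm_lt x (r : R) : 0 < r -> (eucl_norm x < r) = (nsq x < r ^+ 2).
Proof.
by move=> r0; rewrite -eucl_norm_sqr ltr_pXn2r ?nnegrE ?(ltW r0)//; exact: sqrtr_ge0.
Qed.

Lemma nsq_le_bounded A (r : R) x0 : (forall x, A x -> nsq (x - x0) <= r) -> bounded_set A.
Proof.
move=> Ar; have b0 : bounded_set (ccube x0 (1 + r)).
  exact: (compact_bounded (@compact_ccube R n x0 (1 + r))).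
case: b0 => M [Mr MP]; exists M; split=> // k Mk x Ax; apply: (MP k Mk) => i.
have := le_trans (sqr_coord_le (x - x0) i) (Ar x Ax); rewrite !mxE.
move: (x 0 i - x0 0 i) => t tr; have r0 : 0 <= r by exact: le_trans (sqr_ge0 t) tr.
rewrite ler_norml; have := sqr_ge0 (2 * t - 1); have := sqr_ge0 (2 * t + 1).
by move=> *; apply/andP; split; lra.
Qed.

Lemma bounded_nsq_le A : bounded_set A -> exists2 r : R, 0 < r & forall x, A x -> nsq x <= r.
Proof.
move=> [M [_ /(_ (`|M| + 1))]] MP.
have {}MP x : A x -> `|x| <= `|M| + 1.
  by apply: MP; rewrite (le_lt_trans (ler_norm M))// ltrDl.
have M0 : 0 < `|M| + 1 by rewrite ltr_wpDl.
exists (n%:R * (`|M| + 1) ^+ 2 + 1).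
  by rewrite ltr_wpDl// mulr_ge0// exprn_ge0// ltW.
move=> x /MP xM; apply: (@le_trans _ _ (\sum_(i < n) (`|M| + 1) ^+ 2)).
  apply: ler_sum => i _; rewrite -[leLHS]ger0_norm ?sqr_ge0// normrX.
  apply: lerXn2r; rewrite ?nnegrE ?(ltW M0)//; exact: le_trans (coord_le_norm x i) xM.
by rewrite sumr_const card_ord mulr_natl lerDl.
Qed.

Lemma compact_nsq_ball x0 (r : R) : compact [set x | nsq (x - x0) <= r].
Proof.
apply: bounded_closed_compact; first exact: (@nsq_le_bounded _ r x0).
have cN := @continuous_nsq R n x0.
exact: (closed_comp (f := fun x => nsq (x - x0)) (D := [set t | t <= r]) (fun x _ => cN x) (@closed_le R r)).
Qed.

Lemma compact_max (K : set 'rV[R]_n) (F : 'rV[R]_n -> R) : K !=set0 -> compact K ->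
  (forall x, K x -> {for x, continuous F}) -> exists2 x0, K x0 & forall x, K x -> F x <= F x0.
Proof.
move=> K0 cK cF.
have cFK : {within K, continuous F}.
  by apply: continuous_in_subspaceT => x; rewrite inE => /cF.
have [x0 Kx0 x0max] := EVT_max_rV K0 cK cFK.
exists x0; first by rewrite inE in Kx0.
by move=> x Kx; apply: x0max; rewrite inE.
Qed.

(** z is a nearest point of the complement, nonempty because Omega is bounded and n > 0. Points of
    the segment from z to x are closer to x, hence in Omega, so z is a boundary point. *)
Lemma exists_nearest_boundary Omega x : (0 < n)%N -> open Omega -> bounded_set Omega -> Omega x ->
  exists z, [/\ boundary Omega z, 0 < nsq (z - x) & forall y, nsq (y - x) < nsq (z - x) -> Omega y].
Proof.
move=> n0 oO bO Ox.
have [r r0 rP] := bounded_nsq_le bO.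
have clC : closed (~` Omega) by exact: open_closedC.
pose x1 : 'rV[R]_n := const_mx (1 + r).
have x1O : ~ Omega x1.
  move=> /rP; have := sqr_coord_le x1 (Ordinal n0); rewrite mxE => h1 h2.
  by have := le_trans h1 h2; nra.
pose S := (~` Omega) `&` [set y | nsq (y - x) <= nsq (x1 - x)].
have cS : compact S.
  apply: (subclosed_compact _ (@compact_nsq_ball x (nsq (x1 - x)))); last by move=> y [].
  by apply: closedI => //; apply: compact_closed (@compact_nsq_ball _ _); exact: norm_hausdorff.
have [z [zO zr] zmin] : exists2 z, S z & forall y, S y -> - nsq (y - x) <= - nsq (z - x).
  apply: compact_max cS _; first by exists x1; split => /=.
  by move=> y _; have FF : Filter (nbhs y) := nbhs_filter y; exact: (cvgN (@continuous_nsq R n x y)).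
have zx : 0 < nsq (z - x).
  rewrite lt_neqAle nsq_ge0 andbT eq_sym; apply/negP => /eqP zx0; apply: zO.
  suff -> : z = x by [].
  apply/rowP => i; apply/eqP; rewrite -subr_eq0 -sqrf_eq0 eq_le sqr_ge0 andbT -zx0.
  by have := sqr_coord_le (z - x) i; rewrite !mxE.
have inO y : nsq (y - x) < nsq (z - x) -> Omega y.
  move=> yz; apply: contrapT => yO; have := zmin y; rewrite lerN2 leNgt yz => h.
  by suff : False by []; apply/notF/h; split=> //=; rewrite (le_trans (ltW yz)).
exists z; split=> //; split; last by move=> /interior_subset.
move=> B zB.
have line : (fun t : R => t *: (x - z) + z) @ (0 : R) --> z.
  have : (fun t : R => t *: (x - z) + z) @ (0 : R) --> 0 *: (x - z) + z.
    by apply: cvgD; [apply: cvgZ; [exact: cvg_id|exact: cvg_cst]|exact: cvg_cst].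
  by rewrite scale0r add0r.
have [d /= d0 dP] := line _ zB.
pose t := Num.min (d / 2) (2^-1).
have t0 : 0 < t by rewrite lt_min divr_gt0//= invr_gt0.
have td : t < d by rewrite gt_min ltr_pdivrMr// ltr_pMr// ltr1n.
have t1 : t < 1 by rewrite gt_min invf_lt1// ltr1n orbT.
exists (t *: (x - z) + z); split; last by apply: dP; rewrite /= sub0r normrN gtr0_norm.
apply: inO; have -> : t *: (x - z) + z - x = (1 - t) *: (z - x).
  by apply/rowP => i; rewrite !mxE; ring.
have -> : nsq ((1 - t) *: (z - x)) = (1 - t) ^+ 2 * nsq (z - x).
  by rewrite /nsq mulr_sumr; apply: eq_bigr => i _; rewrite mxE exprMn.
by rewrite gtr_pMl//; nra.
Qed.

(** A superlevel set of psi - u is compact: it cannot accumulate at the boundary, since there u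
    exceeds any bound and psi is bounded above. *)
Lemma blowup_max Omega (u psi : 'rV[R]_n -> R) (P : R) : open Omega -> bounded_set Omega ->
  Omega !=set0 ->
  (forall x, Omega x -> {for x, continuous u}) -> (forall x, Omega x -> {for x, continuous psi}) ->
  boundary_blowup Omega u -> (forall x, Omega x -> psi x <= P) ->
  exists2 x0, Omega x0 & forall x, Omega x -> psi x - u x <= psi x0 - u x0.
Proof.
move=> oO bO [x1 Ox1] cu cpsi bu psiP.
pose F x := psi x - u x.
have cF x : Omega x -> {for x, continuous F}.
  move=> Ox; have FF : Filter (nbhs x) := nbhs_filter x; exact: (cvgB (cpsi x Ox) (cu x Ox)).
pose K := Omega `&` [set x | F x1 <= F x].
have KO : K `<=` Omega by move=> x [].
have clK : closed K.
  move=> x clKx; have [Ox|Ox] := pselect (Omega x).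
    split=> //=; rewrite leNgt; apply/negP => FF.
    have nF : \forall y \near x, F y < F x1 by exact: (cvgr_lt _ (cF x Ox)).
    by have [y [[_ /=]]] := clKx _ nF; rewrite leNgt => /negP.
  have bx : boundary Omega x.
    split; first exact: (closureS KO clKx).
    by move=> /interior_subset.
  have [d d0 dP] := bu (P - F x1).
  have nd : \forall y \near x, nsq (y - x) < d ^+ 2.
    have c := @continuous_nsq R n x x; apply: (cvgr_lt _ c).
    by rewrite subrr nsq0 exprn_gt0.
  have [y [[Oy /= Fy] yd]] := clKx _ nd.
  have : P - F x1 < u y.
    apply: dP => //; apply: (@le_lt_trans _ _ (eucl_norm (y - x))).
      apply: ge_inf; last by exists x.
      by exists 0 => _ [w _ <-]; exact: sqrtr_ge0.
    by rewrite eucl_norm_lt.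
  by have := psiP y Oy; move: Fy; rewrite /F; lra.
have bK : bounded_set K by case: bO => M [Mr MP]; exists M; split=> // k /MP h x /KO; exact: h.
have K0 : K !=set0 by exists x1; split => /=.
have [x0 [Ox0 Fx0] x0max] := compact_max K0 (bounded_closed_compact bK clK) (fun x Kx => cF x (KO x Kx)).
exists x0 => // x Ox; rewrite -/(F x) -/(F x0).
have [h|h] := leP (F x1) (F x); first by apply: x0max.
by apply: le_trans Fx0; exact: ltW.
Qed.

End domain.

Lemma continuous_barrier (R : realType) (n : nat) (al be A : R) (m : nat) (x y : 'rV[R]_n) :
  al + be * nsq (x - y) != 0 ->
  {for x, continuous (fun x : 'rV[R]_n => A * (al + be * nsq (x - y))^-1 ^+ m)}.
Proof.
move=> s0; have FF : Filter (nbhs x) := nbhs_filter x.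
have c1 := @continuous_nsq R n y x.
have c2 : (fun x : 'rV[R]_n => al + be * nsq (x - y)) @ x --> al + be * nsq (x - y).
  exact: (cvgD (cvg_cst al) (@cvgMl_tmp R _ (nbhs x) FF _ be _ c1)).
have c3 : (fun x : 'rV[R]_n => (al + be * nsq (x - y))^-1) @ x --> (al + be * nsq (x - y))^-1.
  exact: cvgV c2.
have c4 : (fun x : 'rV[R]_n => (al + be * nsq (x - y))^-1 ^+ m) @ x --> (al + be * nsq (x - y))^-1 ^+ m.
  exact: (cvg_comp _ _ c3 (@exprn_continuous R m _)).
exact: (@cvgMl_tmp R _ (nbhs x) FF _ A _ c4).
Qed.

Lemma archi_ge (R : realType) (x : R) : exists k : nat, x <= k%:R.
Proof.
exists (Num.bound `|x|); apply: (le_trans (ler_norm x)).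
by apply: ltW; exact: archi_boundP.
Qed.

Lemma invr_power_le (R : realType) (s t : R) (m : nat) : 0 < s -> s <= t ->
  t^-1 ^+ m <= s^-1 ^+ m.
Proof.
move=> s0 st; have t0 : 0 < t by exact: lt_le_trans st.
by apply: lerXn2r; rewrite ?nnegrE ?invr_ge0 ?(ltW s0) ?(ltW t0)// lef_pV2.
Qed.

Lemma pos_power_le (R : realType) (T : Type) (u : T -> R) (p xi : R) x :
  0 <= p -> 0 <= xi -> u x <= xi -> pos_power p u x <= xi `^ p.
Proof.
move=> p0 xi0 uxi; apply: ge0_ler_powR => //; rewrite ?nnegrE ?le_max ?lexx ?orbT//.
by rewrite ge_max uxi.
Qed.

Lemma pos_power_ge (R : realType) (T : Type) (u : T -> R) (p xi : R) x :
  0 <= p -> 0 <= xi -> xi <= u x -> xi `^ p <= pos_power p u x.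
Proof.
move=> p0 xi0 uxi; apply: ge0_ler_powR => //; rewrite ?nnegrE ?le_max ?lexx ?orbT//.
by rewrite uxi.
Qed.

Lemma lower_arith (R : realType) (k1 k2 xi t lam B K Q T q P cu : R) :
  1 <= k1 -> 0 <= k2 -> 0 <= K * Q -> 0 < xi / t -> 2 * B + 2 + K * Q <= 4 * k2 * lam -> T <= B -> lam * t <= q -> 0 < t ->
  P <= xi / t -> cu <= K * Q * (xi / t) ->
  2 * (k1 * xi / t) * T + 4 * (- (k1 * k2 * xi / t / t)) * q + xi / t <= - P - cu.
Proof.
move=> k11 k20 KQ0.
have -> : k1 * xi / t = k1 * (xi / t) by rewrite mulrA.
have -> : k1 * k2 * xi / t / t = k1 * k2 * (xi / t) / t by rewrite !mulrA.
move: (xi / t) => e e0 H TB qt t0 Pe cue.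
have k1e : 0 <= k1 * e by rewrite mulr_ge0 ?(ltW e0)//; lra.
have k10 : 0 <= k1 by lra.
have h1 := ler_wpM2l k1e TB.
have : 0 <= k1 * k2 * e / t by rewrite divr_ge0 ?(ltW t0)// !mulr_ge0// ltW.
move=> /ler_wpM2l /(_ _ _ qt).
have -> : k1 * k2 * e / t * (lam * t) = k1 * k2 * e * lam by field; exact: lt0r_neq0.
move=> h2; have h3 := ler_wpM2l k1e H.
have h4 : 0 <= (k1 - 1) * e * (2 + K * Q).
  by rewrite mulr_ge0// ?mulr_ge0 ?(ltW e0)//; lra.
rewrite mulrN mulNr -[4 * _ * q]mulrA.
move: h1 h2 h3 h4 cue; move: (K * Q) (k1 * k2 * e / t * q) => KQ G.
by move=> *; lra.
Qed.

Lemma upper_arith (R : realType) (k1 k2 xs xss B B1 T q e : R) :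
  0 <= k1 -> 0 <= k2 -> 0 <= B1 -> 0 <= xs -> xs <= e -> T <= B1 -> xss * q <= B * e ->
  2 * (k1 * xs) * T + 4 * (k1 * k2 * xss) * q + e <=
  (2 * k1 * B1 + 4 * (k1 * k2) * B + 1) * e.
Proof.
move=> k10 k20 B10 xs0 xse TB xq.
have h1 : k1 * (xs * T) <= k1 * (B1 * e).
  rewrite ler_wpM2l// [leRHS]mulrC; apply: (@le_trans _ _ (xs * B1)); first by rewrite ler_wpM2l.
  by rewrite ler_wpM2r.
have h2 : k1 * k2 * (xss * q) <= k1 * k2 * (B * e) by rewrite ler_wpM2l// mulr_ge0.
rewrite (_ : 2 * (k1 * xs) * T = 2 * (k1 * (xs * T))); last by ring.
rewrite (_ : 4 * (k1 * k2 * xss) * q = 4 * (k1 * k2 * (xss * q))); last by ring.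
rewrite (_ : _ * e = 2 * (k1 * (B1 * e)) + 4 * (k1 * k2 * (B * e)) + e); last by ring.
rewrite lerD2r.
by apply: lerD; rewrite ler_pM2l.
Qed.

(** * Boundary estimates by barriers *)

Section boundary_estimates.
Context {R : realType} {n : nat}.
Variables (Omega : set 'rV[R]_n) (a : 'I_n -> 'I_n -> 'rV[R]_n -> R)
  (b : 'I_n -> 'rV[R]_n -> R) (c : 'rV[R]_n -> R) (p lam M K R0 : R).
Hypothesis p1 : 1 < p.
Hypothesis oO : open Omega.
Hypothesis bO : bounded_set Omega.
Hypothesis lam0 : 0 < lam.
Hypothesis M0 : 0 <= M.
Hypothesis K0 : 0 <= K.
Hypothesis ell : elliptic_bounded Omega a b lam M.
Hypothesis cK : forall x, Omega x -> 0 <= c x <= K.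
Hypothesis R00 : 0 < R0.

Lemma touch_pointwise w g (x0 : 'rV[R]_n) (q : 'I_n -> R) (X : 'I_n -> 'I_n -> R) (e : R) :
  touch_subsolution Omega a b c w g -> Omega x0 -> (forall i j, X i j = X j i) ->
  touch_above w x0 q X -> 0 < e ->
  ~ \forall y \near x0, Omega y ->
      \sum_i \sum_j a i j y * X i j + \sum_i b i y * q i + e <= g y + c y * w y.
Proof.
move=> tw Ox0 sX tau e0 H; have [r r0 rP] := near_ccube H.
apply: (tw x0 q X e r Ox0 sX tau e0 r0); apply: aeW => y yr Oy; exact: rP.
Qed.

Lemma radial_hessian_sym (f1 f2 : R) (z : 'rV[R]_n) i j :
  2 * f1 * (i == j)%:R + 4 * f2 * z 0 i * z 0 j = 2 * f1 * (j == i)%:R + 4 * f2 * z 0 j * z 0 i.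
Proof. by rewrite eq_sym; ring. Qed.

(** If the barrier exceeded u somewhere, psi - u would have a positive maximum in Omega by blow-up,
    and there -psi would touch -u from above as a strict supersolution. *)
Lemma blowup_lower_bound (u : 'rV[R]_n -> R) (delta1 r1 : R) :
  0 < delta1 < 1 -> 0 < r1 -> uniform_exterior_ball Omega delta1 r1 ->
  (forall x, Omega x -> {for x, continuous u}) -> boundary_blowup Omega u ->
  touch_subsolution Omega a b c (fun x => - u x) (fun x => - pos_power p u x) ->
  exists2 c0 : R, 0 < c0 & forall x z r, Omega x -> boundary Omega z -> 0 < r <= R0 ->
    nsq (x - z) <= r ^+ 2 -> c0 * growth p r <= u x.
Proof.
move=> /andP[del0 del1] r10 ext cu bu tu.
have [D2 D20 OD] := bounded_nsq_le bO.
(* Q bounds |x' - y|^2 over Omega, and also 8 r^2, so that the subtracted constant is at most half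
   of the barrier where |x - y|^2 <= 4 r^2. *)
pose Q := 8 * D2 + 16 * R0 ^+ 2 + 1.
have R02 : 0 < R0 ^+ 2 by rewrite exprn_gt0.
have Q1 : 1 <= Q by rewrite /Q; lra.
(* A large exponent makes the second radial derivative beat the first-order terms and c; the other
   condition is that of [lower_barrier_power]. *)
have [k kP] : exists k : nat,
    2 * (n%:R * M * (1 + Q)) + 2 + K * Q <= 4 * k.+2%:R * lam /\ 1 <= k.+1%:R * (p - 1).
  have [k1 k1P] := archi_ge ((2 * (n%:R * M * (1 + Q)) + 2 + K * Q) / (4 * lam)).
  have [k2 k2P] := archi_ge ((p - 1)^-1).
  exists (k1 + k2)%N; split.
    move: k1P; rewrite ler_pdivrMr ?mulr_gt0// => /le_trans; apply.
    by rewrite mulrCA mulrA ler_pM2r// ler_pM2l// ler_nat !leqW// leq_addr.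
  move: k2P; rewrite -div1r ler_pdivrMr ?subr_gt0// => /le_trans; apply.
  by rewrite ler_pM2r ?subr_gt0// ler_nat leqW// leq_addl.
move: kP => [k1 k2].
(* Exterior balls exist only at radii below r1. The fixed factor sg brings every r <= R0 into that
   range while the ball keeps a radius proportional to r. *)
have [sg sg0 [sg1 sgr]] : exists2 sg : R, 0 < sg & sg <= 1 /\ sg * R0 < r1.
  exists (Num.min 1 (r1 / (2 * R0))); first by rewrite lt_min ltr01 divr_gt0// mulr_gt0.
  split; first by rewrite ge_min lexx.
  apply: (@le_lt_trans _ _ (r1 / (2 * R0) * R0)).
    by rewrite ler_wpM2r ?(ltW R00)// ge_min lexx orbT.
  rewrite (_ : r1 / (2 * R0) * R0 = r1 / 2); first lra.
  by field; rewrite gt_eqF.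
have [ta taE] : exists ta, ta = delta1 * sg by exists (delta1 * sg).
have ta0 : 0 < ta by rewrite taE mulr_gt0.
exists (2^-1 * (ta ^+ 2 / 4) ^+ k.+1 * growth p ta).
  by rewrite !mulr_gt0 ?exprn_gt0 ?divr_gt0 ?exprn_gt0 ?growth_gt0.
move=> x z r Ox bz /andP[r0 rR] xz.
have sgr0 : 0 < sg * r < r1.
  by rewrite mulr_gt0//= (le_lt_trans _ sgr)// ler_pM2l.
have [y yP] := ext z (sg * r) bz sgr0.
have [rho rhoE0] : exists rho, rho = ta * r by exists (ta * r).
have rho0 : 0 < rho by rewrite rhoE0 mulr_gt0.
have rhoE : rho = delta1 * (sg * r) by rewrite rhoE0 taE mulrA.
have rho20 : 0 < rho ^+ 2 by rewrite exprn_gt0.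
have yz : nsq (y - z) <= r ^+ 2.
  have [] : (eucl_ball z (sg * r) `\` closure Omega) y.
    by apply: yP; rewrite /eucl_ball /= -rhoE eucl_norm_lt// subrr nsq0.
  rewrite /eucl_ball /= eucl_norm_lt; last by case/andP: sgr0.
  move=> /ltW/le_trans h _; apply: h; rewrite exprMn ler_piMl ?sqr_ge0//.
  by rewrite expr_le1// ltW.
have far x' : Omega x' -> rho ^+ 2 <= nsq (x' - y).
  move=> Ox'; rewrite leNgt; apply/negP => h.
  have [] : (eucl_ball z (sg * r) `\` closure Omega) x'.
    by apply: yP; rewrite /eucl_ball /= -rhoE eucl_norm_lt.
  by move=> _; apply; exact: subset_closure.
have xy : nsq (x - y) <= 4 * r ^+ 2.
  have -> : x - y = (x - z) + (z - y) by rewrite addrA subrK.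
  by apply: (le_trans (nsqD_le _ _)); rewrite (nsqBC z y); lra.
have rR2 : r ^+ 2 <= R0 ^+ 2 by apply: lerXn2r; rewrite // nnegrE ltW.
have nearQ x' : Omega x' -> nsq (x' - y) <= Q.
  move=> Ox'; have -> : x' - y = (x' - x) + (x - y) by rewrite addrA subrK.
  have := nsqD_le (x' - x) (x - y); have := nsqD_le x' (- x); rewrite nsqN.
  by have := OD x Ox; have := OD x' Ox'; rewrite /Q; lra.
pose A := growth p rho * (rho ^+ 2) ^+ k.+1.
have A0 : 0 < A by rewrite mulr_gt0 ?growth_gt0// exprn_gt0.
pose psi x := A * (0 + 1 * nsq (x - y))^-1 ^+ k.+1 - A * Q^-1 ^+ k.+1.
suff : psi x <= u x.
  apply: le_trans; rewrite /psi add0r mul1r.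
  pose W := (4 * r ^+ 2)^-1 ^+ k.+1.
  have r20 : 0 < 4 * r ^+ 2 by rewrite mulr_gt0// exprn_gt0.
  have W0 : 0 < W by rewrite exprn_gt0// invr_gt0.
  have AW : (ta ^+ 2 / 4) ^+ k.+1 * growth p ta * growth p r = A * W.
    rewrite /A /W -[RHS]mulrA -[in RHS]exprMn rhoE0 growthM ?(ltW ta0) ?(ltW r0)//.
    rewrite [in RHS](_ : (ta * r) ^+ 2 / (4 * r ^+ 2) = ta ^+ 2 / 4); first by ring.
    by field; exact: lt0r_neq0.
  have WQ : Q^-1 ^+ k.+1 <= 2^-1 * W.
    apply: (@le_trans _ _ ((8 * r ^+ 2)^-1 ^+ k.+1)).
      by apply: invr_power_le; rewrite /Q; lra.
    have -> : (8 * r ^+ 2)^-1 = 2^-1 * (4 * r ^+ 2)^-1 by field; exact: lt0r_neq0.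
    rewrite exprMn ler_wpM2r ?(ltW W0)// exprS ler_piMr// ?exprn_ile1//.
    by rewrite invf_le1// ler1n.
  have sW : W <= (nsq (x - y))^-1 ^+ k.+1.
    by apply: invr_power_le => //; apply: lt_le_trans rho20 (far x Ox).
  have h1 := ler_wpM2l (ltW A0) WQ; have h2 := ler_wpM2l (ltW A0) sW.
  rewrite (_ : _ * growth p ta * growth p r = 2^-1 * (A * W)); last by rewrite -AW !mulrA.
  by move: h1 h2; rewrite mulrCA; move: (A * W) (A * _) (A * _) => ? ? ?; lra.
apply: contrapT => /negP; rewrite -ltNge => upsi.
have [x0 Ox0 x0max] : exists2 x0, Omega x0 & forall x, Omega x -> psi x - u x <= psi x0 - u x0.
  apply: (@blowup_max _ _ Omega u psi (A * (rho ^+ 2)^-1 ^+ k.+1)) => //.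
  - by exists x.
  - move=> x' Ox'; have FF : Filter (nbhs x') := nbhs_filter x'.
    have c1 : 0 + 1 * nsq (x' - y) != 0.
      by rewrite add0r mul1r gt_eqF// (lt_le_trans rho20)// far.
    have cb := @continuous_barrier R n 0 1 A k.+1 x' y c1.
    exact: (cvgB cb (cvg_cst (A * Q^-1 ^+ k.+1))).
  - move=> x' Ox'; rewrite /psi add0r mul1r lerBlDr.
    rewrite (le_trans (y := A * (rho ^+ 2)^-1 ^+ k.+1))//.
      by rewrite ler_pM2l// invr_power_le// far.
    by rewrite lerDl mulr_ge0 ?(ltW A0)// exprn_ge0// invr_ge0; lra.
have {}upsi : u x0 < psi x0.
  by rewrite -subr_gt0; apply: lt_le_trans (x0max x Ox); rewrite subr_gt0.
pose t := nsq (x0 - y).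
have rhot : rho ^+ 2 <= t by exact: far.
have t0 : 0 < t by exact: lt_le_trans rhot.
have tQ : t <= Q by exact: nearQ.
pose xi := A * t^-1 ^+ k.+1.
have xi0 : 0 < xi by rewrite mulr_gt0// exprn_gt0// invr_gt0.
have psixi : psi x0 <= xi.
  rewrite /psi add0r mul1r lerBlDr lerDl mulr_ge0 ?(ltW A0)// exprn_ge0// invr_ge0; lra.
have xip : xi `^ p <= xi / t.
  have -> : xi = growth p rho * (rho ^+ 2 / t) ^+ k.+1 by rewrite /xi /A -mulrA -exprMn.
  exact: lower_barrier_power.
have s0 : 0 < 0 + 1 * nsq (x0 - y) by rewrite add0r mul1r.
have tay := @inv_power_taylor R 0 1 (- A) k (nsq (x0 - y)) (expr1n _ _) s0.
have umax : \forall x \near x0, - u x - (- A * (0 + 1 * nsq (x - y))^-1 ^+ k.+1) <=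
    - u x0 - (- A * (0 + 1 * nsq (x0 - y))^-1 ^+ k.+1).
  apply: filterS (open_nbhs_nbhs (conj oO Ox0)) => x' /x0max; rewrite /psi !mulNr !opprK.
  by move: (A * _ ^+ _) (A * Q^-1 ^+ _) (A * _ ^+ _) (u x') (u x0) => *; lra.
have touch := radial_touch tay umax.
have eps0 : 0 < xi / t by rewrite divr_gt0.
apply: (touch_pointwise tu Ox0 (radial_hessian_sym _ _ _) touch eps0).
(* Near the touching point u stays below the barrier value, which controls both the nonlinearity and
   c u. *)
have uy : \forall y \near x0, u y < psi x0 by exact: (cvgr_lt _ (cu x0 Ox0)).
apply: filterS uy => y' uy' Oy'; have [sa la aM bM] := ell Oy'.
rewrite radial_operatorE.
set f1 := - 1 * _ * - A * _; set f2 := _ * - A * _.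
have f1E : f1 = k.+1%:R * xi / t.
  rewrite /f1 /xi add0r mul1r -/t !exprS; field; exact: lt0r_neq0.
have f2E : f2 = - (k.+1%:R * k.+2%:R * xi / t / t).
  rewrite /f2 /xi add0r mul1r -/t !exprS; field; exact: lt0r_neq0.
have zQ i : `|(x0 - y) 0 i| <= Q.
  rewrite -(@ler_pXn2r _ 2)// ?nnegrE// ?(le_trans ler01 Q1)//.
  rewrite -normrX ger0_norm ?sqr_ge0//; apply: (le_trans (sqr_coord_le _ _)).
  by apply: (le_trans tQ); rewrite expr2 ler_peMr// (le_trans ler01 Q1).
have S1 := le_trans (ler_norm _) (first_order_le aM bM zQ).
have S2 := la (x0 - y); rewrite -/(nsq _) -/t in S2.
have Pe : pos_power p u y' <= xi / t.
  by apply: le_trans xip; apply: pos_power_le; rewrite ?(ltW xi0) ?(ltW (lt_le_trans uy' psixi))// (le_trans ler01 (ltW p1)).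
have cu' : c y' * u y' <= K * Q * (xi / t).
  have /andP[c0 cK'] := cK Oy'.
  apply: (@le_trans _ _ (c y' * xi)); first by rewrite ler_wpM2l// (ltW (lt_le_trans uy' psixi)).
  rewrite -mulrA ler_pM ?(ltW xi0)// mulrCA ler_peMr ?(ltW xi0)//.
  by rewrite ler_pdivlMr// mul1r.
rewrite mulrN f1E f2E; apply: lower_arith Pe cu'; [|by []|by rewrite mulr_ge0// (le_trans ler01 Q1)|exact: eps0|exact: k1|exact: S1|exact: S2|exact: t0].
by rewrite ler1n.
Qed.

(** The barrier is infinite on the sphere, where u is bounded, so u - psi could be positive only
    with an interior maximum; there psi is a strict supersolution once C is large. No boundary
    behaviour of u is involved. *)
Lemma interior_upper_bound (u : 'rV[R]_n -> R) :
  (forall x, Omega x -> {for x, continuous u}) ->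
  touch_subsolution Omega a b c u (pos_power p u) ->
  exists2 C : R, 0 < C & forall (x0 : 'rV[R]_n) (r : R), 0 < r <= R0 ->
    (forall y : 'rV[R]_n, nsq (y - x0) <= r ^+ 2 -> Omega y) -> u x0 <= C * growth p r.
Proof.
move=> cu tu.
have [k kp] : exists k : nat, 2 <= k.+1%:R * (p - 1).
  have [k kP] := archi_ge (2 / (p - 1)); exists k.
  move: kP; rewrite ler_pdivrMr ?subr_gt0// => /le_trans; apply.
  by rewrite ler_pM2r ?subr_gt0// ler_nat.
have [B BE] : exists B, B = n%:R * M by exists (n%:R * M).
have B0 : 0 <= B by rewrite BE mulr_ge0.
have R01 : 0 <= 1 + R0 by rewrite addr_ge0// ltW.
(* The operator applied to the barrier is at most C1 e, with e as below; one more e is the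
   strictness, and C^(p-1) = C1 + 1 pays for both. *)
pose C1 := 2 * k.+1%:R * (B * (1 + R0)) + 4 * (k.+1%:R * k.+2%:R) * B.
have C10 : 0 <= C1.
  by rewrite addr_ge0 ?mulr_ge0.
have C11 : 0 < C1 + 1 by exact: ltr_wpDl.
have [C C0 CE] : exists2 C : R, 0 < C & C `^ (p - 1) = C1 + 1.
  exists ((C1 + 1) `^ (p - 1)^-1); first exact: powR_gt0.
  by rewrite -powRrM mulVf ?powRr1 ?(ltW C11)// gt_eqF// subr_gt0.
exists C => // x0 r /andP[r0 rR] rO.
have r20 : 0 < r ^+ 2 by rewrite exprn_gt0.
pose A := C * growth p r * (r ^+ 2) ^+ k.+1.
have A0 : 0 < A by rewrite !mulr_gt0 ?growth_gt0// exprn_gt0.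
pose psi y := A * (r ^+ 2 + -1 * nsq (y - x0))^-1 ^+ k.+1.
have psix0 : psi x0 = C * growth p r.
  rewrite /psi subrr nsq0 mulr0 addr0 /A -mulrA -exprMn divff ?expr1n ?mulr1//.
  exact: lt0r_neq0.
rewrite -psix0 leNgt; apply/negP => upsi.
have [xm _ xmP] : exists2 xm, [set y : 'rV[R]_n | nsq (y - x0) <= r ^+ 2] xm &
    forall y : 'rV[R]_n, nsq (y - x0) <= r ^+ 2 -> u y <= u xm.
  apply: (@compact_max R n [set y : 'rV[R]_n | nsq (y - x0) <= r ^+ 2] u _ (@compact_nsq_ball R n x0 (r ^+ 2))).
    by exists x0; rewrite /= subrr nsq0 ltW.
  by move=> y yr; apply: cu; exact: rO.
(* On the sphere |x - x0|^2 = r^2 - s1 the barrier already exceeds the maximum of u, so the problem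
   moves to a slightly smaller closed ball where psi is continuous. *)
have [s1 s10 [s1r s1U]] : exists2 s1 : R, 0 < s1 & s1 < r ^+ 2 /\ u xm <= A * s1^-1 ^+ k.+1.
  pose V := `|u xm| + 1; have V0 : 0 < V by rewrite ltr_wpDl.
  pose s1 := Num.min (r ^+ 2 / 2) (Num.min 1 (A / V)).
  have s10 : 0 < s1 by rewrite !lt_min ltr01 !divr_gt0.
  exists s1 => //; split.
    apply: (@le_lt_trans _ _ (r ^+ 2 / 2)); first by rewrite ge_min lexx.
    by rewrite ltr_pdivrMr// ltr_pMr// ltr1n.
  have s11 : s1 <= 1 by rewrite !ge_min lexx !orbT.
  have s1V : s1 <= A / V by rewrite !ge_min lexx !orbT.
  have i1 : 1 <= s1^-1 by rewrite invf_ge1.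
  apply: (@le_trans _ _ (A * s1^-1)); last first.
    by rewrite ler_pM2l// exprS ler_peMr ?invr_ge0 ?(ltW s10)// exprn_ege1.
  apply: (le_trans (ler_norm _)); rewrite ler_pdivlMr//.
  move: s1V; rewrite ler_pdivlMr//; apply: le_trans; rewrite mulrC ler_wpM2l ?(ltW s10)//.
  by rewrite lerDl.
pose Kb := [set y : 'rV[R]_n | nsq (y - x0) <= r ^+ 2 - s1].
have KbO y : Kb y -> Omega y by rewrite /Kb/= => h; apply: rO; rewrite (le_trans h)// gerBl ltW.
have Kbs y : Kb y -> s1 <= r ^+ 2 + -1 * nsq (y - x0) by rewrite /Kb/=; lra.
have Kb0 : Kb x0 by rewrite /Kb/= subrr nsq0 subr_ge0 ltW.
have [x1 Kx1 x1max] : exists2 x1, Kb x1 & forall y, Kb y -> u y - psi y <= u x1 - psi x1.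
  apply: (@compact_max R n Kb (fun y => u y - psi y) _ (@compact_nsq_ball R n x0 (r ^+ 2 - s1))); first by exists x0.
  move=> y Ky; have FF : Filter (nbhs y) := nbhs_filter y.
  have s0 : r ^+ 2 + -1 * nsq (y - x0) != 0 by apply/lt0r_neq0/(lt_le_trans s10)/Kbs.
  have cb := @continuous_barrier R n (r ^+ 2) (-1) A k.+1 y x0 s0.
  exact: (cvgB (cu y (KbO y Ky)) cb).
have {}upsi : psi x1 < u x1.
  by rewrite -subr_gt0; apply: lt_le_trans (x1max x0 Kb0); rewrite subr_gt0.
have Ox1 := KbO x1 Kx1.
have [s sE] : exists s, s = r ^+ 2 + -1 * nsq (x1 - x0) by exists (r ^+ 2 + -1 * nsq (x1 - x0)).
have s1s : s1 <= s by rewrite sE; exact: Kbs.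
have s0 : 0 < s by exact: lt_le_trans s1s.
have sr : s <= r ^+ 2 by rewrite sE mulN1r lerBlDr lerDl nsq_ge0.
have zr : nsq (x1 - x0) <= r ^+ 2 by move: s0; rewrite sE; lra.
have inner : nsq (x1 - x0) < r ^+ 2 - s1.
  rewrite lt_neqAle; apply/andP; split => //; apply/negP => /eqP h.
  move: upsi; rewrite ltNge => /negP; apply; apply: (le_trans (xmP x1 zr)).
  by rewrite /psi h (_ : r ^+ 2 + -1 * (r ^+ 2 - s1) = s1)//; ring.
have Knear : \forall y \near x1, Kb y.
  have cN := @continuous_nsq R n x0 x1.
  have h : \forall y \near x1, nsq (y - x0) < r ^+ 2 - s1 by exact: (cvgr_lt _ cN).
  by apply: filterS h => y /ltW.
have umax : \forall y \near x1, u y - psi y <= u x1 - psi x1.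
  by apply: filterS Knear => y; exact: x1max.
have s0' : 0 < r ^+ 2 + -1 * nsq (x1 - x0) by rewrite -sE.
have m1 : (-1) ^+ 2 = 1 :> R by rewrite sqrrN expr1n.
have tay := @inv_power_taylor R (r ^+ 2) (-1) A k (nsq (x1 - x0)) m1 s0'.
have touch := radial_touch tay umax.
have [xi xiD] : exists xi, xi = psi x1 by exists (psi x1).
have xiE : xi = C * growth p r * (r ^+ 2 / s) ^+ k.+1.
  by rewrite xiD /psi -sE /A -mulrA -exprMn.
have xi0 : 0 < xi by rewrite xiE !mulr_gt0 ?growth_gt0// exprn_gt0// divr_gt0.
have [e eE] : exists e, e = xi * r ^+ 2 / s ^+ 2 by exists (xi * r ^+ 2 / s ^+ 2).
have eps0 : 0 < e by rewrite eE divr_gt0// ?exprn_gt0// mulr_gt0.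
have xip : (C1 + 1) * e <= xi `^ p.
  rewrite -CE eE xiE; have := @upper_barrier_power R p p1 r s C k.+1.
  by rewrite s0 sr !mulrA; apply.
apply: (touch_pointwise tu Ox1 (radial_hessian_sym _ _ _) touch eps0).
have uy : \forall y \near x1, xi < u y by rewrite xiD; exact: (cvgr_gt _ (cu x1 Ox1)).
apply: filterS uy => y' uy' Oy'; have [sa la aM bM] := ell Oy'.
rewrite radial_operatorE -sE.
set f1 := - -1 * _ * A * _; set f2 := _ * A * _.
have f1E : f1 = k.+1%:R * (xi / s).
  rewrite /f1 xiD /psi -sE !exprS; field; exact: lt0r_neq0.
have f2E : f2 = k.+1%:R * k.+2%:R * (xi / s ^+ 2).
  rewrite /f2 xiD /psi -sE !exprS; field; exact: lt0r_neq0.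
have zQ i : `|(x1 - x0) 0 i| <= R0.
  rewrite -(@ler_pXn2r _ 2)// ?nnegrE ?(ltW R00)//.
  rewrite -normrX ger0_norm ?sqr_ge0//; apply: (le_trans (sqr_coord_le _ _)).
  by apply: (le_trans zr); apply: lerXn2r; rewrite // nnegrE ltW.
have S1 := le_trans (ler_norm _) (first_order_le aM bM zQ).
have S2 := qform_le aM (x1 - x0); rewrite -BE in S1 S2.
have Pe : xi `^ p <= pos_power p u y'.
  by apply: pos_power_ge; rewrite ?(ltW xi0) ?(ltW uy')// (le_trans ler01 (ltW p1)).
have cu0 : 0 <= c y' * u y'.
  by have /andP[c0 _] := cK Oy'; rewrite mulr_ge0// (le_trans (ltW xi0))// ltW.
apply: (@le_trans _ _ (xi `^ p)); last by rewrite -[leLHS]addr0 lerD.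
have h1 : xi / s <= e.
  rewrite eE -mulrA ler_pM2l// ler_pdivlMr ?exprn_gt0// expr2 mulrA mulVf ?mul1r//.
  exact: lt0r_neq0.
have h2 : xi / s ^+ 2 * qform (fun i j => a i j y') (x1 - x0) <= B * e.
  apply: (@le_trans _ _ (xi / s ^+ 2 * (B * r ^+ 2))).
    rewrite ler_wpM2l ?divr_ge0 ?(ltW xi0) ?sqr_ge0//; apply: (le_trans S2).
    by rewrite ler_wpM2l.
  by rewrite eE le_eqVlt; apply/orP; left; apply/eqP; ring.
apply: le_trans xip; rewrite f1E f2E; apply: (upper_arith _ _ _ _ h1 S1 h2) => //.
  by rewrite mulr_ge0.
by rewrite divr_ge0// ltW.
Qed.

End boundary_estimates.

(** * Comparison of two solutions *)

Lemma powR_pred (R : realType) (p x : R) : 0 < x -> x `^ p = x * x `^ (p - 1).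
Proof.
move=> x0; rewrite -[X in _ = X * _](powRr1 (ltW x0)) -powRD; last by rewrite (gt_eqF x0) implybT.
by congr (_ `^ _); ring.
Qed.

(** k^p - k is a product of the nonnegative increasing factors k and k^(p-1) - 1. The gain in the
    comparison can therefore be bounded below independently of k. *)
Lemma powR_sub_le (R : realType) (p k1 k : R) : 1 < p -> 1 < k1 -> k1 <= k ->
  k1 `^ p - k1 <= k `^ p - k.
Proof.
move=> p1 k11 k1k; have k10 : 0 < k1 by lra.
have k0 : 0 < k by apply: lt_le_trans k1k; exact: lt_trans k11.
have E (x : R) : 0 < x -> x `^ p - x = x * (x `^ (p - 1) - 1).
  by move=> x0; rewrite [in LHS](powR_pred p x0) mulrBr mulr1.
rewrite !E//; apply: ler_pM => //; first exact: ltW.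
  rewrite subr_ge0; have := @ler_powR _ k1 (ltW k11) 0 (p - 1); rewrite powRr0; apply.
  by rewrite subr_ge0 ltW.
rewrite lerD2r; apply: ge0_ler_powR; rewrite ?nnegrE ?subr_ge0 ?(ltW p1) ?(ltW k0) ?(ltW k10)//.
Qed.

Lemma powR_sub_gt0 (R : realType) (p k : R) : 1 < p -> 1 < k -> 0 < k `^ p - k.
Proof.
move=> p1 k1; have k0 : 0 < k by exact: lt_trans ltr01 k1.
rewrite [in ltRHS](powR_pred p k0) -[X in _ - X]mulr1 -mulrBr.
rewrite mulr_gt0// subr_gt0.
have := @gt0_ltr_powR R (p - 1); rewrite subr_gt0 => /(_ p1 1 k).
by rewrite !nnegrE powR1; apply=> //; exact: ltW.
Qed.

Section comparison.
Context {R : realType} {n : nat}.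
Variables (Omega : set 'rV[R]_n) (a : 'I_n -> 'I_n -> 'rV[R]_n -> R)
  (b : 'I_n -> 'rV[R]_n -> R) (c : 'rV[R]_n -> R) (p lam M K : R).
Hypothesis n0 : (0 < n)%N.
Hypothesis p1 : 1 < p.
Hypothesis oO : open Omega.
Hypothesis bO : bounded_set Omega.
Hypothesis lam0 : 0 < lam.
Hypothesis M0 : 0 <= M.
Hypothesis K0 : 0 <= K.
Hypothesis ell : elliptic_bounded Omega a b lam M.
Hypothesis cK : forall x, Omega x -> 0 <= c x <= K.
Variables (delta1 r1 : R).
Hypothesis del01 : 0 < delta1 < 1.
Hypothesis r10 : 0 < r1.
Hypothesis ext : uniform_exterior_ball Omega delta1 r1.

(** r is half the distance to the boundary: points of the ball of radius r around x are at distance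
    at most 4 r from z and are themselves centres of balls of radius r/2 in Omega. The bound R0 on 4
    r lets the barrier estimates apply at all these radii. *)
Lemma inner_radius : exists2 R0 : R, 0 < R0 & forall x, Omega x -> exists r z,
  [/\ 0 < r, 4 * r <= R0, boundary Omega z, nsq (x - z) = 4 * r ^+ 2 &
    forall y, nsq (y - x) < 4 * r ^+ 2 -> Omega y].
Proof.
have [D2 D20 OD] := bounded_nsq_le bO.
exists (4 * (1 + D2)); first lra.
move=> x Ox; have [z [bz zx zO]] := exists_nearest_boundary n0 oO bO Ox.
have zD : nsq z <= D2.
  have cl : closed [set y : 'rV[R]_n | nsq (y - 0) <= D2].
    by apply: compact_closed (@compact_nsq_ball R n 0 D2); exact: norm_hausdorff.
  have [clz _] := bz; have : closure [set y : 'rV[R]_n | nsq (y - 0) <= D2] z.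
    by apply: closureS clz => y /OD; rewrite /= subr0.
  by rewrite -(closure_id _).1//= subr0.
pose r := Num.sqrt (nsq (z - x)) / 2.
have r0 : 0 < r by rewrite divr_gt0// sqrtr_gt0.
have rE : 4 * r ^+ 2 = nsq (z - x).
  by rewrite /r expr_div_n sqr_sqrtr ?nsq_ge0//; field.
exists r, z; split=> //; last by rewrite rE.
  rewrite ler_pM2l//; have := nsqD_le z (- x); rewrite nsqN -rE => h.
  have := OD x Ox; have := sqr_ge0 (r - 1); nra.
by rewrite rE nsqBC.
Qed.

Variables u v : 'rV[R]_n -> R.
Hypothesis cu : forall x, Omega x -> {for x, continuous u}.
Hypothesis cv : forall x, Omega x -> {for x, continuous v}.
Hypothesis bu : boundary_blowup Omega u.
Hypothesis bv : boundary_blowup Omega v.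
Hypothesis tuv : forall s t : R, touch_subsolution Omega a b c
  (fun x => s * u x + t * v x) (fun x => s * pos_power p u x + t * pos_power p v x).

Lemma comparison x : Omega x -> u x <= v x.
Proof.
move=> Ox; rewrite leNgt; apply/negP => vu.
have fE (f g : 'rV[R]_n -> R) (s t : R) h : (forall y, s * f y + t * g y = h y) ->
  (fun y => s * f y + t * g y) = h by move=> H; apply/funext.
have tu : touch_subsolution Omega a b c u (pos_power p u).
  by have := @tuv 1 0; rewrite (fE u v 1 0 u) ?(fE _ _ 1 0 (pos_power p u))// => y; ring.
have tv : touch_subsolution Omega a b c v (pos_power p v).
  by have := @tuv 0 1; rewrite (fE u v 0 1 v) ?(fE _ _ 0 1 (pos_power p v))// => y; ring.
have tNv : touch_subsolution Omega a b c (fun x => - v x) (fun x => - pos_power p v x).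
  have := @tuv 0 (-1); rewrite (fE u v 0 (-1) (fun y => - v y)) => [|y]; last by ring.
  by rewrite (fE _ _ 0 (-1) (fun y => - pos_power p v y))// => y; ring.
have [R0 R00 rad] := inner_radius.
have [cl cl0 low] := blowup_lower_bound p1 oO bO lam0 K0 ell cK R00 del01 r10 ext cv bv tNv.
have [Cu Cu0 upu] := interior_upper_bound p1 M0 ell cK R00 cu tu.
have [Cv Cv0 upv] := interior_upper_bound p1 M0 ell cK R00 cv tv.
have v0 y : Omega y -> 0 < v y.
  move=> Oy; have [r [z [r0 rR bz yz _]]] := rad y Oy.
  apply: (@lt_le_trans _ _ (cl * growth p (2 * r))).
    by rewrite mulr_gt0// growth_gt0// mulr_gt0.
  apply: (low y z) => //; first by rewrite mulr_gt0//=; lra.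
  by rewrite yz exprMn; lra.
pose S := [set u y / v y | y in Omega].
have ubS : has_ubound S.
  exists (Cu / (cl * growth p 2)) => _ [y Oy <-].
  have [r [z [r0 rR bz yz yO]]] := rad y Oy.
  have h1 : u y <= Cu * growth p r.
    apply: upu; first by rewrite r0/=; lra.
    move=> y' h; apply: yO; apply: (le_lt_trans h); have : 0 < r ^+ 2 by rewrite exprn_gt0.
    lra.
  have h2 : cl * growth p (2 * r) <= v y.
    apply: (low y z) => //; first by rewrite mulr_gt0//=; lra.
    by rewrite yz exprMn; lra.
  rewrite ler_pdivrMr ?v0//; apply: (le_trans h1).
  apply: le_trans (ler_wpM2l _ h2); last first.
    by rewrite divr_ge0 ?(ltW Cu0)// mulr_ge0 ?(ltW cl0)// ltW// growth_gt0.
  rewrite growthM ?(ltW r0)// le_eqVlt; apply/orP; left; apply/eqP.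
  by field; rewrite !gt_eqF// growth_gt0.
have Sx : S (u x / v x) by exists x.
have supS : has_sup S by split; [exists (u x / v x)|].
pose ks := sup S.
have ks1 : 1 < ks.
  apply: (@lt_le_trans _ _ (u x / v x)); first by rewrite ltr_pdivlMr ?mul1r ?v0.
  exact: ub_le_sup.
have ksP y : Omega y -> u y <= ks * v y.
  by move=> Oy; rewrite -ler_pdivrMr ?v0//; apply: ub_le_sup => //; exists y.
(* Any fixed value strictly between 1 and the supremum; c1, th and th' may depend on it but not on k
   >= k1. *)
pose k1 := (1 + ks) / 2.
have k11 : 1 < k1 by rewrite /k1; lra.
have k1s : k1 < ks by rewrite /k1; lra.
have k1p := powR_sub_gt0 p1 k11.
pose B := n%:R * M * (1 + R0).
have B0 : 0 <= B by rewrite !mulr_ge0// addr_ge0// ltW.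
have [c1 c10 c1E] : exists2 c1 : R, 0 < c1 & c1 = (k1 `^ p - k1) * (cl * growth p 4) `^ p.
  exists ((k1 `^ p - k1) * (cl * growth p 4) `^ p) => //.
  by rewrite mulr_gt0// powR_gt0// mulr_gt0// growth_gt0.
(* The operator applied to ka |y - x0|^2 is at most 2 ka B, and the strictness is ka; with ka = th
   growth(r) / r^2 both are paid by c1 growth(r) / r^2. *)
have [th th0 thE] : exists2 th : R, 0 < th & th * (2 * B + 1) = c1.
  exists (c1 / (2 * B + 1)); first by rewrite divr_gt0// ltr_wpDl// mulr_ge0.
  by rewrite divfK// gt_eqF// ltr_wpDl// mulr_ge0.
(* On the sphere v is at most Cv growth(1/2) growth(r), by the upper bound on balls of radius r/2,
   so a gain th growth(r) in u - k v is worth at least th' v. *)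
pose th' := th / (Cv * growth p (2^-1)).
have g20 : 0 < growth p (2^-1 : R) by rewrite growth_gt0// invr_gt0.
have th'0 : 0 < th' by rewrite divr_gt0// mulr_gt0.
suff step (k : R) (x0 : 'rV[R]_n) : k1 <= k -> Omega x0 -> k * v x0 < u x0 ->
    exists2 x1, Omega x1 & (k + th') * v x1 < u x1.
  (* Starting from k = ks - ep, one step reaches ks - ep + th' > ks. *)
  pose ep := Num.min (ks - k1) (th' / 2).
  have ep0 : 0 < ep by rewrite lt_min subr_gt0 k1s divr_gt0.
  have ep1 : ep <= ks - k1 by rewrite ge_min lexx.
  have ep2 : ep <= th' / 2 by rewrite ge_min lexx orbT.
  have [_ [y Oy <-] ye] := @sup_adherent _ S ep ep0 supS.
  have kk : k1 <= ks - ep by lra.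
  have [||x1 Ox1 x1P] := step (ks - ep) y kk; first exact: Oy.
    by rewrite -ltr_pdivlMr ?v0.
  have := ksP x1 Ox1; apply/negP; rewrite -ltNge; apply: le_lt_trans x1P.
  by rewrite ler_pM2r ?v0//; lra.
move=> k1k Ox0 kvu.
have [r [z [r0 rR bz x0z rO]]] := rad x0 Ox0.
have r20 : 0 < r ^+ 2 by rewrite exprn_gt0.
have rR1 : r <= R0 by apply: le_trans rR; rewrite ler_peMl ?(ltW r0)// ler1n.
have g0 := growth_gt0 p r0.
pose w y := 1 * u y + - k * v y.
pose ka := th * growth p r / r ^+ 2.
have ka0 : 0 < ka by rewrite divr_gt0// mulr_gt0.
have Or y : nsq (y - x0) <= r ^+ 2 -> Omega y by move=> h; apply: rO; lra.
have cw y : Omega y -> {for y, continuous w}.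
  move=> Oy; have FF : Filter (nbhs y) := nbhs_filter y.
  exact: (cvgD (@cvgMl_tmp R _ (nbhs y) FF u 1 _ (cu Oy)) (@cvgMl_tmp R _ (nbhs y) FF v (- k) _ (cv Oy))).
have [x1 /= x1r x1max] : exists2 x1, [set y : 'rV[R]_n | nsq (y - x0) <= r ^+ 2] x1 &
    forall y : 'rV[R]_n, nsq (y - x0) <= r ^+ 2 -> w y - ka * nsq (y - x0) <= w x1 - ka * nsq (x1 - x0).
  apply: (@compact_max R n [set y : 'rV[R]_n | nsq (y - x0) <= r ^+ 2] (fun y => w y - ka * nsq (y - x0)) _
    (@compact_nsq_ball R n x0 (r ^+ 2))).
    by exists x0; rewrite /= subrr nsq0 ltW.
  move=> y /= yr; have FF : Filter (nbhs y) := nbhs_filter y.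
  exact: (cvgB (cw y (Or y yr)) (@cvgMl_tmp R _ (nbhs y) FF _ ka _ (@continuous_nsq R n x0 y))).
have Ox1 := Or x1 x1r.
have wx0 : 0 < w x0 by rewrite /w mul1r mulNr subr_gt0.
have wx1 : w x0 + ka * nsq (x1 - x0) <= w x1.
  have := x1max x0; rewrite subrr nsq0 mulr0 subr0 => /(_ (ltW r20)).
  by rewrite lerBrDr.
have wx1_gt0 : 0 < w x1.
  by apply: lt_le_trans wx1; rewrite ltr_wpDr// mulr_ge0 ?nsq_ge0// ltW.
have k0 : 0 < k by apply: lt_le_trans k1k; exact: lt_trans k11.
(* A maximum on the sphere gives the required point; an interior one contradicts
   [touch_subsolution]. *)
have [inner|outer] := ltP (nsq (x1 - x0)) (r ^+ 2); last first.
  exists x1 => //.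
  have h1 : th * growth p r < w x1.
    have E : ka * r ^+ 2 = th * growth p r by rewrite divfK// gt_eqF.
    rewrite -E; apply: lt_le_trans wx1; apply: (@le_lt_trans _ _ (ka * nsq (x1 - x0))).
      by rewrite ler_wpM2l// ltW.
    by rewrite ltrDr.
  have h2 : v x1 <= Cv * growth p (2^-1) * growth p r.
    rewrite -mulrA -growthM ?invr_ge0 ?(ltW r0)//; apply: upv.
      by rewrite mulr_gt0 ?invr_gt0//=; lra.
    move=> y yx; apply: rO; have -> : y - x0 = (y - x1) + (x1 - x0) by rewrite addrA subrK.
    have := nsqD_le (y - x1) (x1 - x0); move: yx; rewrite exprMn (_ : 2^-1 ^+ 2 = 4^-1); last by field.
    by move: x1r; lra.
  have h3 : th' * v x1 <= th * growth p r.
    apply: le_trans (ler_wpM2l (ltW th'0) h2) _; rewrite /th' le_eqVlt; apply/orP; left; apply/eqP.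
    by field; rewrite !gt_eqF.
  by move: h1; rewrite /w; move: h3; rewrite mulrDl; lra.
exfalso.
have tay (eta : R) : 0 < eta -> \forall t \near nsq (x1 - x0),
    `|ka * t - ka * nsq (x1 - x0) - ka * (t - nsq (x1 - x0)) - 0 / 2 * (t - nsq (x1 - x0)) ^+ 2|
      <= eta * (t - nsq (x1 - x0)) ^+ 2.
  move=> eta0; near=> t; rewrite (_ : _ - _ - _ - _ = 0); last by ring.
  by rewrite normr0 mulr_ge0 ?sqr_ge0// ltW.
have umax : \forall y \near x1, w y - ka * nsq (y - x0) <= w x1 - ka * nsq (x1 - x0).
  have h : \forall y \near x1, nsq (y - x0) < r ^+ 2 by exact: (cvgr_lt _ (@continuous_nsq R n x0 x1)).
  by apply: filterS h => y /ltW; exact: x1max.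
have touch := radial_touch tay umax.
apply: (touch_pointwise (@tuv 1 (- k)) Ox1 (radial_hessian_sym ka 0 _) touch ka0).
have wy : \forall y \near x1, 0 < w y by exact: (cvgr_gt _ (cw x1 Ox1)).
have ry : \forall y \near x1, nsq (y - x0) < r ^+ 2 by exact: (cvgr_lt _ (@continuous_nsq R n x0 x1)).
near=> y' => Oy'; have [sa la aM bM] := ell Oy'.
have wy' : 0 < w y' by near: y'.
have ry' : nsq (y' - x0) < r ^+ 2 by near: y'.
rewrite radial_operatorE mulr0 mul0r addr0.
have zQ i : `|(x1 - x0) 0 i| <= R0.
  rewrite -(@ler_pXn2r _ 2)// ?nnegrE ?(ltW R00)//.
  rewrite -normrX ger0_norm ?sqr_ge0//; apply: (le_trans (sqr_coord_le _ _)).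
  by apply: (le_trans x1r); apply: lerXn2r; rewrite ?nnegrE ?(ltW r0) ?(ltW R00).
have S1 := le_trans (ler_norm _) (first_order_le aM bM zQ).
have vl : cl * growth p 4 * growth p r <= v y'.
  rewrite -mulrA -growthM ?(ltW r0)//; apply: (low y' z) => //.
    by rewrite mulr_gt0.
  have -> : y' - z = (y' - x0) + (x0 - z) by rewrite addrA subrK.
  apply: (le_trans (nsqD_le _ _)); rewrite x0z exprMn -mulrDr.
  (* 10 r^2 <= (4 r)^2, which is where [growth p 4] in c1 comes from. *)
  apply: (@le_trans _ _ (2 * (r ^+ 2 + 4 * r ^+ 2))); first by rewrite ler_pM2l// lerD2r ltW.
  rewrite (_ : 2 * (r ^+ 2 + 4 * r ^+ 2) = 10 * r ^+ 2); last by ring.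
  by rewrite ler_wpM2r ?(ltW r20)// -natrX ler_nat.
have vy0 := v0 y' Oy'.
have uy : k * v y' < u y' by move: wy'; rewrite /w mul1r mulNr subr_gt0.
have p0 : 0 <= p := le_trans ler01 (ltW p1).
have Pu : k `^ p * v y' `^ p <= pos_power p u y'.
  rewrite -powRM ?(ltW k0) ?(ltW vy0)//.
  by apply: pos_power_ge; rewrite ?mulr_ge0 ?(ltW k0) ?(ltW vy0) ?(ltW uy).
have Pv : pos_power p v y' = v y' `^ p by rewrite /pos_power max_l// ltW.
have vp : (cl * growth p 4) `^ p * (growth p r / r ^+ 2) <= v y' `^ p.
  have g4 : 0 <= cl * growth p 4 by rewrite ltW// mulr_gt0// growth_gt0.
  have := barrier_power p1 0 r0 ltr01; rewrite expr1n mulr1 mul0r powRr0 !mulr1 => <-.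
  rewrite -(powRM p g4 (ltW g0)); apply: (ge0_ler_powR p0 _ _ vl); rewrite nnegrE ?(ltW vy0)//.
  by rewrite mulr_ge0// ltW.
have main : c1 * (growth p r / r ^+ 2) <= 1 * pos_power p u y' + - k * pos_power p v y'.
  rewrite Pv c1E -mulrA; apply: (@le_trans _ _ ((k `^ p - k) * v y' `^ p)).
    apply: ler_pM => //; first exact: ltW.
      by rewrite mulr_ge0 ?powR_ge0// divr_ge0 ?(ltW g0)// ltW.
    exact: powR_sub_le.
  by rewrite mulrBl mul1r mulNr lerD2r.
have cw0 : 0 <= c y' * (1 * u y' + - k * v y').
  by have /andP[c0 _] := cK Oy'; rewrite mulr_ge0// ltW.
apply: (@le_trans _ _ (c1 * (growth p r / r ^+ 2))); last by rewrite -[leLHS]addr0 lerD.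
rewrite -thE.
have -> : th * (2 * B + 1) * (growth p r / r ^+ 2) = 2 * ka * B + ka by rewrite /ka; ring.
have ka20 : 0 < 2 * ka by exact: mulr_gt0.
by rewrite lerD2r ler_pM2l.
Unshelve. all: by end_near.
Qed.

End comparison.

(** Entries of a positive matrix are bounded by its trace, at most n Lambda, and |b_i| <= b_i^2 + 1
    <= K + 1; the sum bounds both. *)
Lemma elliptic_bounded_of (R : realType) (n : nat) (Omega : set 'rV[R]_n)
    (a : 'I_n -> 'I_n -> 'rV[R]_n -> R) (b : 'I_n -> 'rV[R]_n -> R) (K lambda Lambda : R) :
  0 < K -> 0 < lambda <= Lambda ->
  (forall x, Omega x -> forall i j, a i j x = a j i x) ->
  (forall x, Omega x -> \sum_(i < n) b i x ^+ 2 <= K) ->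
  (forall x, Omega x -> forall xi : 'rV[R]_n,
    lambda * eucl_norm xi ^+ 2
      <= \sum_(i < n) \sum_(j < n) a i j x * xi 0 i * xi 0 j
      <= Lambda * eucl_norm xi ^+ 2) ->
  elliptic_bounded Omega a b lambda (n%:R * Lambda + K + 1).
Proof.
move=> K0 /andP[l0 lL] sa bK la x Ox.
have L0 : 0 < Lambda by exact: lt_le_trans lL.
have qa (z : 'rV[R]_n) : lambda * nsq z <= qform (fun i j => a i j x) z <= Lambda * nsq z.
  by have := la x Ox z; rewrite eucl_norm_sqr.
split.
- exact: sa.
- by move=> z; case/andP: (qa z).
- move=> i j; apply: (@le_trans _ _ (\sum_k a k k x)).
    apply: (psd_entry_le (Y := fun i j => a i j x)) => [k l|z]; first exact: sa.
    by apply: le_trans (andP (qa z)).1; rewrite mulr_ge0 ?nsq_ge0// ltW.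
  apply: (@le_trans _ _ (\sum_(k < n) Lambda)); last first.
    by rewrite sumr_const card_ord [n%:R * _]mulr_natl -addrA lerDl addr_ge0// ltW.
  apply: ler_sum => k _; have /andP[_] := qa (delta_mx 0 k); rewrite qform_delta.
  rewrite (_ : nsq (delta_mx 0 k) = 1) ?mulr1//.
  rewrite /nsq (bigD1 k)//= big1 => [|j0 /negbTE jk]; last by rewrite mxE jk andbF expr0n.
  by rewrite mxE !eqxx expr1n addr0.
move=> i; have := bK x Ox; rewrite (bigD1 i)//= => h.
have bi : b i x ^+ 2 <= K by apply: le_trans h; rewrite lerDl sumr_ge0// => j _; exact: sqr_ge0.
have nL : 0 <= n%:R * Lambda by rewrite mulr_ge0// ltW.
apply: (@le_trans _ _ (K + 1)); last by rewrite -addrA lerDr.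
rewrite ler_norml; have := sqr_ge0 (2 * b i x - 1); have := sqr_ge0 (2 * b i x + 1).
by move: (b i x) bi => t bi *; apply/andP; split; lra.
Qed.

Theorem theorem3p1 (R : realType) (n : nat) (p : R) (Omega : set 'rV[R]_n)
    (delta1 r1 : R)
    (a : 'I_n -> 'I_n -> 'rV[R]_n -> R) (b : 'I_n -> 'rV[R]_n -> R)
    (c : 'rV[R]_n -> R) (K lambda Lambda : R) :
  (2 <= n)%N -> 1 < p ->
  open Omega -> connected Omega -> Omega !=set0 -> bounded_set Omega ->
  0 < delta1 < 1 -> 0 < r1 -> uniform_exterior_ball Omega delta1 r1 ->
  (forall i j, measurable_fun [set: leb_rV R n] (a i j : leb_rV R n -> R)) ->
  (forall i, measurable_fun [set: leb_rV R n] (b i : leb_rV R n -> R)) ->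
  measurable_fun [set: leb_rV R n] (c : leb_rV R n -> R) ->
  0 < K -> 0 < lambda <= Lambda ->
  (forall x, Omega x -> forall i j, a i j x = a j i x) ->
  (forall x, Omega x -> \sum_(i < n) b i x ^+ 2 <= K) ->
  (forall x, Omega x -> 0 <= c x <= K) ->
  (forall x, Omega x -> forall xi : 'rV[R]_n,
    lambda * eucl_norm xi ^+ 2
      <= \sum_(i < n) \sum_(j < n) a i j x * xi 0 i * xi 0 j
      <= Lambda * eucl_norm xi ^+ 2) ->
  (forall u v : 'rV[R]_n -> R,
    C2_solution a b c Omega u (pos_power p u) -> boundary_blowup Omega u ->
    C2_solution a b c Omega v (pos_power p v) -> boundary_blowup Omega v ->
    forall x, Omega x -> u x = v x) /\
  (forall u v : 'rV[R]_n -> R,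
    W2n_solution a b c Omega u (pos_power p u) -> boundary_blowup Omega u ->
    W2n_solution a b c Omega v (pos_power p v) -> boundary_blowup Omega v ->
    forall x, Omega x -> u x = v x).
Proof.
move=> n2 p1 oO _ _ bO del01 r10 ext _ _ _ K0 lL sa bK cK la.
have ell := elliptic_bounded_of K0 lL sa bK la.
have [l0 lL'] := andP lL; have n0 : (0 < n)%N by exact: leq_trans n2.
have M0 : 0 <= n%:R * Lambda + K + 1.
  by rewrite !addr_ge0// ?mulr_ge0// ltW// (lt_le_trans l0).
have le u v := @comparison R n Omega a b c p lambda _ K n0 p1 oO bO l0 M0 (ltW K0) ell cK
  delta1 r1 del01 r10 ext u v.
have C2cont u f : C2_solution a b c Omega u f -> forall x, Omega x -> {for x, continuous u}.
  by move=> [Cu _] x Ox; have [+ _] := Cu x Ox [::]; exact.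
split=> u v Su bu Sv bv x Ox; apply/eqP; rewrite eq_le; apply/andP; split.
- apply: (le u v) Ox => //; [exact: C2cont Su|exact: C2cont Sv|move=> s t].
  exact: C2_touch n0 oO l0 ell Su Sv.
- apply: (le v u) Ox => //; [exact: C2cont Sv|exact: C2cont Su|move=> s t].
  exact: C2_touch n0 oO l0 ell Sv Su.
- have [cu _ _] := Su; have [cv _ _] := Sv; apply: (le u v) Ox => // s t.
  exact: W2n_touch n0 oO l0 ell Su Sv.
have [cu _ _] := Su; have [cv _ _] := Sv; apply: (le v u) Ox => // s t.
exact: W2n_touch n0 oO l0 ell Sv Su.
Qed.
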